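(* Let $\Lambda$ be a valid translation-invariant $\mathbb{Z}^2$-specification over a finite alphabet $\mathcal{A}$ with $q(\Lambda)<p_c$, and let $\mu=\mu(\Lambda)$ be its unique associated $\mathbb{Z}^2$-MRF. Let $N$ be an integer and let $t,b\in\mathcal{A}^{\mathbb{Z}}$ be sequences with period $p$ such that $1,n,t,b$ is compatible with $\Lambda$ for all $n>N$. Then there exist $Q,R>0$ such that for all $n>N$, $$\left|\frac1p\Big(h\big((\mu(\Lambda_{1,n+1,t,b}))^{[p]}\big)-h\big((\mu(\Lambda_{1,n,t,b}))^{[p]}\big)\Big)-h(\mu)\right|<Qe^{-Rn}.$$
   Context: An alphabet $\mathcal{A}$ is a finite set with at least two elements. $\mathbb{Z}^2$ also denotes the graph with vertex set $\mathbb{Z}^2$ and edges between points at $\ell^1$-distance 1. For a (countable, locally finite) graph $G$ and $S\subset V(G)$, $\partial(S,G)$ is the set of vertices outside $S$ adjacent to some element of $S$; $\partial S=\partial(S,\mathbb{Z}^2)$. All measures are Borel probability measures; a configuration $w\in\mathcal{A}^S$ with $S$ finite is identified with the cylinder set $\{x: x|_S=w\}$, so $\mu(w)$ and $\mu(w\mid u)$ make sense. Concatenation of configurations on disjoint sets is written as a product. MRF: a measure $\mu$ on $\mathcal{A}^{V(G)}$ is a $G$-MRF if for every finite $S\subset V(G)$, $\eta\in\mathcal{A}^S$, finite $T$ with $\partial(S,G)\subseteq T\subseteq V(G)\setminus S$ and $\delta\in\mathcal{A}^T$ with $\mu(\delta)\ne0$, $\mu(\eta\mid\delta|_{\partial(S,G)})=\mu(\eta\mid\delta)$.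 Specification: a $G$-specification $\Lambda$ is a family of probability measures $\Lambda^\delta$ on $\mathcal{A}^S$, one for every finite $S\subset V(G)$ and $\delta\in\mathcal{A}^{\partial(S,G)}$. A $G$-MRF $\mu$ is associated to $\Lambda$ if $\mu(\cdot\mid\delta)=\Lambda^\delta$ on $\mathcal{A}^S$ for all finite $S$ and all $\delta\in\mathcal{A}^{\partial(S,G)}$ with $\mu(\delta)>0$. $\Lambda$ is valid if at least one $G$-MRF is associated to it; if exactly one is, it is denoted $\mu(\Lambda)$. A $\mathbb{Z}^2$-specification is translation-invariant if $\Lambda^{\sigma_v\delta}=\sigma_v\Lambda^\delta$ for all $\delta$ and $v\in\mathbb{Z}^2$, where $(\sigma_v x)(u)=x(u+v)$. $q(\Lambda)=\sup_{g\in V(G)}\max_{\delta,\delta'} d(\Lambda^\delta,\Lambda^{\delta'})$, where $\delta,\delta'$ range over $\mathcal{A}^{\partial(\{g\},G)}$, $\Lambda^\delta,\Lambda^{\delta'}$ are the corresponding measures on $\mathcal{A}^{\{g\}}$, and $d(\alpha,\beta)=\frac12\sum_s|\alpha(s)-\beta(s)|$ is total variation distance. $p_c$ is the critical probability for site percolation on $\mathbb{Z}^2$. When $\Lambda$ is a valid $\mathbb{Z}^2$-specification with $q(\Lambda)<p_c$, it has a unique associated $\mathbb{Z}^2$-MRF. Strips: for integers $m<n$, $H_{m,n}$ is the maximal (induced) subgraph of $\mathbb{Z}^2$ on $\mathbb{Z}\times[m,n]$. Given a $\mathbb{Z}^2$-specification $\Lambda$ and $t,b\in\mathcal{A}^{\mathbb{Z}}$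 (with $t$ placed on row $\mathbb{Z}\times\{n+1\}$ and $b$ on row $\mathbb{Z}\times\{m-1\}$), the $H_{m,n}$-specification $\Lambda_{m,n,t,b}$ is defined by $\Lambda_{m,n,t,b}^\delta(\eta)=\Lambda^\xi(\eta)$ for finite $S\subset\mathbb{Z}\times[m,n]$, $\eta\in\mathcal{A}^S$, $\delta\in\mathcal{A}^{\partial(S,H_{m,n})}$, where $\xi\in\mathcal{A}^{\partial S}$ is the concatenation of $t|_{\partial S\cap(\mathbb{Z}\times\{n+1\})}$, $b|_{\partial S\cap(\mathbb{Z}\times\{m-1\})}$ and $\delta$. Compatibility (for integers $m<n$): $m,n,t,b$ is compatible with $\Lambda$ if there is an MRF $\mu$ associated to $\Lambda$ such that for all sufficiently large $k$ there is $\delta_k\in\mathcal{A}^{\partial([-k,k]\times[m,n])}$ with $\mu(\delta_k)>0$ whose top row is $t|_{[-k,k]}$ and whose bottom row is $b|_{[-k,k]}$. When $\Lambda$ is valid, $q(\Lambda)<1$ and $m,n,t,b$ is compatible with $\Lambda$, $\Lambda_{m,n,t,b}$ has a unique associated $H_{m,n}$-MRF $\mu(\Lambda_{m,n,t,b})$; it is regarded as a measure on the one-dimensional full shift $(\mathcal{A}^{[m,n]})^{\mathbb{Z}}$ whose letters are columns. Higher power code: for a measure $\nu$ on $\mathcal{B}^{\mathbb{Z}}$, $\nu^{[p]}$ is the image of $\nu$ under $\phi:\mathcal{B}^{\mathbb{Z}}\to(\mathcal{B}^p)^{\mathbb{Z}}$, $(\phi x)(v)=x|_{[pv,\,p(v+1)-1]}$.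 For $p$-periodic $t,b$, $(\mu(\Lambda_{1,n,t,b}))^{[p]}$ is translation-invariant. Entropy: for a translation-invariant measure $\mu$ on $\mathcal{B}^{\mathbb{Z}^d}$, $h(\mu)=\lim_{j_1,\dots,j_d\to\infty}\frac{-1}{j_1\cdots j_d}\sum_{w\in\mathcal{B}^{\prod[1,j_i]}}\mu(w)\log\mu(w)$, omitting terms with $\mu(w)=0$. *)

(* Defs.v *)
From HB Require Import structures.
From mathcomp Require Import all_boot all_order all_algebra finmap zify.
From mathcomp Require Import all_classical all_reals all_analysis.

Set Implicit Arguments.
Unset Strict Implicit.
Unset Printing Implicit Defensive.

Import Order.TTheory GRing.Theory Num.Theory.
Import numFieldNormedType.Exports.

Local Open Scope classical_set_scope.
Local Open Scope ring_scope.

(* Alphabets are pointed only because the measurable types of the library are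
   pointed types; the choice of the point is immaterial. *)
#[short(type="alphabetType")]
HB.structure Definition Alphabet := {A of Finite A & isPointed A}.

HB.saturate bool.

HB.instance Definition _ (I : finType) (A : alphabetType) :=
  isPointed.Build {ffun I -> A} [ffun=> point].

Section Configurations.
Variables (V : choiceType) (A : alphabetType).

Definition restr (S : {fset V}) (x : V -> A) : {ffun S -> A} :=
  [ffun u => x (val u)].

Definition subrestr (S T : {fset V}) (sST : (S `<=` T)%fset)
    (d : {ffun T -> A}) : {ffun S -> A} :=
  [ffun u => d (fincl sST u)].

Definition cyl (S : {fset V}) (w : {ffun S -> A}) : set (V -> A) :=
  [set x | restr S x = w].

Definition cylinders : set (set (V -> A)) :=
  [set C | exists (S : {fset V}) (w : {ffun S -> A}), C = cyl w].

(* For V countable, the Borel sigma-algebra of the product topology on A^V is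
   the one generated by the cylinder sets. *)
Definition cfg := g_sigma_algebraType cylinders.

HB.instance Definition _ := Measurable.on cfg.

Lemma measurable_cyl (S : {fset V}) (w : {ffun S -> A}) :
  measurable (cyl w : set cfg).
Proof. by apply: sub_sigma_algebra; exists S, w. Qed.

Lemma measurable_coord (v : V) (a : A) : measurable ([set x | x v = a] : set cfg).
Proof.
have -> : [set x | x v = a] = cyl [ffun _ : [fset v]%fset => a].
  rewrite /cyl; apply/seteqP; split=> x /=.
    move=> xv; apply/ffunP=> u; rewrite !ffunE.
    by have /fset1P -> := valP u.
  by move=> /ffunP /(_ [` fset11 v ]%fset); rewrite !ffunE.
exact: measurable_cyl.
Qed.

End Configurations.

Arguments measurable_coord {V A}.

Lemma measurable_to_cfg d (T : measurableType d) (V : choiceType)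
    (A : alphabetType) (f : T -> cfg V A) :
  (forall v a, measurable [set x | f x v = a]) -> measurable_fun setT f.
Proof.
move=> mf; apply: (@measurability _ _ T (cfg V A) setT f (@cylinders V A)) => //.
move=> _ [_ [S [w ->]] <-]; rewrite setTI.
have -> : f @^-1` cyl w =
    \big[setI/setT]_(u : S) [set x | f x (val u) = w u].
  rewrite -bigcap_seq; apply/seteqP; split=> x /=.
    by move=> /ffunP xw u _; rewrite /= -xw ffunE.
  by move=> xw; apply/ffunP => u; rewrite ffunE xw//= mem_index_enum.
by apply: bigsetI_measurable => u _; exact: mf.
Qed.

(* Locally finite graphs: the neighbourhood map [nbrs] witnesses local
   finiteness. *)
Record graph := Graph {
  vert :> countType;
  adj : rel vert;
  adj_sym : symmetric adj;
  adj_irr : irreflexive adj;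
  nbrs : vert -> {fset vert};
  nbrsE : forall u v, (v \in nbrs u) = adj u v }.

Definition boundary (G : graph) (S : {fset G}) : {fset G} :=
  ((\bigcup_(u <- S) nbrs u) `\` S)%fset.

Lemma boundaryP (G : graph) (S : {fset G}) v :
  reflect (v \notin S /\ exists2 u, u \in S & adj u v) (v \in boundary S).
Proof.
rewrite in_fsetD; apply: (iffP andP) => -[vS].
  by move=> /bigfcupP[u /andP[uS _]]; rewrite nbrsE => uv; split=> //; exists u.
by move=> [u uS uv]; split=> //; apply/bigfcupP; exists u; rewrite ?uS ?nbrsE.
Qed.

Definition Z2adj (u v : int * int) : bool :=
  `|u.1 - v.1| + `|u.2 - v.2| == 1.

Definition Z2nbrs (u : int * int) : {fset int * int} :=
  [fset ((u.1 + 1)%R, u.2); ((u.1 - 1)%R, u.2);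
        (u.1, (u.2 + 1)%R); (u.1, (u.2 - 1)%R)]%fset.

Lemma Z2adj_sym : symmetric Z2adj.
Proof. by move=> u v; rewrite /Z2adj distrC [X in _ + X]distrC. Qed.

Lemma Z2adj_irr : irreflexive Z2adj.
Proof. by move=> u; rewrite /Z2adj !subrr. Qed.

Lemma Z2nbrsE u v : (v \in Z2nbrs u) = Z2adj u v.
Proof.
case: u v => [u1 u2] [v1 v2]; rewrite /Z2nbrs /Z2adj !inE !xpair_eqE /=.
lia.
Qed.

Definition Z2 : graph := Graph Z2adj_sym Z2adj_irr Z2nbrsE.

Section Induced.
Variables (G : graph) (P : pred G).

Definition induced_adj (u v : {v : G | P v}) := adj (val u) (val v).

Definition induced_nbrs (u : {v : G | P v}) : {fset {v : G | P v}} :=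
  [fset v in pmap insub (nbrs (val u))]%fset.

Lemma induced_adj_sym : symmetric induced_adj.
Proof. by move=> u v; exact: adj_sym. Qed.

Lemma induced_adj_irr : irreflexive induced_adj.
Proof. by move=> u; exact: adj_irr. Qed.

Lemma induced_nbrsE u v : (v \in induced_nbrs u) = induced_adj u v.
Proof. by rewrite in_fset /= mem_pmap_sub /= nbrsE. Qed.

Definition induced : graph :=
  Graph induced_adj_sym induced_adj_irr induced_nbrsE.

End Induced.

Definition in_strip (m n : int) : pred Z2 := fun v => m <= v.2 <= n.

Definition strip (m n : int) : graph := induced (in_strip m n).

Section Specifications.
Variables (R : realType) (G : graph) (A : alphabetType).

Definition condp (mu : probability (cfg G A) R) (S T : {fset G})
    (w : {ffun S -> A}) (u : {ffun T -> A}) : R :=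
  fine (mu (cyl w `&` cyl u)) / fine (mu (cyl u)).

Definition is_MRF (mu : probability (cfg G A) R) :=
  forall (S : {fset G}) (eta : {ffun S -> A}) (T : {fset G})
    (sT : (boundary S `<=` T)%fset) (delta : {ffun T -> A}),
  [disjoint T & S]%fset -> mu (cyl delta) != 0%E ->
  condp mu eta (subrestr sT delta) = condp mu eta delta.

Record specification := Specification {
  spec_fun :> forall S : {fset G}, {ffun boundary S -> A} -> {ffun S -> A} -> R;
  spec_ge0 : forall S d w, 0 <= @spec_fun S d w;
  spec_sum1 : forall S d, \sum_w @spec_fun S d w = 1 }.

Definition associated (L : specification) (mu : probability (cfg G A) R) :=
  is_MRF mu /\
  forall (S : {fset G}) (delta : {ffun boundary S -> A}),
    (0 < mu (cyl delta))%E -> forall eta, condp mu eta delta = L S delta eta.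

Definition valid (L : specification) := exists mu, associated L mu.

Definition tv (I : finType) (f g : I -> R) : R := 2^-1 * \sum_s `|f s - g s|.

Definition qspec (L : specification) : R :=
  sup (range (fun g : G =>
    \big[Num.max/0]_(d : {ffun boundary [fset g]%fset -> A})
      \big[Num.max/0]_(d' : {ffun boundary [fset g]%fset -> A})
        tv (L [fset g]%fset d) (L [fset g]%fset d'))).

End Specifications.

Section TranslationInvariance.
Variables (R : realType) (A : alphabetType).

Definition shift_cfg (v : int * int) (x : Z2 -> A) : Z2 -> A :=
  fun u => x ((u : int * int) + v).

Definition shift_set (v : int * int) (S : {fset int * int}) : {fset Z2} :=
  [fset (u - v)%R | u in S]%fset.

(* Since A is nonempty, every configuration on a finite set is the restriction
   of a configuration on Z^2; this is
   Lambda^(sigma_v delta)(sigma_v eta) = Lambda^delta(eta)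
   for delta = x restricted to the boundary of S and eta = y restricted to S;
   sigma_v maps configurations on S to configurations on S - v. *)
Definition translation_invariant (L : specification R Z2 A) :=
  forall (v : int * int) (S : {fset Z2}) (x y : Z2 -> A),
    L (shift_set v S) (restr (boundary (shift_set v S)) (shift_cfg v x))
      (restr (shift_set v S) (shift_cfg v y)) =
    L S (restr (boundary S) x) (restr S y).

End TranslationInvariance.

Section Percolation.
Variables (R : realType) (G : graph).

(* P is the product over the sites of the Bernoulli measures with P(open) = p;
   it is determined by its values on cylinder sets. *)
Definition is_bernoulli (p : R) (P : probability (cfg G bool) R) :=
  forall (S : {fset G}) (w : {ffun S -> bool}),
    P (cyl w) = (\prod_(u : S) (if w u then p else 1 - p))%:E.

Definition open_cluster (x : G -> bool) (u : G) : set G :=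
  [set v | exists s : seq G,
    [/\ path (@adj G) u s, last u s = v & all x (u :: s)]].

Definition percolates : set (G -> bool) :=
  [set x | exists u : G, infinite_set (open_cluster x u)].

Definition p_c : R :=
  sup [set p | 0 <= p <= 1 /\
    exists2 P : probability (cfg G bool) R,
      is_bernoulli p P & P percolates = 0%E].

End Percolation.

Section StripSpecification.
Variables (R : realType) (A : alphabetType) (L : specification R Z2 A).
Variables (m n : int) (t b : int -> A).

Definition unstrip (S : {fset strip m n}) : {fset Z2} :=
  [fset val u | u in S]%fset.

(* The value [point] outside D is never read in [strip_bc] and [strip_fun]: a
   site of the boundary of S in Z^2 that is on neither of the rows n + 1 and
   m - 1 belongs to the boundary of S in the strip. *)
Definition extend (D : {fset strip m n}) (d : {ffun D -> A}) (v : Z2) : A :=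
  if obind insub (insub v) is Some u then d u else point.

Definition strip_bc (S : {fset strip m n}) (d : {ffun boundary S -> A}) :
    {ffun boundary (unstrip S) -> A} :=
  restr _ (fun v : Z2 => if v.2 == n + 1 then t v.1
                         else if v.2 == m - 1 then b v.1
                         else extend d v).

Definition strip_fun (S : {fset strip m n}) (d : {ffun boundary S -> A})
    (eta : {ffun S -> A}) : R :=
  L (unstrip S) (strip_bc d) (restr (unstrip S) (extend eta)).

Lemma extendE (D : {fset strip m n}) (d : {ffun D -> A}) (u : D) :
  extend d (val (val u)) = d u.
Proof. by rewrite /extend valK /= valK. Qed.

Lemma strip_ge0 S d w : 0 <= @strip_fun S d w.
Proof. exact: spec_ge0. Qed.

Lemma strip_sum1 S d : \sum_w @strip_fun S d w = 1.
Proof.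
rewrite -(spec_sum1 L (strip_bc d)) /strip_fun.
have mS (u : S) : val (val u) \in unstrip S.
  by apply: in_imfset; exact: fsvalP.
rewrite [RHS](reindex (fun eta : {ffun S -> A} =>
  restr (unstrip S) (extend eta))) //=.
exists (fun w : {ffun unstrip S -> A} => [ffun u : S => w [` mS u]%fset]).
  by move=> eta _; apply/ffunP => u; rewrite !ffunE /= extendE.
move=> w _; apply/ffunP => v; rewrite ffunE.
have /imfsetP[u /= uS vE] := valP v.
rewrite vE (extendE _ [` uS]%fset) ffunE; congr (w _).
by apply: val_inj; rewrite /= vE.
Qed.

Definition strip_spec : specification R (strip m n) A :=
  Specification strip_ge0 strip_sum1.

End StripSpecification.

(* The integer interval [m, n], empty if n < m. *)
Definition fint (m n : int) : {fset int} :=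
  [fset (m + i%:Z)%R | i in iota 0 (if (m <= n)%R then `|n - m|.+1 else 0)]%fset.

Lemma mem_fint m n i : (i \in fint m n) = (m <= i <= n).
Proof.
apply/imfsetP/idP => /= [[k kI ->]|imn].
  by move: kI; rewrite mem_iota; case: ifP => mn; lia.
by exists `|i - m|%N; rewrite ?mem_iota ?ifT; lia.
Qed.

Definition fbox (i j m n : int) : {fset int * int} := (fint i j `*` fint m n)%fset.

Definition compatible (R : realType) (A : alphabetType)
    (L : specification R Z2 A) (m n : int) (t b : int -> A) :=
  m < n /\
  exists2 mu : probability (cfg Z2 A) R, associated L mu &
  exists K : nat, forall k : nat, (K <= k)%N ->
  exists d : {ffun boundary (fbox (- k%:Z) k%:Z m n : {fset Z2}) -> A},
    [/\ (0 < mu (cyl d))%E,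
        forall u, (val u).2 = n + 1 -> d u = t (val u).1 &
        forall u, (val u).2 = m - 1 -> d u = b (val u).1].

Section Columns.
Variables (R : realType) (A : alphabetType) (m n : int).

Definition column := {ffun fint m n -> A}.
HB.instance Definition _ := Alphabet.on column.

Lemma in_strip_fint (i : int) (j : fint m n) : in_strip m n (i, val j).
Proof. by have := valP j; rewrite mem_fint. Qed.

Definition columns (x : cfg (strip m n) A) : cfg int column :=
  fun i => [ffun j : fint m n => x (exist _ (i, val j) (in_strip_fint i j))].

Lemma measurable_columns : measurable_fun setT columns.
Proof.
apply: measurable_to_cfg => i c.
have -> : [set x | columns x i = c] = \big[setI/setT]_(j : fint m n)
    [set x | x (exist _ (i, val j) (in_strip_fint i j)) = c j].
  rewrite -bigcap_seq; apply/seteqP; split=> x /=.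
    by move=> /ffunP xc j _; rewrite /= -xc ffunE.
  by move=> xc; apply/ffunP => j; rewrite ffunE xc//= mem_index_enum.
by apply: bigsetI_measurable => j _; exact: measurable_coord.
Qed.

HB.instance Definition _ :=
  isMeasurableFun.Build _ _ _ _ columns measurable_columns.

Definition column_measure (nu : probability (cfg (strip m n) A) R) :
    probability (cfg int column) R :=
  distribution nu columns.

End Columns.

Section HigherPower.
Variables (R : realType) (B : alphabetType) (p : nat).

Definition power_code (x : cfg int B) : cfg int {ffun 'I_p -> B} :=
  fun v => [ffun i : 'I_p => x (p%:Z * v + i%:Z)].

Lemma measurable_power_code : measurable_fun setT power_code.
Proof.
apply: measurable_to_cfg => v c.
have -> : [set x | power_code x v = c] =
    \big[setI/setT]_(i : 'I_p) [set x | x (p%:Z * v + i%:Z) = c i].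
  rewrite -bigcap_seq; apply/seteqP; split=> x /=.
    by move=> /ffunP xc j _; rewrite /= -xc ffunE.
  by move=> xc; apply/ffunP => j; rewrite ffunE xc//= mem_index_enum.
by apply: bigsetI_measurable => i _; exact: measurable_coord.
Qed.

HB.instance Definition _ :=
  isMeasurableFun.Build _ _ _ _ power_code measurable_power_code.

Definition higher_power (nu : probability (cfg int B) R) :
    probability (cfg int {ffun 'I_p -> B}) R :=
  distribution nu power_code.

End HigherPower.

Section Entropy.
Variables (R : realType).

(* A term with mu(w) = 0 contributes 0 * ln 0 = 0. *)
Definition block_entropy (V : choiceType) (B : alphabetType)
    (mu : probability (cfg V B) R) (S : {fset V}) : R :=
  - \sum_(w : {ffun S -> B}) fine (mu (cyl w)) * ln (fine (mu (cyl w))).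

Definition entropy1 (B : alphabetType) (nu : probability (cfg int B) R) : R :=
  lim ((fun j : nat => (j%:R)^-1 * block_entropy nu (fint 1 j%:Z)) @ \oo).

Definition entropy2 (B : alphabetType) (mu : probability (cfg Z2 B) R) : R :=
  lim ((fun j : nat * nat => ((j.1 * j.2)%:R)^-1 *
          block_entropy mu (fbox 1 j.1%:Z 1 j.2%:Z : {fset Z2}))
       @ filter_prod \oo \oo).

End Entropy.

(* Main.v *)
(* Order the sites column by column, from the bottom to the top of each column.
   By the chain rule, the entropy per column of a strip measure is the sum over
   its rows of the conditional entropy of a site given its past.  By disagreement
   percolation, the conditional law of a site given its past depends only up to an
   exponentially small error on what happens far away: two conditional laws with
   the same conditioning in a box differ in total variation by at most the
   probability that, for Bernoulli site percolation with parameter q(Lambda), an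
   open path leads from the site to the boundary of the box.  This probability
   decays exponentially because q(Lambda) < p_c, by the argument of Duminil-Copin
   and Tassion.  Hence, up to errors exponentially small in n, the lower n/2 rows
   of the strip of height n + 1 contribute as much as the lower n/2 rows of the
   strip of height n, the upper rows as much as the upper rows of the strip of
   height n, and the remaining middle row contributes the conditional entropy of
   a site of the plane given its past, which is h(mu). *)

Require Import Defs.
From HB Require Import structures.
From mathcomp Require Import all_boot all_order all_algebra finmap zify ring lra.
From mathcomp Require Import all_classical all_reals all_analysis.

Set Implicit Arguments.
Unset Strict Implicit.
Unset Printing Implicit Defensive.

Import Order.TTheory GRing.Theory Num.Theory.
Import numFieldNormedType.Exports.

Local Open Scope ring_scope.

(** Measures enter only through the probabilities of finite patterns. The plane measure and all
    strip measures become such laws on one lattice, a strip law being frozen outside of its rows, so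
    that any two of them can be compared around any two sites. Percolation probabilities are finite
    sums as well, with all sites outside of a list closed. No coupling of measures is constructed:
    the optimal coupling is unfolded site by site in an induction on the list.

    The obstacle is that a conditional entropy averages over a past that reaches far away and has
    different laws in the two systems. The conditional entropy at a site is therefore first replaced
    by a function of the past within distance m, and the laws of this near past are then compared in
    a window of radius 2m. A row must not see both sides of the strip within distance 2m; this asks
    for 4m <= n and explains the final choice m = n / 4. The square-root modulus of continuity of -s
    ln s, the area of the window and the number of rows only reduce the exponential rate. All limits
    come from Cauchy estimates between pairs of sites that see the same surroundings. *)

Section Update.
Variables (V : eqType) (A : Type).

Definition upd (x : V -> A) (v : V) (a : A) : V -> A :=
  fun u => if u == v then a else x u.

Lemma updC x u v a b : u != v -> upd (upd x u a) v b = upd (upd x v b) u a.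
Proof.
move=> uv; apply/funext => z; rewrite /upd.
by case: (eqVneq z v) => // ->; rewrite eq_sym (negbTE uv).
Qed.

Lemma upd_id x v a b : upd (upd x v a) v b = upd x v b.
Proof. by apply/funext => z; rewrite /upd; case: eqP. Qed.

Lemma upd_eq x v a : upd x v a v = a.
Proof. by rewrite /upd eqxx. Qed.

Lemma upd_neq x v a u : u != v -> upd x v a u = x u.
Proof. by rewrite /upd => /negbTE ->. Qed.

Lemma upd_self x v : upd x v (x v) = x.
Proof. by apply/funext => z; rewrite /upd; case: eqP => // ->. Qed.

(** Measurability with respect to the sites in [X], in the pointwise form that finite sums can
    use. *)
Definition depends (X : V -> Prop) (T : Type) (g : (V -> A) -> T) :=
  forall y y' : V -> A, (forall u, X u -> y u = y' u) -> g y = g y'.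

End Update.

(** * Iterated sums over the values at finitely many sites *)

Section IteratedSum.
Variables (R : realType) (V : eqType) (A : finType) (w : A -> R).

(** Weight 1 gives a sum over the configurations on [l], a probability vector an expectation under a
    product measure; off [l] the configuration is [x]. With a list, inductions can reveal one site
    at a time, in any order by [itsum_perm]. *)
Fixpoint itsum (l : seq V) (g : (V -> A) -> R) (x : V -> A) : R :=
  if l is v :: l' then \sum_a w a * itsum l' g (upd x v a) else g x.

Lemma itsum_cat l l' g x : itsum (l ++ l') g x = itsum l (itsum l' g) x.
Proof.
elim: l x => //= v l IH x.
by apply: eq_bigr => a _; rewrite IH.
Qed.

Lemma eq_itsum l g g' x :
  (forall y, (forall u, u \notin l -> y u = x u) -> g y = g' y) ->
  itsum l g x = itsum l g' x.
Proof.
elim: l x => [|v l IH] x H /=; first exact: H.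
apply: eq_bigr => a _; congr (_ * _); apply: IH => y Hy; apply: H => u.
by rewrite inE negb_or => /andP[uv ul]; rewrite Hy// upd_neq.
Qed.

Lemma itsumZ l c g x : itsum l (fun y => c * g y) x = c * itsum l g x.
Proof.
elim: l x => //= v l IH x; rewrite mulr_sumr; apply: eq_bigr => a _.
by rewrite IH mulrCA.
Qed.

Lemma itsum_sum (I : Type) (r : seq I) (P : pred I) l (g : I -> (V -> A) -> R) x :
  itsum l (fun y => \sum_(i <- r | P i) g i y) x =
  \sum_(i <- r | P i) itsum l (g i) x.
Proof.
elim: l x => //= v l IH x; rewrite exchange_big; apply: eq_bigr => a _.
by rewrite IH mulr_sumr.
Qed.

Lemma itsumD l g g' x :
  itsum l (fun y => g y + g' y) x = itsum l g x + itsum l g' x.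
Proof.
elim: l x => //= v l IH x; rewrite -big_split; apply: eq_bigr => a _.
by rewrite IH mulrDr.
Qed.

Lemma itsumN l g x : itsum l (fun y => - g y) x = - itsum l g x.
Proof.
elim: l x => //= v l IH x; rewrite -sumrN; apply: eq_bigr => a _.
by rewrite IH mulrN.
Qed.

Lemma itsumB l g g' x :
  itsum l (fun y => g y - g' y) x = itsum l g x - itsum l g' x.
Proof. by rewrite itsumD itsumN. Qed.

Lemma itsum_rem l v g x : v \in l -> itsum l g x = itsum (v :: rem v l) g x.
Proof.
elim: l x => //= u l IH x; rewrite inE.
case: (eqVneq u v) => [->//|uv] /= vl.
under eq_bigr => a _ do rewrite (IH _ vl) /= mulr_sumr.
rewrite exchange_big /=; apply: eq_bigr => b _; rewrite mulr_sumr.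
by apply: eq_bigr => a _; rewrite updC// mulrCA.
Qed.

Lemma itsum_perm l l' g x : perm_eq l l' -> itsum l g x = itsum l' g x.
Proof.
elim: l l' x => [|v l IH] l' x ll'.
  by move: ll'; rewrite perm_sym => /perm_nilP ->.
have vl' : v \in l' by rewrite -(perm_mem ll') mem_head.
rewrite (itsum_rem _ _ vl') /=; apply: eq_bigr => a _; rewrite (IH (rem v l'))//.
by rewrite -(perm_cons v); apply: (perm_trans ll'); apply: perm_to_rem.
Qed.

Lemma itsum_ext (X : V -> Prop) l g x x' : depends X g ->
  (forall u, X u -> u \notin l -> x u = x' u) -> itsum l g x = itsum l g x'.
Proof.
move=> dg; elim: l x x' => [|v l IH] x x' H /=; first by apply: dg => u /H ->.
apply: eq_bigr => a _; congr (_ * _); apply: IH => u Xu ul; rewrite /upd.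
by case: eqP => // /eqP uv; rewrite H// inE negb_or uv.
Qed.

Lemma itsum_mull (X : V -> Prop) l f g x : depends X f ->
  (forall u, X u -> u \notin l) ->
  itsum l (fun y => f y * g y) x = f x * itsum l g x.
Proof.
move=> df Xl; rewrite -itsumZ; apply: eq_itsum => y Hy; congr (_ * _).
by apply: df => u /Xl; exact: Hy.
Qed.

Hypothesis w0 : forall a, 0 <= w a.

Lemma le_itsum l g g' x :
  (forall y, (forall u, u \notin l -> y u = x u) -> g y <= g' y) ->
  itsum l g x <= itsum l g' x.
Proof.
elim: l x => [|v l IH] x H /=; first exact: H.
apply: ler_sum => a _; apply: ler_wpM2l => //; apply: IH => y Hy; apply: H => u.
by rewrite inE negb_or => /andP[uv ul]; rewrite Hy// upd_neq.
Qed.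

Lemma itsum_ge0 l g x :
  (forall y, (forall u, u \notin l -> y u = x u) -> 0 <= g y) ->
  0 <= itsum l g x.
Proof.
move=> g0; apply: le_trans (le_itsum g0).
by elim: l {g0} x => //= v l IH x; apply: sumr_ge0 => a _; apply: mulr_ge0.
Qed.

Hypothesis w1 : \sum_a w a = 1.

Lemma itsum_cst l c x : itsum l (fun=> c) x = c.
Proof.
elim: l x => //= v l IH x; under eq_bigr do rewrite IH.
by rewrite -mulr_suml w1 mul1r.
Qed.

End IteratedSum.

(** * Site percolation below p_c *)

Section Indicator.
Variable R : realType.

Definition ind (P : Prop) : R := `[< P >]%:R.

Lemma ind_le (P Q : Prop) : (P -> Q) -> ind P <= ind Q.
Proof. by rewrite /ind; do 2 case: asboolP => //; rewrite ?ler01//; tauto. Qed.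

Lemma ind_iff (P Q : Prop) : (P <-> Q) -> ind P = ind Q.
Proof. by move=> PQ; apply/eqP; rewrite eq_le !ind_le//; tauto. Qed.

Lemma ind_ge0 (P : Prop) : 0 <= ind P.
Proof. by rewrite /ind ler0n. Qed.

Lemma ind_le1 (P : Prop) : ind P <= 1.
Proof. by rewrite /ind lern1 leq_b1. Qed.

Lemma indT (P : Prop) : P -> ind P = 1.
Proof. by rewrite /ind; case: asboolP. Qed.

Lemma indF (P : Prop) : ~ P -> ind P = 0.
Proof. by rewrite /ind; case: asboolP. Qed.

End Indicator.
Arguments ind {R}.
Arguments indT {R P}.
Arguments indF {R P}.
Arguments ind_ge0 {R}.
Arguments ind_le1 {R}.
Arguments ind_le {R P Q}.
Arguments ind_iff {R P Q}.

(** * Bernoulli expectations and Russo's formula *)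

Section Expectation.
Variables (R : realType) (V : eqType).
Implicit Types (s : R) (l : seq V).

Definition bern s (b : bool) : R := if b then s else 1 - s.

Definition Ex s := @itsum R V bool (bern s).

(** Boundary condition of the percolation sums: sites outside of the list are closed. *)
Definition off : V -> bool := fun=> false.

Lemma bern_ge0 s : 0 <= s <= 1 -> forall b, 0 <= bern s b.
Proof. by move=> s01 [] /=; lra. Qed.

Lemma bern_sum1 s : \sum_b bern s b = 1.
Proof. by rewrite big_bool /=; ring. Qed.

Lemma itsum_upd (A : finType) (w : A -> R) v l g (x : V -> A) a : v \notin l ->
  itsum w l g (upd x v a) = itsum w l (fun y => g (upd y v a)) x.
Proof.
elim: l x => //= u l IH x; rewrite inE negb_or => /andP[vu vl].
by apply: eq_bigr => b _; rewrite updC// IH.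
Qed.

Lemma Ex_cons s v l g : v \notin l ->
  Ex s (v :: l) g off =
  s * Ex s l (fun y => g (upd y v true)) off + (1 - s) * Ex s l g off.
Proof.
move=> vl; rewrite /Ex /= big_bool /=; congr (_ * _ + _ * _).
  exact: itsum_upd.
by congr (itsum _ _ _ _); apply/funext => u; rewrite /upd; case: eqP.
Qed.

Definition increasing (g : (V -> bool) -> R) :=
  forall x y : V -> bool, (forall u, x u -> y u) -> g x <= g y.

(** Sites outside of the list are closed, so a longer list can only open more sites. *)
Lemma Ex_incr_cat s l l' g : 0 <= s <= 1 -> increasing g ->
  (forall u, u \in l' -> u \notin l) -> Ex s l g off <= Ex s (l ++ l') g off.
Proof.
move=> s01 ig ll'; rewrite /Ex itsum_cat; apply: le_itsum; first exact: bern_ge0.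
move=> y Hy; rewrite -[leLHS](itsum_cst (bern_sum1 s) l' _ y).
apply: le_itsum; first exact: bern_ge0.
move=> z Hz; apply: ig => u yu; case: (boolP (u \in l')) => ul'; last by rewrite Hz.
by move: yu; rewrite Hy ?ll'.
Qed.

Lemma Ex_le s l g g' x : 0 <= s <= 1 ->
  (forall y, (forall u, u \notin l -> y u = x u) -> g y <= g' y) ->
  Ex s l g x <= Ex s l g' x.
Proof. by move=> s01; apply: le_itsum; exact: bern_ge0. Qed.

Lemma Ex_le1 s l g x : 0 <= s <= 1 -> (forall y, g y <= 1) -> Ex s l g x <= 1.
Proof.
move=> s01 g1; rewrite -[leRHS](itsum_cst (bern_sum1 s) l _ x).
by apply: Ex_le.
Qed.

Lemma Ex_ge0 s l g x : 0 <= s <= 1 -> (forall y, 0 <= g y) -> 0 <= Ex s l g x.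
Proof. by move=> s01 g1; apply: itsum_ge0 => //; exact: bern_ge0. Qed.

Lemma Ex_increasing s l g : 0 <= s <= 1 -> increasing g -> increasing (Ex s l g).
Proof.
move=> s01 ig; elim: l => //= v l IH x y xy.
apply: ler_sum => a _; apply: ler_wpM2l; first exact: bern_ge0.
by apply: IH => u; rewrite /upd; case: eqP => // _; exact: xy.
Qed.

(** Site by site: the value with the site open is at least the value with the site closed, and a
    larger parameter moves weight to the former. *)
Lemma Ex_mono s s' l g x : 0 <= s -> s <= s' -> s' <= 1 -> increasing g ->
  Ex s l g x <= Ex s' l g x.
Proof.
move=> s0 ss' s1 ig; elim: l x => //= v l IH x.
rewrite /Ex /= !big_bool /= -!/(Ex _ _ _ _).
have H : Ex s' l g (upd x v false) <= Ex s' l g (upd x v true).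
  apply: Ex_increasing => //; first by lra.
  by move=> u; rewrite /upd; case: eqP.
have := IH (upd x v true); have := IH (upd x v false).
nra.
Qed.

(** Russo's formula: when [g] is the indicator of an increasing event, the summand at [v] is the
    probability that [v] is pivotal. *)
Lemma is_derive_Ex s l g x : uniq l ->
  is_derive s 1 (fun s => Ex s l g x)
    (\sum_(v <- l) Ex s l (fun y => g (upd y v true) - g (upd y v false)) x).
Proof.
elim: l x => [|v l IH] x /=; first by rewrite big_nil => _; exact: is_derive_cst.
move=> /andP[vl ul].
have -> : (fun s : R => Ex s (v :: l) g x) =
    (fun s : R => s * Ex s l g (upd x v true) + (1 - s) * Ex s l g (upd x v false)).
  by apply/funext => r; rewrite /Ex /= big_bool.
have d1 := IH (upd x v true) ul; have d2 := IH (upd x v false) ul.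
apply: is_derive_eq.
rewrite big_cons /Ex /= big_bool /= -!/(Ex _ _ _ _).
rewrite /GRing.scale /=.
under [in RHS]eq_bigr do rewrite big_bool /= -!/(Ex _ _ _ _).
rewrite big_split /= -!mulr_sumr.
have dv z : Ex s l (fun y => g (upd y v true) - g (upd y v false)) z =
    Ex s l g (upd z v true) - Ex s l g (upd z v false).
  by rewrite /Ex itsumB -!(itsum_upd _ _ _ _ vl).
rewrite !dv !upd_id; ring.
Qed.

End Expectation.

(** * Open clusters and the sites next to them *)

Section Clusters.
Variable G : graph.
Implicit Types (x y : G -> bool) (u v w o : G) (F : G -> Prop).

Lemma cluster_refl x u : x u -> open_cluster x u u.
Proof. by move=> xu; exists [::]; split => //=; rewrite xu. Qed.

Lemma cluster_open x u v : open_cluster x u v -> x u /\ x v.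
Proof.
move=> [s [_ <- /= /andP[xu /allP sx]]]; split => //.
by have := mem_last u s; rewrite inE => /orP[/eqP ->//|/sx].
Qed.

Lemma cluster_step x u v w :
  open_cluster x u v -> adj v w -> x w -> open_cluster x u w.
Proof.
move=> [s [us sv sx]] vw xw; exists (rcons s w); split.
- by rewrite rcons_path us sv.
- by rewrite last_rcons.
- by move: sx => /= /andP[-> ?]; rewrite all_rcons xw.
Qed.

Lemma cluster_ind x u (Q : G -> Prop) : Q u ->
  (forall v w, open_cluster x u v -> Q v -> adj v w -> x w -> Q w) ->
  forall v, open_cluster x u v -> Q v.
Proof.
move=> Qu H v [s]; elim/last_ind: s v => [|s w IH] v [].
  by move=> _ <- _.
rewrite rcons_path last_rcons => /andP[us sw] <-.
rewrite /= all_rcons => /and3P[xu xw sx].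
have sU : open_cluster x u (last u s) by exists s; split => //=; rewrite xu.
by apply: (H _ _ sU) => //; apply: IH; split => //=; rewrite xu.
Qed.

Lemma cluster_trans x u v w :
  open_cluster x u v -> open_cluster x v w -> open_cluster x u w.
Proof.
move=> uv; apply: (@cluster_ind x v (open_cluster x u)) => // a b _.
exact: cluster_step.
Qed.

Lemma cluster_sym x u v : open_cluster x u v -> open_cluster x v u.
Proof.
move=> uv; have [xu _] := cluster_open uv; move: v uv.
apply: (@cluster_ind x u (fun v => open_cluster x v u)); first exact: cluster_refl.
move=> v w uv vu vw xw; apply: cluster_trans vu.
apply: (@cluster_step x w w v); first exact: cluster_refl.
  by rewrite adj_sym.
by have [] := cluster_open uv.
Qed.

Lemma cluster_mono x y u v : (forall z, x z -> y z) ->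
  open_cluster x u v -> open_cluster y u v.
Proof.
move=> xy [s [us sv sx]]; exists s; split => //.
exact: sub_all sx.
Qed.

(** Follow a path from [u] up to its first step out of [X]. *)
Lemma cluster_exit (X : pred G) x u v : X u -> open_cluster x u v ->
  open_cluster (fun z => x z && X z) u v \/
  exists a b, [/\ open_cluster (fun z => x z && X z) u a, adj a b, x b & ~~ X b].
Proof.
move=> Xu uv; have [xu _] := cluster_open uv; move: v uv.
apply: cluster_ind; first by left; apply: cluster_refl; rewrite xu.
move=> v w _ [uv|] vw xw; last by right.
case: (boolP (X w)) => Xw; last by right; exists v, w.
by left; apply: (cluster_step uv) => //; rewrite xw.
Qed.

(** The site in [F] need not be open: [F] stands for sites without a percolation state, such as the
    outside of a box, explored sites or disagreeing boundary sites. *)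
Definition touches F x o := exists2 u, open_cluster x o u & exists2 w, adj u w & F w.

Lemma touches_mono F F' x y o : (forall w, F w -> F' w) -> (forall z, x z -> y z) ->
  touches F x o -> touches F' y o.
Proof.
move=> FF' xy [u ou [w uw Fw]]; exists u; first exact: cluster_mono ou.
by exists w => //; exact: FF'.
Qed.

Lemma upd_true x v z : x z -> upd x v true z.
Proof. by rewrite /upd; case: eqP. Qed.

(** A path that uses [v] reaches a neighbour of [v] beforehand, and from an open [v] the set [F] is
    one step away. So opening [v] amounts to adding [v] to [F]. *)
Lemma touches_upd F x v o : o != v -> x v = false ->
  (exists2 w, adj v w & F w) ->
  touches F (upd x v true) o <-> touches (fun w => F w \/ w = v) x o.
Proof.
move=> ov xv [w vw Fw]; split.
  have ux z : upd x v true z && (z != v) -> x z.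
    by rewrite /upd; case: (eqVneq z v) => //=; rewrite andbT.
  move=> [u ou [z uz Fz]].
  case: (@cluster_exit (predC1 v) _ _ _ _ ou) => //=.
    by move=> ou'; exists u; [exact: (cluster_mono _ ou')|exists z => //; left].
  move=> [a [b [oa ab _]]]; rewrite negbK => /eqP bv.
  by exists a; [exact: (cluster_mono _ oa)|exists b => //; right].
move=> [u ou [z uz [Fz|zv]]].
  exists u; last by exists z.
  by apply: cluster_mono ou => *; exact: upd_true.
exists v; last by exists w.
apply: (@cluster_step _ o u) => //; last by rewrite upd_eq.
  by apply: cluster_mono ou => *; exact: upd_true.
by rewrite -zv.
Qed.

End Clusters.

(** * A lower bound for the expected number of pivotal sites *)

Section ExplorationFromOutside.
Variables (R : realType) (G : graph).
Implicit Types (s : R) (o : G) (D K : seq G) (F : G -> Prop).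

Definition bd D : seq G := boundary [fset u in D]%fset.

Lemma mem_bd D v : reflect (v \notin D /\ exists2 u, u \in D & adj u v) (v \in bd D).
Proof.
apply: (iffP (boundaryP _ _)).
  by rewrite inE => -[vD [u]]; rewrite inE => uD uv; split => //; exists u.
by move=> [vD [u uD uv]]; split; [rewrite inE|exists u; rewrite ?inE].
Qed.

Lemma bd_uniq D : uniq (bd D).
Proof. exact: fset_uniq. Qed.

(** The functional of Duminil-Copin and Tassion for site percolation: the expected number of
    boundary sites of [D] next to the cluster of [o] inside [D]. *)
Definition exits s D o : R :=
  Ex s D (fun x => \sum_(y <- bd D) ind (touches (eq y) x o)) (@off G).

Lemma touches_increasing F o : increasing (fun x => ind (touches F x o) : R).
Proof. by move=> x y xy; apply: ind_le; apply: touches_mono. Qed.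

(* The exploration from outside of Duminil-Copin and Tassion: D consists of the
   unexplored sites, F of the outside and the explored open sites, K of the
   explored closed sites.  When no site of D is adjacent to F, the sites of K at
   which the cluster of o leaves D are pivotal, and there are at least
   [exits s D o] of them on average. *)
Lemma pivotal_lower_bound s o : 0 <= s <= 1 ->
  (forall D, uniq D -> o \in D -> 1 <= exits s D o) ->
  forall D F K, uniq D -> o \in D -> uniq K ->
  (forall v, v \in K -> v \notin D /\ exists2 w, adj v w & F w) ->
  (forall u v, u \in D -> v \notin D -> adj u v -> F v \/ v \in K) ->
  Ex s D (fun x => 1 - ind (touches F x o)) (@off G) <=
  Ex s D (fun x => \sum_(v <- K ++ D)
    (ind (touches F (upd x v true) o) - ind (touches F x o))) (@off G).
Proof.
move=> s01 Hex D; have [n] := ubnP (size D).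
elim: n D => // n IH D sD F K uD oD uK KF DF.
have pos x v : 0 <= ind (touches F (upd x v true) o) - ind (touches F x o) :> R.
  by rewrite subr_ge0; apply: touches_increasing => z; exact: upd_true.
case: (pselect (exists v, v \in D /\ exists2 w, adj v w & F w)); last first.
  move=> noF.
  have bdK v : v \in bd D -> v \in K.
    move=> /mem_bd[vD [u uD' uv]]; have [Fv|//] := DF _ _ uD' vD uv.
    by exfalso; apply: noF; exists u; split => //; exists v.
  (* The left side is at most 1, hence at most [exits s D o]. The right side is at least that, since
     all of [bd D] lies in [K] and opening a touched site of [K] links the cluster of [o] to [F]. *)
  apply: le_trans (_ : exits s D o <= _).
    by apply: le_trans (Hex _ uD oD); apply: Ex_le1 => // y; rewrite gerBl ind_ge0.
  apply: Ex_le => // x Hx; rewrite big_cat /=.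
  apply: ler_wpDr; first by apply: sumr_ge0.
  have F0 : ~ touches F x o.
    move=> [u ou [w uw Fw]]; apply: noF; exists u; split; last by exists w.
    by have [_] := cluster_open ou; apply: contraTT => /Hx ->.
  rewrite [leRHS](eq_bigr (fun v => ind (touches F (upd x v true) o))); last first.
    by move=> v _; rewrite (indF F0) subr0.
  rewrite [leRHS](bigID (fun v => v \in bd D)) /=.
  apply: ler_wpDr; first by apply: sumr_ge0 => *; exact: ind_ge0.
  rewrite -[leRHS]big_filter.
  have pbd : perm_eq [seq v <- K | v \in bd D] (bd D).
    apply: uniq_perm; rewrite ?filter_uniq ?bd_uniq// => v.
    by rewrite mem_filter andb_idr//; exact: bdK.
  rewrite [leRHS](perm_big _ pbd) /=.
  rewrite big_seq [leRHS]big_seq; apply: ler_sum => v /bdK /KF[vD [w vw Fw]].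
  apply: ind_le => -[u ou [z uz vz]]; subst z; exists v; last by exists w.
  apply: (@cluster_step _ _ _ u) => //; last by rewrite upd_eq.
  by apply: cluster_mono ou => *; exact: upd_true.
move=> [v [vD [w vw Fw]]].
(* When [o] itself is adjacent to [F], opening it realizes the event, and the summand at [o] alone
   equals the left side. *)
case: (eqVneq o v) => [ov|ov].
  apply: Ex_le => // x Hx; rewrite big_cat /=.
  apply: ler_wpDl; first by apply: sumr_ge0.
  rewrite (big_rem v)//=; apply: ler_wpDr; first by apply: sumr_ge0.
  rewrite [X in _ <= X - _]indT//; exists v; last by exists w.
  by rewrite ov; apply: cluster_refl; rewrite upd_eq.
set D' := rem v D.
have pD : perm_eq D (v :: D') by exact: perm_to_rem.
have pK : perm_eq (K ++ D) (v :: K ++ D').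
  apply: (@perm_trans _ (K ++ v :: D')); first by rewrite perm_cat2l.
  by rewrite -cat1s perm_catCA.
have vD' : v \notin D' by rewrite mem_rem_uniq// inE eqxx.
have uD' : uniq D' by rewrite rem_uniq.
have oD' : o \in D' by rewrite mem_rem_uniq// inE ov.
have sD' : (size D' < n)%N by rewrite size_rem//; case: (D) vD sD.
have D'E u : u \in D' = (u != v) && (u \in D) by rewrite mem_rem_uniq// inE.
rewrite /Ex !(itsum_perm _ _ _ pD) -!/(Ex _ _ _ _) !Ex_cons//.
have [s0 s1] := andP s01.
apply: lerD; apply: ler_wpM2l; rewrite ?subr_ge0//; last first.
(* [v] closed: it joins [K]. *)
- have -> : (fun x => \sum_(v0 <- K ++ D)
     (ind (touches F (upd x v0 true) o) - ind (touches F x o))) =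
    (fun x => \sum_(v0 <- (v :: K) ++ D')
     (ind (touches F (upd x v0 true) o) - ind (touches F x o))) :> (_ -> R).
    by apply/funext => x; apply: perm_big.
  apply: IH => //=.
  + by rewrite uK andbT; apply/negP => /KF[]; rewrite vD.
  + move=> z; rewrite inE => /orP[/eqP ->|zK]; first by split => //; exists w.
    by have [zD Fz] := KF _ zK; split => //; rewrite D'E (negbTE zD) andbF.
  + move=> a b; rewrite !D'E inE => /andP[av aD]; rewrite negb_and negbK.
    move=> /orP[/eqP ->|bD] ab; first by right; rewrite eqxx.
    by have [Fb|bK] := DF _ _ aD bD ab; [left|right; rewrite bK orbT].
(* [v] open: it joins [F], and its own summand vanishes because opening it again changes nothing. *)
set F' := fun w => F w \/ w = v.
have E1 y : (forall u, u \notin D' -> y u = off u) ->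
    ind (touches F (upd y v true) o) = ind (touches F' y o) :> R.
  by move=> Hy; apply: ind_iff; apply: touches_upd => //; [rewrite Hy|exists w].
apply: le_trans (_ : Ex s D' (fun x => 1 - ind (touches F' x o)) (@off G) <= _).
  by apply: Ex_le => // y Hy; rewrite E1.
have vK : v \notin K by apply/negP => /KF[]; rewrite vD.
apply: le_trans (IH _ sD' F' K uD' oD' uK _ _) _.
- move=> z zK; have [zD [a za Fa]] := KF _ zK; split.
    by rewrite D'E (negbTE zD) andbF.
  by exists a => //; left.
- move=> a b; rewrite !D'E => /andP[av aD]; rewrite negb_and negbK.
  move=> /orP[/eqP ->|bD] ab; first by left; right.
  by have [Fb|bK] := DF _ _ aD bD ab; [left; left|right].
apply: Ex_le => // y Hy.
rewrite [leRHS](perm_big _ pK) big_cons /= upd_id subrr add0r big_seq [leRHS]big_seq.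
apply: ler_sum => z zKD.
have zv : z != v.
  apply: contraTneq zKD => ->.
  by rewrite mem_cat negb_or vK.
rewrite E1// updC 1?eq_sym// lerD2r; apply: ind_le => ?.
by apply/touches_upd => //; [rewrite upd_neq 1?eq_sym// Hy|exists w].
Qed.

End ExplorationFromOutside.

(** * Connections to a distant set, explored from the inside *)

Section ExplorationFromInside.
Variables (R : realType) (G : graph) (s : R) (S : seq G) (Z : G -> Prop) (eps : R).
Implicit Types (D : seq G) (C : G -> Prop) (x : G -> bool).
Hypothesis s01 : 0 <= s <= 1.
Hypothesis SZ : forall u, u \in S -> ~ Z u.
Hypothesis eps0 : 0 <= eps.
Hypothesis Heps : forall D y, uniq D -> y \in bd S ->
  Ex s D (fun x => ind (exists2 z, open_cluster x y z & Z z)) (@off G) <= eps.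

(** The sites of [C] count as open whatever [x] says: once explored they have left the list [D], so
    that [x] is closed there. *)
Definition far_from C x :=
  exists u, (exists2 c, C c & adj c u) /\ exists2 z, open_cluster x u z & Z z.

Definition exit_at C x (y : G) := (exists2 c, C c & adj c y) \/
  exists u, (exists2 c, C c & adj c u) /\
    touches (eq y) (fun z => x z && (z \in S)) u.

Lemma cluster_upd_avoid x v z u : z != v -> open_cluster (upd x v true) z u ->
  open_cluster x z u \/ exists2 a, open_cluster x z a & adj a v.
Proof.
move=> zv zu.
have ux w : upd x v true w && (w != v) -> x w.
  by rewrite /upd; case: (eqVneq w v) => //=; rewrite andbT.
case: (@cluster_exit _ (predC1 v) _ _ _ _ zu) => //=.
  by move=> zu'; left; exact: (cluster_mono _ zu').
move=> [a [b [za ab _]]]; rewrite negbK => /eqP bv; right.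
by exists a; [exact: (cluster_mono _ za)|rewrite -bv].
Qed.

(* C is the explored part of an open cluster and D consists of the unexplored
   sites; only sites of S are explored, so that the cluster leaves S through a
   site whose own cluster is still unexplored. *)
Lemma exploration_bound D C : uniq D -> (forall c, C c -> c \in S) ->
  Ex s D (fun x => ind (far_from C x)) (@off G) <=
  eps * Ex s D (fun x => \sum_(y <- bd S) ind (exit_at C x y)) (@off G).
Proof.
have [n] := ubnP (size D); elim: n D C => // n IH D C sD uD CS.
case: (pselect (exists v, [/\ v \in D, v \in S & exists2 c, C c & adj c v]));
    last first.
  (* No unexplored site of [S] is adjacent to [C]: a connection from a neighbour of [C] to [Z] has
     to start at a site of [bd S], where [Heps] applies. *)
  move=> noD.
  apply: (@le_trans _ _ (Ex s D (fun x => \sum_(y <- bd S) ind (exists2 c, C c & adj c y) *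
      ind (exists2 z, open_cluster x y z & Z z)) (@off G))).
    apply: Ex_le => // x Hx; rewrite /ind; case: asboolP => [|_]; last first.
      by apply: sumr_ge0 => y _; rewrite mulr_ge0 ?ler0n.
    move=> [u [[c Cc cu] [z uz Zz]]].
    have uD' : u \in D.
      by have [xu _] := cluster_open uz; apply: contraTT xu => /Hx ->.
    have uS : u \notin S.
      by apply/negP => uS; apply: noD; exists u; split => //; exists c.
    have ub : u \in bd S by apply/mem_bd; split => //; exists c => //; exact: CS.
    rewrite (big_rem u)//= !asboolT; [|by exists z|by exists c].
    by rewrite mulr1 lerDl; apply: sumr_ge0 => y _; rewrite mulr_ge0 ?ler0n.
  rewrite /Ex itsum_sum -!/(Ex _ _ _ _).
  apply: (@le_trans _ _ (eps * \sum_(y <- bd S) ind (exists2 c, C c & adj c y))).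
    rewrite mulr_sumr big_seq [leRHS]big_seq; apply: ler_sum => y yS.
    by rewrite itsumZ mulrC; apply: ler_wpM2r; [exact: ind_ge0|exact: Heps].
  apply: ler_wpM2l => //.
  rewrite -[leLHS](itsum_cst (bern_sum1 s) D _ (@off G)).
  by apply: Ex_le => // x _; apply: ler_sum => y _; apply: ind_le; left.
move=> [v [vD vS [c Cc cv]]].
set D' := rem v D.
have pD : perm_eq D (v :: D') by exact: perm_to_rem.
have vD' : v \notin D' by rewrite mem_rem_uniq// inE eqxx.
have uD' : uniq D' by rewrite rem_uniq.
have sD' : (size D' < n)%N by rewrite size_rem//; case: (D) vD sD.
rewrite /Ex !(itsum_perm _ _ _ pD) -!/(Ex _ _ _ _) !Ex_cons//.
have [s0 s1] := andP s01.
rewrite mulrDr ![eps * (_ * _)]mulrCA.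
apply: lerD; apply: ler_wpM2l; rewrite ?subr_ge0//; last exact: IH.
(* [v] open: it joins [C]. Since [v] is not in [Z], a connection to [Z] through [v] goes on from a
   neighbour of [v]. *)
pose C' w := C w \/ w = v.
apply: (@le_trans _ _ (Ex s D' (fun x => ind (far_from C' x)) (@off G))).
  apply: Ex_le => // x Hx; apply: ind_le => -[u [[d Cd du] [z uz Zz]]].
  have zv : z != v by apply/eqP => zv; apply: (SZ vS); rewrite -zv.
  have [zu|[a za av]] := cluster_upd_avoid zv (cluster_sym uz).
    exists u; split; first by exists d => //; left.
    by exists z => //; exact: cluster_sym.
  exists a; split; first by exists v; [right|rewrite adj_sym].
  by exists z => //; exact: cluster_sym.
apply: le_trans (IH _ C' sD' uD' _) _; first by move=> d [/CS//|->].
apply: ler_wpM2l => //; apply: Ex_le => // x Hx; apply: ler_sum => y _.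
have vo : upd x v true v && (v \in S) by rewrite upd_eq.
apply: ind_le => -[[d [Cd|->] dy]|[u [[d [Cd|->] du] ty]]].
- by left; exists d.
- right; exists v; split; first by exists c.
  by exists v; [exact: cluster_refl|exists y].
- right; exists u; split; first by exists d.
  by apply: touches_mono ty => // z /andP[xz ->]; rewrite upd_true.
- right; exists v; split; first by exists c.
  have [a ua ay] : touches (eq y) (fun z => upd x v true z && (z \in S)) u.
    by apply: touches_mono ty => // z /andP[xz ->]; rewrite upd_true.
  exists a => //; apply: cluster_trans ua.
  apply: (@cluster_step _ _ _ v) => //; first exact: cluster_refl.
  have [u' uu' _] := ty; have [/andP[xu uS] _] := cluster_open uu'.
  by rewrite upd_true.
Qed.

(* A Simon-Lieb type inequality. *)
Lemma far_le_exits D v : uniq S -> uniq D -> v \in S ->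
  Ex s D (fun x => ind (exists2 z, open_cluster x v z & Z z)) (@off G) <=
  eps * exits s S v.
Proof.
move=> uS uD vS.
set g := fun x => ind _; have ig : increasing g.
  move=> x y xy; apply: ind_le => -[z vz Zz]; exists z => //.
  exact: cluster_mono vz.
(* [D] need not contain [S]; adding the missing sites can only increase the left side. *)
pose l := D ++ [seq u <- S | u \notin D].
apply: (@le_trans _ _ (Ex s l g (@off G))).
  by apply: Ex_incr_cat => // u; rewrite mem_filter => /andP[].
have ul : uniq l.
  rewrite cat_uniq uD filter_uniq// andbT; apply/hasPn => u.
  by rewrite mem_filter => /andP[].
have lS u : u \in S -> u \in l.
  by move=> uS'; rewrite mem_cat mem_filter uS'; case: (u \in D).
have vl := lS _ vS.
pose l' := rem v l; pose S' := rem v S.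
have vl' : v \notin l' by rewrite mem_rem_uniq// inE eqxx.
have vS' : v \notin S' by rewrite mem_rem_uniq// inE eqxx.
rewrite /exits /Ex (itsum_perm _ _ _ (perm_to_rem vl)).
rewrite [in leRHS](itsum_perm _ _ _ (perm_to_rem vS)) -!/(Ex _ _ _ _) !Ex_cons//.
have [s0 s1] := andP s01.
(* A closed [v] is connected to nothing, so both sides may be reduced to the case of [v] open, with
   the common factor [s]. *)
have -> : Ex s l' g (@off G) = 0.
  rewrite -[RHS](itsum_cst (bern_sum1 s) l' _ (@off G)); apply: eq_itsum => y Hy.
  by apply: indF => -[z /cluster_open[yv _] _]; move: yv; rewrite Hy.
rewrite mulr0 addr0 mulrDr mulrCA; apply: ler_wpDr.
  apply: mulr_ge0 => //; apply: mulr_ge0; first by rewrite subr_ge0.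
  by apply: Ex_ge0 => // y; apply: sumr_ge0 => *; exact: ind_ge0.
apply: ler_wpM2l => //.
pose C w := w = v.
apply: (@le_trans _ _ (Ex s l' (fun x => ind (far_from C x)) (@off G))).
  apply: Ex_le => // x Hx; apply: ind_le => -[z vz Zz].
  have zv : z != v by apply/eqP => zv; apply: (SZ vS); rewrite -zv.
  have [zu|[a za av]] := cluster_upd_avoid zv (cluster_sym vz).
    by have [_] := cluster_open zu; rewrite Hx.
  exists a; split; first by exists v => //; rewrite adj_sym.
  by exists z => //; exact: cluster_sym.
apply: le_trans (exploration_bound _ _) _; first by rewrite rem_uniq.
  by move=> c ->.
apply: ler_wpM2l => //.
(* The exits from [S] read only the states in [S]; the other sites of [l'] integrate to 1. *)
have pl' : perm_eq l' (S' ++ [seq u <- l' | u \notin S]).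
  apply: uniq_perm; first by rewrite rem_uniq.
    rewrite cat_uniq rem_uniq// filter_uniq ?rem_uniq// andbT; apply/hasPn => u.
    by rewrite mem_filter => /andP[vS2 _]; rewrite /= mem_rem_uniq// inE (negbTE vS2) andbF.
  move=> u; rewrite mem_cat mem_filter !mem_rem_uniq// !inE.
  by case: (boolP (u \in S)) => [/lS ->|]; rewrite ?andbT ?andbF ?orbF.
rewrite /Ex (itsum_perm _ _ _ pl') itsum_cat; apply: Ex_le => // y Hy.
set f := (X in _ <= X).
rewrite -[f](itsum_cst (bern_sum1 s) [seq u <- l' | u \notin S] _ y).
apply: Ex_le => // x Hx; apply: ler_sum => w _; apply: ind_le.
have vo : upd y v true v by rewrite upd_eq.
have xy z : x z && (z \in S) -> upd y v true z.
  by move=> /andP[xz zS]; apply: upd_true; rewrite -Hx// mem_filter zS.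
move=> [[d -> dy]|[u [[d -> du] [a ua ay]]]].
  by exists v; [exact: cluster_refl|exists w].
exists a => //; apply: (@cluster_trans _ _ _ u); last exact: cluster_mono ua.
apply: (@cluster_step _ _ _ v) => //; first exact: cluster_refl.
by have [xu _] := cluster_open ua; exact: xy.
Qed.

End ExplorationFromInside.

(** * Events that depend on finitely many sites *)

Lemma measure_bigU (d : measure_display) (T : measurableType d) (R : realType)
    (mu : probability T R) (I : finType) (F : I -> set T) :
  (forall i, measurable (F i)) ->
  (forall i j, (F i `&` F j !=set0)%classic -> i = j) ->
  mu (\big[setU/set0]_i F i) = (\sum_i mu (F i))%E.
Proof.
move=> mF tF; rewrite -bigcup_seq measure_fin_bigcup//; last first.
  by move=> i j _ _; exact: tF.
by rewrite -fsbig_seq ?index_enum_uniq.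
Qed.

Section FiniteDimensional.
Variables (V : choiceType) (A : alphabetType).

Lemma cyl_restrE (l : seq V) (y : V -> A) :
  cyl (restr [fset u in l]%fset y) = [set x | forall u, u \in l -> x u = y u]%classic.
Proof.
apply/seteqP; split => x /=.
  move=> /ffunP xy u ul; have ul' : u \in [fset u in l]%fset by rewrite inE.
  by have := xy [` ul']%fset; rewrite !ffunE.
by move=> xy; apply/ffunP => u; rewrite !ffunE xy//; have := valP u; rewrite inE.
Qed.

Lemma measurable_agree (l : seq V) (y : V -> A) :
  measurable ([set x | forall u, u \in l -> x u = y u]%classic : set (cfg V A)).
Proof. by rewrite -cyl_restrE; exact: measurable_cyl. Qed.

Lemma agree_cons (Q : set (V -> A)) (l : seq V) v (y : V -> A) : v \notin l ->
  ([set x | (forall u, u \in l -> x u = y u) /\ Q x] =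
  \big[setU/set0]_(a : A)
    [set x | (forall u, u \in v :: l -> x u = upd y v a u) /\ Q x])%classic.
Proof.
move=> vl; rewrite -bigcup_seq; apply/seteqP; split => x /=.
  move=> [xy Qx]; exists (x v) => /=; first exact: mem_index_enum.
  split => // u; rewrite inE /upd; case: eqP => [->//|_ /=]; exact: xy.
move=> [a _ /= [xy Qx]]; split => // u ul; rewrite xy ?inE ?ul ?orbT// upd_neq//.
by apply: contraNneq vl => <-.
Qed.

Lemma findim_base (Q : set (V -> A)) (l : seq V) (y : V -> A) :
  depends (fun u => u \in l) Q ->
  [set x | (forall u, u \in l -> x u = y u) /\ Q x]%classic =
  if `[< Q y >] then [set x | forall u, u \in l -> x u = y u]%classic else set0%classic.
Proof.
move=> dQ; case: asboolP => Qy; apply/seteqP; split => x //=.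
- by case.
- by move=> xy; split => //; rewrite (dQ x y).
- by move=> [xy Qx]; apply: Qy; rewrite -(dQ x y).
Qed.

(** Split according to the values of the sites of [l], one site at a time ([l1] is still free, [l2]
    is fixed); with all of them fixed, the event is a cylinder or empty. *)
Lemma measurable_findim (Q : set (V -> A)) (l : seq V) :
  depends (fun u => u \in l) Q -> measurable (Q : set (cfg V A)).
Proof.
move=> dQ.
suff H (l1 l2 : seq V) (y : V -> A) : uniq (l1 ++ l2) ->
    depends (fun u => u \in l1 ++ l2) Q ->
    measurable ([set x | (forall u, u \in l2 -> x u = y u) /\ Q x]%classic : set (cfg V A)).
  have /= := H (undup l) [::] (fun=> point); rewrite cats0 undup_uniq.
  have -> : [set x | (forall u : V, u \in [::] -> x u = point) /\ Q x]%classic = Q.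
    by apply/seteqP; split => x /=; [case|].
  apply => // x y xy; apply: dQ => u ul; apply: xy; by rewrite mem_undup.
elim: l1 l2 y => [|v l1 IH] l2 y ul dl.
  rewrite findim_base//; case: ifP => _; [exact: measurable_agree|exact: measurable0].
move: ul => /=; rewrite mem_cat negb_or => /andP[/andP[vl1 vl2] ul].
rewrite (@agree_cons Q l2 v)//; apply: bigsetU_measurable => a _; apply: IH.
  rewrite cat_uniq /= (negbTE vl1) /= vl2 /=.
  by move: ul; rewrite cat_uniq.
move=> x z xz; apply: dl => u ul'; apply: xz.
by move: ul'; rewrite !(inE, mem_cat) orbCA.
Qed.

End FiniteDimensional.

Section BernoulliExpectation.
Variables (R : realType) (G : graph) (p : R) (P : probability (cfg G bool) R).
Hypothesis PB : is_bernoulli p P.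

Lemma bernoulli_agree (l : seq G) (y : G -> bool) : uniq l ->
  P [set x | forall u, u \in l -> x u = y u]%classic = (\prod_(u <- l) bern p (y u))%:E.
Proof.
move=> ul.
rewrite -cyl_restrE PB; congr (_%:E).
rewrite (eq_bigr (fun u => bern p (y (val u)))); last by move=> u _; rewrite ffunE.
rewrite -(big_seq_fsetE _ _ xpredT (fun u => bern p (y u))) /=.
apply: perm_big; apply: uniq_perm => //; first exact: fset_uniq.
by move=> u; rewrite inE.
Qed.

(** The same splitting as in [measurable_findim]; the fixed sites contribute the product of their
    weights. This is the only bridge between the Bernoulli measure and the finite sums. *)
Lemma bernoulli_Ex (Q : set (G -> bool)) (l : seq G) x : uniq l ->
  depends (fun u => u \in l) Q ->
  P Q = (Ex p l (fun x => ind (Q x)) x)%:E.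
Proof.
move=> ul dQ.
suff H (l1 l2 : seq G) (y : G -> bool) : uniq (l1 ++ l2) ->
    depends (fun u => u \in l1 ++ l2) Q ->
    P [set x | (forall u, u \in l2 -> x u = y u) /\ Q x]%classic =
    ((\prod_(u <- l2) bern p (y u)) * Ex p l1 (fun x => ind (Q x)) y)%:E.
  have := H l [::] x; rewrite cats0 big_nil mul1r => <- //; congr (P _).
  by apply/seteqP; split => z /=; [|case].
elim: l1 l2 y {ul dQ} => [|v l1 IH] l2 y ul dl.
  rewrite findim_base// /Ex /= /ind; case: asboolP => Qy.
    by rewrite bernoulli_agree// mulr1.
  by rewrite measure0 mulr0.
move: ul => /=; rewrite mem_cat negb_or => /andP[/andP[vl1 vl2] ul].
have dl' : depends (fun u => u \in l1 ++ v :: l2) Q.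
  move=> x' z xz; apply: dl => u ul'; apply: xz.
  by move: ul'; rewrite !(inE, mem_cat) orbCA.
have ul' : uniq (l1 ++ v :: l2).
  rewrite cat_uniq /= (negbTE vl1) /= vl2 /=.
  by move: ul; rewrite cat_uniq.
rewrite (@agree_cons _ _ Q l2 v)// measure_bigU; first last.
- move=> a b [z /= [[za _] [zb _]]].
  by rewrite -(upd_eq y v a) -za ?mem_head// zb ?mem_head// upd_eq.
- move=> a; apply: (@measurable_findim _ _ _ (l1 ++ v :: l2)) => z z' zz'.
  apply/propext; split => -[zy Qz]; split.
  + by move=> u ul3; rewrite -zz'; [exact: zy|rewrite mem_cat ul3 orbT].
  + by rewrite -(dl' z z').
  + by move=> u ul3; rewrite zz'; [exact: zy|rewrite mem_cat ul3 orbT].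
  + by rewrite (dl' z z').
transitivity (\sum_(a : bool) ((\prod_(u <- v :: l2) bern p (upd y v a u)) *
    Ex p l1 (fun x => ind (Q x)) (upd y v a))%:E)%E.
  by apply: eq_bigr => a _; exact: IH.
rewrite sumEFin /Ex /= mulr_sumr; congr (_%:E); apply: eq_bigr => a _.
rewrite big_cons upd_eq mulrCA mulrA; congr (_ * _ * _).
rewrite big_seq [RHS]big_seq; apply: eq_bigr => u ul2; rewrite upd_neq//.
by apply: contraNneq vl2 => <-.
Qed.

End BernoulliExpectation.

(** * Boxes in the plane and the percolation event *)

Section Distance.
Implicit Types u v w : Z2.

Definition dist u v : nat := maxn `|u.1 - v.1|%N `|u.2 - v.2|%N.

Lemma distxx u : dist u u = 0%N.
Proof. rewrite /dist; lia. Qed.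

Lemma dist_triangle u v w : (dist u w <= dist u v + dist v w)%N.
Proof. rewrite /dist; lia. Qed.

Lemma dist_adj u v : adj u v -> (dist u v <= 1)%N.
Proof. rewrite /dist /= /Z2adj; lia. Qed.

Lemma distD u v w : dist ((u : int * int) + w) ((v : int * int) + w) = dist u v.
Proof. by case: u v w => [u1 u2] [v1 v2] [w1 w2]; rewrite /dist /=; lia. Qed.

Definition interval (a : int) (n : nat) : seq int :=
  [seq a - n%:Z + k%:Z | k <- iota 0 (2 * n).+1].

Lemma mem_interval a n i : (i \in interval a n) = (`|a - i|%N <= n)%N.
Proof.
apply/mapP/idP => [[k]|H]; first by rewrite mem_iota => ? ->; lia.
by exists `|(i - a + n%:Z)%R|%N; [rewrite mem_iota; lia|lia].
Qed.

Definition box u (n : nat) : seq Z2 :=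
  [seq ((i, j) : Z2) | i <- interval u.1 n, j <- interval u.2 n].

Lemma mem_box u n v : (v \in box u n) = (dist u v <= n)%N.
Proof.
case: v => i j; apply/allpairsP/idP => /= [[[a b] /= [Ha Hb [-> ->]]]|H].
  by move: Ha Hb; rewrite !mem_interval /dist /= geq_max => -> ->.
by move: H; rewrite /dist /= geq_max => /andP[H1 H2]; exists (i, j); rewrite /= !mem_interval.
Qed.

Lemma box_uniq u n : uniq (box u n).
Proof.
apply: allpairs_uniq; last by move=> [? ?] [? ?] _ _ [-> ->].
all: by rewrite map_inj_uniq ?iota_uniq// => k k'; lia.
Qed.

Lemma size_box u n : size (box u n) = ((2 * n).+1 ^ 2)%N.
Proof. by rewrite size_allpairs !size_map size_iota. Qed.

End Distance.

Section Percolates.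
Implicit Types (c u v w : Z2) (x : Z2 -> bool).

(** The first site outside of the box need not be open, so that the event depends on the box
    only. *)
Definition leaves_box n c x :=
  touches (fun w => (n < dist c w)%N) (fun z => x z && (dist c z <= n)%N) c.

Lemma leaves_boxP n c x u : open_cluster x c u -> (n < dist c u)%N ->
  leaves_box n c x.
Proof.
move=> cu nu; have := @cluster_exit _ (fun z => (dist c z <= n)%N) x c u.
rewrite distxx => /(_ isT cu)[/cluster_open[_]|[a [b [ca ab _]]]].
  by rewrite leqNgt nu andbF.
by rewrite -ltnNge => nb; exists a => //; exists b.
Qed.

Lemma leaves_box_far n c x : leaves_box n c x ->
  exists2 u, open_cluster x c u & (n <= dist c u)%N.
Proof.
move=> [u cu [w uw nw]]; exists u; first by apply: cluster_mono cu => z /andP[].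
by have := dist_adj uw; have := dist_triangle c u w; lia.
Qed.

Lemma leaves_boxS n m c x : (m <= n)%N -> leaves_box n c x -> leaves_box m c x.
Proof.
move=> mn [u cu [w uw nw]].
have [um|mu] := leqP (dist c u) m; last first.
  by apply: leaves_boxP mu; apply: cluster_mono cu => z /andP[].
have := @cluster_exit _ (fun z => (dist c z <= m)%N) _ c u _ cu.
rewrite distxx => /(_ isT)[cu'|[a [b [ca ab _]]]].
  exists u; last by exists w => //; lia.
  by apply: cluster_mono cu' => z /andP[/andP[-> _] ->].
rewrite -ltnNge => nb; exists a => //; last by exists b.
by apply: cluster_mono ca => z /andP[/andP[-> _] ->].
Qed.

Lemma depends_leaves_box n c :
  depends (fun u => u \in box c n) (leaves_box n c).
Proof.
move=> x y xy; rewrite /leaves_box.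
suff -> : (fun z => x z && (dist c z <= n)%N) = (fun z => y z && (dist c z <= n)%N) by [].
apply/funext => z; case: (boolP (dist c z <= n)%N); rewrite ?andbF ?andbT// => H.
by apply: xy; rewrite mem_box.
Qed.

(** A cluster is infinite exactly when it leaves every box. Enumerating the sites makes the event a
    countable combination of finite-dimensional ones, hence measurable. *)
Lemma percolatesE : @percolates Z2 =
  (\bigcup_k if @choice.unpickle Z2 k is Some c then \bigcap_n leaves_box n c else set0)%classic.
Proof.
apply/seteqP; split => x /=.
  move=> [c inf]; exists (choice.pickle c); first exact: I; rewrite choice.pickleK => n _ /=.
  apply: contrapT => H; apply: inf.
  apply: (sub_finite_set _ (finite_seq (box c n))) => u /= cu.
  by rewrite mem_box leqNgt; apply/negP => nu; apply: H; exact: leaves_boxP nu.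
move=> [k _]; case: choice.unpickle => // c H; exists c => fin.
have [n Hn] : exists n, forall u, open_cluster x c u -> (dist c u <= n)%N.
  have /finite_seqP[s Hs] := fin; exists (\max_(u <- s) dist c u) => u cu.
  apply: (@leq_bigmax_seq _ _ xpredT (dist c)) => //.
  by have : [set` s]%classic u by rewrite -Hs.
have [u cu] := leaves_box_far (H n.+1 I).
by have := Hn u cu; lia.
Qed.

Section NoPercolation.
Variables (R : realType) (p : R) (P : probability (cfg Z2 bool) R).
Hypothesis PB : is_bernoulli p P.

Definition theta (s : R) n : R :=
  Ex s (box (0, 0) n) (fun x => ind (leaves_box n (0, 0) x)) (@off Z2).

Lemma measurable_leaves_box n c : measurable (leaves_box n c : set (cfg Z2 bool)).
Proof. exact: (measurable_findim (@depends_leaves_box n c)). Qed.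

(** Continuity from above: the events of leaving the n-th box decrease to an event contained in
    percolation. *)
Lemma theta_small : P (@percolates Z2) = 0%E ->
  forall e : R, 0 < e -> exists n, theta p n < e.
Proof.
move=> P0 e e0.
have Pn n : P (leaves_box n (0, 0)) = (theta p n)%:E.
  exact: (bernoulli_Ex PB _ (box_uniq _ _) (@depends_leaves_box n _)).
have mI c : measurable ((\bigcap_n leaves_box n c)%classic : set (cfg Z2 bool)).
  by apply: bigcap_measurableType => n _; exact: measurable_leaves_box.
have mp : measurable (@percolates Z2 : set (cfg Z2 bool)).
  rewrite percolatesE; apply: bigcup_measurable => k _.
  by case: choice.unpickle => [c|]; [exact: mI|exact: measurable0].
have I0 : P (\bigcap_n leaves_box n (0%R, 0%R))%classic = 0%E.
  apply/eqP; rewrite eq_le measure_ge0 andbT -P0; apply: le_measure; rewrite ?inE//.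
  by rewrite percolatesE => x Hx; exists (choice.pickle ((0, 0) : Z2));
    [exact: I|rewrite choice.pickleK].
have : ((fun n => P (leaves_box n (0, 0))) @ \oo --> 0%E)%classic.
  rewrite -I0; apply: nonincreasing_cvg_mu => //.
  - by apply: le_lt_trans (probability_le1 _ _) _; rewrite ?ltry//; exact: measurable_leaves_box.
  - by move=> i; exact: measurable_leaves_box.
  - by move=> n m nm; apply/subsetPset => x; exact: leaves_boxS.
rewrite (_ : (fun n => _) = (fun n => (theta p n)%:E)); last by apply/funext.
move=> /fine_cvgP[_ /cvgr0_norm_lt/(_ _ e0)[n _ /(_ n (leqnn n)) /= H]].
by exists n; apply: le_lt_trans H; exact: ler_norm.
Qed.

End NoPercolation.

End Percolates.

(** * Sharpness: a finite set with less than one expected exit *)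

Section Subcritical.
Variable R : realType.
Implicit Types (s q p : R) (n : nat).

Let o : Z2 := (0, 0).

(** The difference on the left does not read the state at [v], and the one on the right vanishes
    when [v] is open; hence the factor [1 - s]. It turns Russo's formula into the sum of
    [pivotal_lower_bound]. *)
Lemma pivotal_Ex (V : eqType) s (l : seq V) v (g : (V -> bool) -> R) :
  uniq l -> v \in l ->
  (1 - s) * Ex s l (fun y => g (upd y v true) - g (upd y v false)) (@off V) =
  Ex s l (fun y => g (upd y v true) - g y) (@off V).
Proof.
move=> ul vl.
have vl' : v \notin rem v l by rewrite mem_rem_uniq// inE eqxx.
rewrite /Ex !(itsum_perm _ _ _ (perm_to_rem vl)) -!/(Ex _ _ _ _) !Ex_cons//.
have e1 : Ex s (rem v l) (fun y => g (upd (upd y v true) v true) -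
    g (upd (upd y v true) v false)) (@off V) =
    Ex s (rem v l) (fun y => g (upd y v true) - g (upd y v false)) (@off V).
  by apply: eq_itsum => y _; rewrite !upd_id.
have e2 : Ex s (rem v l) (fun y => g (upd (upd y v true) v true) -
    g (upd y v true)) (@off V) = 0.
  rewrite -[RHS](itsum_cst (bern_sum1 s) (rem v l) _ (@off V)).
  by apply: eq_itsum => y _; rewrite upd_id subrr.
have e3 : Ex s (rem v l) (fun y => g (upd y v true) - g (upd y v false)) (@off V) =
    Ex s (rem v l) (fun y => g (upd y v true) - g y) (@off V).
  apply: eq_itsum => y Hy; congr (_ - g _); rewrite -[RHS](upd_self y v).
  by rewrite Hy.
rewrite e1 e2 e3; ring.
Qed.

Definition outside n : Z2 -> Prop := fun w => (n < dist o w)%N.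

Lemma theta_touches s n :
  theta s n = Ex s (box o n) (fun x => ind (touches (outside n) x o)) (@off Z2).
Proof.
apply: eq_itsum => x Hx; rewrite /leaves_box; congr (ind (touches _ _ _)).
apply/funext => z; case: (boolP (dist o z <= n)%N); rewrite ?andbT ?andbF// => H.
by rewrite Hx// mem_box.
Qed.

Lemma exits_incr s q (S : seq Z2) v : 0 <= q -> q <= s -> s <= 1 ->
  exits q S v <= exits s S v :> R.
Proof.
move=> q0 qs s1; apply: Ex_mono => // x y xy.
by apply: ler_sum => w _; exact: touches_increasing.
Qed.

(** If every finite set had at least one expected exit at [q], hence at all parameters above, then
    (1 - c) theta'(c) >= 1 - theta(c) between [q] and [p]. So theta would grow linearly on that
    interval, against its smallness at [p]. *)
Lemma exits_lt1 q p : 0 <= q -> q < p -> p <= 1 ->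
  (forall e, 0 < e -> exists n, theta p n < e) ->
  exists S : seq Z2, [/\ uniq S, o \in S & exits q S o < 1].
Proof.
move=> q0 qp p1 Hth; apply: contrapT => noS.
have {noS}Hq S : uniq S -> o \in S -> 1 <= exits q S o.
  by move=> uS oS; rewrite leNgt; apply/negP => H; apply: noS; exists S.
(* The bound is used twice: being at most 1/2, it makes the derivative at least 1/2, and the mean
   value theorem then gives theta(p) >= (p - q) / 2. *)
have [n Hn] : exists n, theta p n < (p - q) / 2 by apply: Hth; lra.
pose g x : R := ind (touches (outside n) x o).
pose df s := \sum_(v <- box o n)
  Ex s (box o n) (fun y => g (upd y v true) - g (upd y v false)) (@off Z2).
have dth s : is_derive s 1 (fun s => theta s n) (df s).
  rewrite (_ : (fun s => theta s n) = (fun s => Ex s (box o n) g (@off Z2))).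
    by apply: is_derive_Ex; exact: box_uniq.
  by apply/funext => r; exact: theta_touches.
have [|c cqp] := @MVT R (fun s => theta s n) df q p qp (fun x _ => dth x).
  by apply: derivable_within_continuous => x _; exact: @ex_derive.
move: cqp; rewrite in_itv /= => /andP[qc cp] Hc.
have c01 : 0 <= c <= 1 by lra.
have Hdf : 1 - theta c n <= (1 - c) * df c.
  rewrite /df mulr_sumr big_seq.
  rewrite (eq_bigr (fun v => Ex c (box o n) (fun y => g (upd y v true) - g y) (@off Z2)));
    last by move=> v vb; apply: pivotal_Ex => //; exact: box_uniq.
  rewrite -big_seq /Ex -itsum_sum -!/(Ex _ _ _ _).
  apply: (@le_trans _ _ (Ex c (box o n) (fun x => 1 - g x) (@off Z2))).
    rewrite /Ex itsumB itsum_cst; last exact: bern_sum1.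
    by rewrite theta_touches.
  (* At the start nothing inside of the box is explored, and [F] is everything outside of it. *)
  apply: (@pivotal_lower_bound _ _ c o c01 _ (box o n) (outside n) [::]) => //.
  - move=> D uD oD; apply: le_trans (Hq D uD oD) _.
    by apply: exits_incr => //; lra.
  - exact: box_uniq.
  - by rewrite mem_box distxx.
  - by move=> u v _; rewrite mem_box -ltnNge => nv _; left.
have thcp : theta c n <= theta p n.
  apply: Ex_mono => //; [lra|lra|].
  move=> x y xy; apply: ind_le; apply: touches_mono => // z /andP[/xy -> ->] //.
have th0 : 0 <= theta q n by apply: Ex_ge0 => [|y]; [lra|exact: ind_ge0].
have df1 : 2^-1 <= df c.
  nra.
nra.
Qed.

End Subcritical.

(** * Exponential decay of connection probabilities *)

Section ExponentialDecay.
Variable R : realType.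

Lemma itsum_map (V : eqType) (A : finType) (w : A -> R) (f g : V -> V) l
    (h : (V -> A) -> R) x : cancel f g -> cancel g f ->
  itsum w (map f l) h x = itsum w l (fun y => h (y \o g)) (x \o f).
Proof.
move=> fg gf; elim: l x => [|v l IH] x /=.
  by congr h; apply/funext => u /=; rewrite gf.
apply: eq_bigr => a _; rewrite IH; congr (_ * itsum _ _ _ _); apply/funext => u /=.
by rewrite /upd (can_eq fg).
Qed.

Lemma cluster_hom (G : graph) (f : G -> G) (x y : G -> bool) u v :
  (forall a b, adj a b -> adj (f a) (f b)) -> (forall a, x a -> y (f a)) ->
  open_cluster x u v -> open_cluster y (f u) (f v).
Proof.
move=> fadj xy uv; have [xu _] := cluster_open uv; move: v uv.
apply: (@cluster_ind _ x u (fun v => open_cluster y (f u) (f v))).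
  by apply: cluster_refl; exact: xy.
move=> v w _ fv vw xw; apply: (cluster_step fv); [exact: fadj|exact: xy].
Qed.

Definition translate (v u : Z2) : Z2 := ((u : int * int) + v)%R.

Lemma translateK v : cancel (translate v) (translate (- (v : int * int))%R).
Proof. by move=> u; rewrite /translate addrK. Qed.

Lemma translateVK v : cancel (translate (- (v : int * int))%R) (translate v).
Proof. by move=> u; rewrite /translate subrK. Qed.

Lemma adj_translate v a b : adj (translate v a) (translate v b) = adj a b.
Proof.
case: a b v => [a1 a2] [b1 b2] [v1 v2]; rewrite /= /Z2adj /=; lia.
Qed.

Lemma perm_bd_translate (S : seq Z2) v :
  perm_eq (bd (map (translate v) S)) (map (translate v) (bd S)).
Proof.
apply: uniq_perm.
- exact: bd_uniq.
- by rewrite map_inj_uniq ?bd_uniq//; exact: can_inj (translateK v).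
move=> u; apply/mem_bd/mapP => [[uS [w /mapP[w' w'S ->] wu]]|[w /mem_bd[wS [w' w'S ww']] ->]].
  exists (translate (- (v : int * int))%R u); last by rewrite translateVK.
  apply/mem_bd; split.
    by apply: contra uS => uS; apply/mapP; exists (translate (- (v : int * int))%R u) => //;
      rewrite translateVK.
  by exists w' => //; rewrite -(adj_translate v) translateVK.
rewrite mem_map; last exact: can_inj (translateK v).
split => //; exists (translate v w'); first exact: map_f.
by rewrite adj_translate.
Qed.

Lemma exits_translate (s : R) (S : seq Z2) v : 0 <= s <= 1 ->
  exits s (map (translate v) S) v <= exits s S (0, 0).
Proof.
move=> s01; rewrite /exits /Ex (itsum_map _ _ _ _ (translateK v) (translateVK v)).
apply: Ex_le => // x _.
rewrite (perm_big _ (perm_bd_translate S v)) big_map; apply: ler_sum => y _; apply: ind_le.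
move=> [u vu [z uz yz]]; subst z.
exists (translate (- (v : int * int))%R u); last first.
  exists y => //; by rewrite -(adj_translate v) translateVK.
have -> : ((0, 0) : Z2) = translate (- (v : int * int))%R v.
  by rewrite /translate subrr.
apply: cluster_hom vu => [a b|a]; first by rewrite adj_translate.
by [].
Qed.

(** Iterate [far_le_exits] with translates of [S]: every stretch of length [L] costs a factor
    [phi < 1]. The rate [r] is the L-th root of [phi], and the constant [phi^-1] pays for rounding
    [m] down to a multiple of [L]. *)
Lemma exponential_decay (q p : R) (P : probability (cfg Z2 bool) R) :
  0 <= q -> q < p -> p <= 1 -> is_bernoulli p P -> P (@percolates Z2) = 0%E ->
  exists K r : R, [/\ 0 < K, 0 < r < 1 & forall (D : seq Z2) v m, uniq D ->
    Ex q D (fun x => ind (exists2 z, open_cluster x v z & (m <= dist v z)%N)) (@off Z2)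
      <= K * r ^+ m].
Proof.
move=> q0 qp p1 PB P0.
have [S [uS oS S1]] := exits_lt1 q0 qp p1 (theta_small PB P0).
have q01 : 0 <= q <= 1 by lra.
(* The maximum with 1/2 keeps [phi] positive, so that it has a logarithm and an inverse. *)
pose phi := Num.max (exits q S (0, 0)) 2^-1.
have phi0 : 0 < phi by rewrite lt_max; apply/orP; right; lra.
have phi1 : phi < 1 by rewrite gt_max S1; lra.
(* The successor makes all of [S] strictly closer than [L], so that [S] avoids the target and its
   boundary sites are within distance [L]. *)
pose L := (\max_(u <- S) dist (0%R, 0%R) u).+1.
have SL u : u \in S -> (dist (0%R, 0%R) u < L)%N.
  by move=> uS'; rewrite ltnS; apply: (@leq_bigmax_seq _ _ xpredT (dist (0%R, 0%R))).
have step k : forall (D : seq Z2) v, uniq D ->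
    Ex q D (fun x => ind (exists2 z, open_cluster x v z & (k * L <= dist v z)%N)) (@off Z2)
    <= phi ^+ k.
  elim: k => [|k IH] D v uD.
    by rewrite expr0; apply: Ex_le1 => // y; exact: ind_le1.
  have vE : v = translate v (0, 0) by rewrite /translate add0r.
  have Sv u : u \in map (translate v) S -> (dist v u < L)%N.
    by move=> /mapP[w wS ->]; rewrite {1}vE distD; exact: SL.
  apply: le_trans (far_le_exits q01 (S := map (translate v) S) (eps := phi ^+ k) _ _ _ _ uD _) _.
  - by move=> u /Sv uL; apply/negP; rewrite -ltnNge mulSn (leq_trans uL)// leq_addr.
  - by apply: exprn_ge0; exact: ltW.
  - move=> D' y uD' /mem_bd[_ [u /Sv uL uy]].
    apply: le_trans (IH D' y uD'); apply: Ex_le => // x _; apply: ind_le.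
    move=> [z yz vz]; exists z => //; move: vz; rewrite mulSn.
    move=> /leq_trans/(_ (dist_triangle v y z)) vz; rewrite -(leq_add2l L).
    apply: leq_trans vz _; rewrite leq_add2r (leq_trans (dist_triangle v u y))//.
    by rewrite -(addn1 (dist v u)) in uL *; exact: leq_trans (leq_add (leqnn _) (dist_adj uy)) uL.
  - by rewrite map_inj_uniq//; exact: can_inj (translateK v).
  - by rewrite {1}vE; apply: map_f.
  rewrite exprSr; apply: ler_wpM2l; first by apply: exprn_ge0; exact: ltW.
  by apply: le_trans (exits_translate _ _ q01) _; rewrite le_max lexx.
pose r := expR (ln phi / L%:R).
have rL : r ^+ L = phi.
  by rewrite -expRM_natl mulrC divfK ?pnatr_eq0// lnK// posrE.
have r0 : 0 < r by exact: expR_gt0.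
have r1 : r < 1.
  by rewrite -expR0 ltr_expR pmulr_llt0 ?invr_gt0 ?ltr0n// ln_lt0// phi0.
exists phi^-1, r; split; [by rewrite invr_gt0|by rewrite r0|].
move=> D v m uD.
apply: (@le_trans _ _ (phi ^+ (m %/ L))).
  apply: le_trans (step (m %/ L)%N D v uD); apply: Ex_le => // x _; apply: ind_le.
  by move=> [z vz mz]; exists z => //; apply: leq_trans mz; exact: leq_trunc_div.
rewrite mulrC ler_pdivlMr// -exprSr -{1}rL -exprM.
by apply: ler_wiXn2l; rewrite ?(ltW r0) ?(ltW r1)// mulnC ltnW// ltn_ceil.
Qed.

End ExponentialDecay.

(** * Disagreement percolation *)

Section Mixtures.
Variables (R : realType) (I : finType).
Implicit Types (al e : I -> R).

(* The bound comes from the maximal coupling of [al] and [al']. *)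
Lemma mixture_dist al al' e e' (q eps0 eps1 : R) :
  (forall i, 0 <= al i) -> (forall i, 0 <= al' i) ->
  \sum_i al i = 1 -> \sum_i al' i = 1 ->
  (forall E : pred I, \sum_(i | E i) (al i - al' i) <= q) ->
  (forall i, 0 < al i -> 0 < al' i -> `|e i - e' i| <= eps0) ->
  (forall i j, 0 < al i -> 0 < al' j -> `|e i - e' j| <= eps1) ->
  0 <= eps0 -> eps0 <= eps1 ->
  `|\sum_i al i * e i - \sum_i al' i * e' i| <= q * eps1 + (1 - q) * eps0.
Proof.
move=> al0 al0' al1 al1' Hq He0 He1 e00 e01.
(* [m] is the mass on which the coupling keeps the two indices equal. The residues [r] and [r'] have
   the same mass [tau <= q] and are coupled independently. *)
pose m i := Num.min (al i) (al' i).
pose r i := al i - m i; pose r' i := al' i - m i.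
have m0 i : 0 <= m i by rewrite le_min al0 al0'.
have r0 i : 0 <= r i by rewrite subr_ge0 ge_min lexx.
have r0' i : 0 <= r' i by rewrite subr_ge0 ge_min lexx orbT.
pose tau := \sum_i r i.
have tauE : \sum_i m i = 1 - tau by rewrite /tau sumrB al1; ring.
have tauE' : \sum_i r' i = tau by rewrite sumrB al1' tauE; ring.
have tau0 : 0 <= tau by apply: sumr_ge0.
have tauq : tau <= q.
  apply: le_trans (Hq (fun i => al' i < al i)).
  rewrite /tau (bigID (fun i => al' i < al i)) /= [X in _ + X]big1 ?addr0.
    by apply: ler_sum => i /ltW H; rewrite /r /m min_r.
  by move=> i; rewrite -leNgt => H; rewrite /r /m min_l// subrr.
have -> : \sum_i al i * e i - \sum_i al' i * e' i =
    \sum_i m i * (e i - e' i) + (\sum_i r i * e i - \sum_i r' i * e' i).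
  rewrite -!sumrB -big_split /=; apply: eq_bigr => i _; rewrite /r /r'; ring.
have H1 : `|\sum_i m i * (e i - e' i)| <= (1 - tau) * eps0.
  apply: le_trans (ler_norm_sum _ _ _) _; rewrite -tauE mulr_suml.
  apply: ler_sum => i _; rewrite normrM (ger0_norm (m0 i)).
  have [mi|mi] := eqVneq (m i) 0; first by rewrite mi !mul0r.
  apply: ler_wpM2l => //; have : 0 < m i by rewrite lt_def mi m0.
  by rewrite lt_min => /andP[]; exact: He0.
have H2 : `|\sum_i r i * e i - \sum_i r' i * e' i| <= tau * eps1.
  have [t0|t0] := eqVneq tau 0.
    have rz i : r i = 0 by exact: (psumr_eq0P (fun i _ => r0 i) t0).
    have rz' i : r' i = 0 by exact: (psumr_eq0P (fun i _ => r0' i) (etrans tauE' t0)).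
    by rewrite !big1 ?subrr ?normr0 ?t0 ?mul0r// => i _; rewrite ?rz ?rz' mul0r.
  have tp : 0 < tau by rewrite lt_def t0.
  (* The coupling of the residues has weights [r i * r' j / tau]; multiplying by [tau] clears the
     denominator. *)
  rewrite -(ler_pM2l tp) -{1}(ger0_norm tau0) -normrM.
  have -> : tau * (\sum_i r i * e i - \sum_i r' i * e' i) =
      \sum_i \sum_j r i * r' j * (e i - e' j).
    transitivity (\sum_i \sum_j (r' j * (r i * e i) - r i * (r' j * e' j))).
      under [RHS]eq_bigr => i _ do rewrite sumrB -mulr_suml -mulr_sumr tauE'.
      by rewrite sumrB -mulr_sumr -mulr_suml mulrBr.
    by apply: eq_bigr => i _; apply: eq_bigr => j _; ring.
  apply: le_trans (ler_norm_sum _ _ _) _; rewrite mulrA {1}/tau mulr_suml mulr_suml.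
  apply: ler_sum => i _; apply: le_trans (ler_norm_sum _ _ _) _.
  rewrite -tauE' mulr_sumr mulr_suml; apply: ler_sum => j _.
  rewrite normrM ger0_norm ?mulr_ge0//.
  have [ri|ri] := eqVneq (r i) 0; first by rewrite ri !mul0r.
  have [rj|rj] := eqVneq (r' j) 0; first by rewrite rj mulr0 !mul0r.
  apply: ler_wpM2l; first exact: mulr_ge0.
  apply: He1.
    by apply: (@lt_le_trans _ _ (r i)); [rewrite lt_def ri r0|rewrite gerBl].
  by apply: (@lt_le_trans _ _ (r' j)); [rewrite lt_def rj r0'|rewrite gerBl].
apply: le_trans (ler_normD _ _) _.
nra.
Qed.

End Mixtures.

(** * Laws given by pattern probabilities, and conditional expectations *)

Section Laws.
Variables (R : realType) (G : graph) (A : alphabetType).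
Implicit Types (P : seq G -> (G -> A) -> R) (U T D : seq G) (x y : G -> A).

Definition sumc := @itsum R G A (fun=> 1).

Lemma sumc_cons D v g x : sumc (v :: D) g x = \sum_a sumc D g (upd x v a).
Proof. by apply: eq_bigr => a _; rewrite mul1r. Qed.

Lemma le_sumc D g g' x :
  (forall y, (forall u, u \notin D -> y u = x u) -> g y <= g' y) ->
  sumc D g x <= sumc D g' x.
Proof. by apply: le_itsum => a; exact: ler01. Qed.

(* [P U x] stands for the probability that the configuration agrees with x on U. *)
Record is_law P : Prop := IsLaw {
  law_nil : forall x, P [::] x = 1;
  law_ge0 : forall U x, 0 <= P U x;
  law_ext : forall U x y, (forall u, u \in U -> x u = y u) -> P U x = P U y;
  law_mem : forall U U' x, U =i U' -> P U x = P U' x;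
  law_marg : forall v U x, v \notin U -> \sum_a P (v :: U) (upd x v a) = P U x }.

Definition avg P D T (f : (G -> A) -> R) x :=
  sumc D (fun y => f y * P (D ++ T) y) x / P T x.

Section LawTheory.
Variable P : seq G -> (G -> A) -> R.
Hypothesis PL : is_law P.

Lemma law_catC D v T x : P (v :: D ++ T) x = P (D ++ v :: T) x.
Proof. by apply: (law_mem PL) => u; rewrite !(inE, mem_cat) orbCA. Qed.

Lemma law_sum D T x : uniq D -> (forall u, u \in D -> u \notin T) ->
  sumc D (P (D ++ T)) x = P T x.
Proof.
elim: D T x => [|v D IH] T x //; rewrite cons_uniq => /andP[vD uD] DT.
rewrite sumc_cons -(law_marg PL x (DT v (mem_head _ _))).
apply: eq_bigr => a _.
rewrite (_ : P (v :: D ++ T) = P (D ++ v :: T)); last first.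
  by apply/funext => y; exact: law_catC.
apply: IH => // u uD'; rewrite inE negb_or DT ?inE ?uD' ?orbT// andbT.
by apply: contraNneq vD => <-.
Qed.

Lemma law_consr v U x : P (v :: U) x <= P U x.
Proof.
case: (boolP (v \in U)) => vU.
  rewrite (law_mem PL (U' := U))// => u; rewrite inE.
  by case: eqVneq => // ->; rewrite vU.
rewrite -(law_marg PL x vU) (bigD1 (x v))//= upd_self lerDl.
by apply: sumr_ge0 => a _; exact: (law_ge0 PL).
Qed.

Lemma law_catr D U x : P (D ++ U) x <= P U x.
Proof. by elim: D => //= v D IH; apply: le_trans (law_consr _ _ _) IH. Qed.

Lemma law_off D T x y : (forall u, u \in D -> u \notin T) ->
  (forall u, u \notin D -> y u = x u) -> P T y = P T x.
Proof.
move=> DT yx; apply: (law_ext PL) => u uT; apply: yx.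
by apply/negP => /DT; rewrite uT.
Qed.

(** Also valid for a null pattern on [T], because all of its extensions are null. *)
Lemma avgE D T f x : (forall u, u \in D -> u \notin T) ->
  sumc D (fun y => f y * P (D ++ T) y) x = P T x * avg P D T f x.
Proof.
move=> DT; rewrite /avg; have [T0|T0] := eqVneq (P T x) 0; last by field.
rewrite T0 mul0r /sumc -[RHS](mul0r (sumc D (fun=> 0) x)) -itsumZ.
apply: eq_itsum => y Hy; rewrite mul0r (_ : P _ y = 0) ?mulr0//.
apply/eqP; rewrite eq_le (law_ge0 PL) andbT -T0 -(law_off DT Hy).
exact: law_catr.
Qed.

Lemma avg_le D T f x c : uniq D -> (forall u, u \in D -> u \notin T) -> 0 < P T x ->
  (forall y, (forall u, u \notin D -> y u = x u) -> 0 < P (D ++ T) y -> f y <= c) ->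
  avg P D T f x <= c.
Proof.
move=> uD DT T0 Hf; rewrite ler_pdivrMr// -(law_sum x uD DT) /sumc -itsumZ.
apply: le_sumc => y Hy; have := law_ge0 PL (D ++ T) y.
rewrite le_eqVlt => /orP[/eqP <-|Py]; first by rewrite !mulr0.
by rewrite ler_pM2r//; exact: Hf.
Qed.

Lemma avgN D T f x : avg P D T (fun y => - f y) x = - avg P D T f x.
Proof.
rewrite /avg -mulNr /sumc -itsumN; congr (_ / _).
by apply: eq_itsum => y _; rewrite mulNr.
Qed.

Lemma avg_ge D T f x c : uniq D -> (forall u, u \in D -> u \notin T) -> 0 < P T x ->
  (forall y, (forall u, u \notin D -> y u = x u) -> 0 < P (D ++ T) y -> c <= f y) ->
  c <= avg P D T f x.
Proof.
move=> uD DT T0 Hf; rewrite -lerN2 -avgN; apply: avg_le => // y Hy Py.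
by rewrite lerN2; exact: Hf.
Qed.

Lemma avg01 D T f x : uniq D -> (forall u, u \in D -> u \notin T) -> 0 < P T x ->
  (forall y, 0 <= f y <= 1) -> 0 <= avg P D T f x <= 1.
Proof.
move=> uD DT T0 f01; rewrite avg_ge ?avg_le// => y _ _.
  by case/andP: (f01 y).
by case/andP: (f01 y).
Qed.

(** The law of total probability with [v] revealed first; this is the inductive step of
    [disagreement]. *)
Lemma avg_cons D D' v T f x : perm_eq D (v :: D') -> uniq D ->
  (forall u, u \in D -> u \notin T) ->
  avg P D T f x = \sum_a (P (v :: T) (upd x v a) / P T x) *
                          avg P D' (v :: T) f (upd x v a).
Proof.
move=> pD uD DT; have := uD; rewrite (perm_uniq pD) /= => /andP[vD' uD'].
rewrite {1}/avg /sumc (itsum_perm _ _ _ pD) -/(sumc _ _ _) sumc_cons mulr_suml.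
apply: eq_bigr => a _; rewrite mulrAC -avgE; last first.
  move=> u uD2; rewrite inE negb_or DT ?(perm_mem pD) ?inE ?uD2 ?orbT// andbT.
  by apply: contraNneq vD' => <-.
rewrite /sumc; congr (_ / _); apply: eq_itsum => y _.
by rewrite (law_mem PL (U' := D' ++ v :: T))// => u;
  rewrite mem_cat (perm_mem pD) !(inE, mem_cat) -orbA orbCA.
Qed.

End LawTheory.

Lemma avg_diff_le P P' D D' T T' f f' x x' q : is_law P -> is_law P' ->
  uniq D -> uniq D' ->
  (forall u, u \in D -> u \notin T) -> (forall u, u \in D' -> u \notin T') ->
  0 < P T x -> 0 < P' T' x' ->
  (forall y y', (forall u, u \notin D -> y u = x u) ->
    (forall u, u \notin D' -> y' u = x' u) -> 0 < P (D ++ T) y ->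
    0 < P' (D' ++ T') y' -> f y - f' y' <= q) ->
  avg P D T f x - avg P' D' T' f' x' <= q.
Proof.
move=> PL PL' uD uD' DT DT' T0 T0' H.
rewrite lerBlDr; apply: (avg_le PL uD DT T0) => y Hy Py; rewrite -lerBlDl.
by apply: (avg_ge PL' uD' DT' T0') => y' Hy' Py'; rewrite lerBlDl -lerBlDr; exact: H.
Qed.

End Laws.

(** * Gibbs laws and the propagation of disagreements *)

Section Gibbs.
Variables (R : realType) (G : graph) (A : alphabetType) (L : specification R G A).
Implicit Types (P : seq G -> (G -> A) -> R) (U T D S : seq G) (x y : G -> A).

Definition spec_at S x : R := L [fset u in S]%fset (restr _ x) (restr _ x).

(* A law on a strip is viewed as a law on the whole plane that is frozen to [bc]
   outside of the region [V]. *)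
Record gibbs (V : pred G) (bc : G -> A) P : Prop := Gibbs {
  gibbs_law : is_law P;
  gibbs_markov : forall S T x, {subset S <= V} -> (forall u, u \in S -> u \notin T) ->
    {subset bd S <= T} -> P (S ++ T) x = P T x * spec_at S x;
  gibbs_frozen : forall U x u, u \in U -> ~~ V u -> x u <> bc u -> P U x = 0 }.

Lemma spec_at_depends S : depends (fun u => u \in S \/ u \in bd S) (spec_at S).
Proof.
move=> x y xy; rewrite /spec_at; congr (L _ _); apply/ffunP => u; rewrite !ffunE; apply: xy.
  by right; exact: valP.
by left; have := valP u; rewrite inE.
Qed.

Variable q : R.
Hypothesis q01 : 0 <= q <= 1.
Hypothesis Hq : forall v x y (E : pred A),
  \sum_(a | E a) (spec_at [:: v] (upd x v a) - spec_at [:: v] (upd y v a)) <= q.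

(** [T] may miss neighbours of [v]. Averaging over these leaves a mixture of single-site measures of
    the specification, and any two such mixtures are still within [q] of each other. *)
Lemma site_avg V bc P (PG : gibbs V bc P) v T x (E : pred A) : V v -> v \notin T ->
  \sum_(a | E a) P (v :: T) (upd x v a) / P T x =
  avg P [seq u <- bd [:: v] | u \notin T] T
    (fun y => \sum_(a | E a) spec_at [:: v] (upd y v a)) x.
Proof.
move=> Vv vT; have PL := gibbs_law PG.
pose D := [seq u <- bd [:: v] | u \notin T]; rewrite -/D.
have vD : v \notin D.
  by rewrite mem_filter negb_and; apply/orP; right; apply/negP => /mem_bd[]; rewrite mem_head.
have uD : uniq D by rewrite filter_uniq ?bd_uniq.
have DT u : u \in D -> u \notin T by rewrite mem_filter => /andP[].
rewrite /avg -mulr_suml; congr (_ / _).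
transitivity (\sum_(a | E a) sumc D (fun y => spec_at [:: v] (upd y v a) * P (D ++ T) y) x);
    last first.
  by rewrite /sumc -itsum_sum; apply: eq_itsum => y _; rewrite mulr_suml.
apply: eq_bigr => a _.
rewrite -(law_sum PL _ uD); last first.
  by move=> u uD'; rewrite inE negb_or DT// andbT; apply: contraNneq vD => <-.
rewrite /sumc itsum_upd//; apply: eq_itsum => y Hy.
rewrite -(law_catC PL) -cat1s (gibbs_markov PG).
- rewrite mulrC; congr (_ * _); apply: (law_ext PL) => u.
  rewrite mem_cat => uDT; rewrite upd_neq//; apply: contraTneq uDT => ->.
  by rewrite negb_or vD vT.
- by move=> u; rewrite inE => /eqP ->.
- by move=> u; rewrite inE => /eqP ->; rewrite mem_cat negb_or vD vT.
- by move=> u ub; rewrite mem_cat mem_filter ub andbT orNb.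
Qed.

Section Disagreement.
Variables (V V' : pred G) (bc bc' : G -> A) (P P' : seq G -> (G -> A) -> R).
Hypotheses (PG : gibbs V bc P) (PG' : gibbs V' bc' P').

Lemma site_dist v T T' x x' (E : pred A) : V v -> V' v -> v \notin T -> v \notin T' ->
  0 < P T x -> 0 < P' T' x' ->
  \sum_(a | E a) (P (v :: T) (upd x v a) / P T x -
                  P' (v :: T') (upd x' v a) / P' T' x') <= q.
Proof.
move=> Vv Vv' vT vT' T0 T0'; rewrite sumrB !(site_avg PG, site_avg PG')//.
apply: avg_diff_le => //.
- exact: gibbs_law PG.
- exact: gibbs_law PG'.
- by rewrite filter_uniq ?bd_uniq.
- by rewrite filter_uniq ?bd_uniq.
- by move=> u; rewrite mem_filter => /andP[].
- by move=> u; rewrite mem_filter => /andP[].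
- by move=> y y' _ _ _ _; rewrite -sumrB; exact: Hq.
Qed.

Lemma avg_spec_at V0 bc0 P0 (PG0 : gibbs V0 bc0 P0) D T f x : {subset D <= V0} ->
  (forall u, u \in D -> u \notin T) -> {subset bd D <= T} -> 0 < P0 T x ->
  avg P0 D T f x = sumc D (fun y => f y * spec_at D y) x.
Proof.
move=> DV DT bD T0; apply: (mulfI (lt0r_neq0 T0)).
rewrite /avg mulrCA divff ?gt_eqF// mulr1.
rewrite /sumc -itsumZ; apply: eq_itsum => y Hy.
by rewrite (gibbs_markov PG0)// (law_off (gibbs_law PG0) DT Hy); ring.
Qed.

(* Disagreement percolation (van den Berg and Maes): a disagreement on the
   boundary can only reach B along a path of sites at which the optimal coupling
   of the two single-site marginals fails. *)
Lemma disagreement D F (B : G -> Prop) T T' x x' f : uniq D ->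
  {subset D <= V} -> {subset D <= V'} ->
  (forall u, u \in D -> u \notin T) -> (forall u, u \in D -> u \notin T') ->
  {subset bd D <= T} -> {subset bd D <= T'} -> 0 < P T x -> 0 < P' T' x' ->
  (forall w, w \in bd D -> x w <> x' w -> F w) ->
  (forall y, 0 <= f y <= 1) -> depends B f ->
  (forall b, B b -> b \notin D -> x b = x' b) ->
  `|avg P D T f x - avg P' D T' f x'| <=
  Ex q D (fun om => ind (exists2 b, B b & touches F om b)) (@off G).
Proof.
have PL := gibbs_law PG; have PL' := gibbs_law PG'.
have [n] := ubnP (size D); elim: n D F T T' x x' => // n IH.
move=> D F T T' x x' sD uD DV DV' DT DT' bT bT' T0 T0' xF f01 fB xB.
case: (pselect (exists2 v, v \in D & exists2 w, adj v w & F w)); last first.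
  (* No site of [D] is next to [F], so the two configurations agree on [bd D] and both averages are
     the same sum. *)
  move=> noF.
  rewrite (avg_spec_at PG)// (avg_spec_at PG')//.
  rewrite (_ : sumc D _ x = sumc D (fun y => f y * spec_at D y) x').
    by rewrite subrr normr0; apply: Ex_ge0 => // y; exact: ind_ge0.
  apply: (@itsum_ext _ _ _ _ (fun u => B u \/ (u \in D \/ u \in bd D))).
    move=> y y' yy'; congr (_ * _).
      by apply: fB => u Bu; apply: yy'; left.
    by apply: spec_at_depends => u uD'; apply: yy'; right.
  move=> u [Bu|[->//|ub]] uD'; first exact: xB.
  apply: contrapT => xu; have /mem_bd[_ [w wD wu]] := ub.
  by apply: noF; exists w => //; exists u => //; exact: xF.
move=> [v vD [w vw Fw]].
set D' := rem v D.
have pD : perm_eq D (v :: D') by exact: perm_to_rem.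
have vD' : v \notin D' by rewrite mem_rem_uniq// inE eqxx.
have uD' : uniq D' by rewrite rem_uniq.
have sD' : (size D' < n)%N by rewrite size_rem//; case: (D) vD sD.
have D'E u : u \in D' = (u != v) && (u \in D) by rewrite mem_rem_uniq// inE.
have D'D u : u \in D' -> u \in D by rewrite D'E => /andP[].
have bD' u : u \in bd D' -> u != v -> u \in bd D.
  move=> /mem_bd[uD2 [z zD zu]] uv; apply/mem_bd; split; last by exists z => //; exact: D'D.
  by move: uD2; rewrite D'E uv.
have DvT u : u \in D' -> u \notin v :: T.
  by rewrite D'E inE negb_or => /andP[-> /DT].
have DvT' u : u \in D' -> u \notin v :: T'.
  by rewrite D'E inE negb_or => /andP[-> /DT'].
have bvT : {subset bd D' <= v :: T}.
  by move=> u ub; rewrite inE; case: (eqVneq u v) => //= uv; apply: bT; exact: bD'.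
have bvT' : {subset bd D' <= v :: T'}.
  by move=> u ub; rewrite inE; case: (eqVneq u v) => //= uv; apply: bT'; exact: bD'.
rewrite (avg_cons PL _ _ pD)// (avg_cons PL' _ _ pD)//.
pose g om : R := ind (exists2 b, B b & touches F om b).
rewrite -/g /Ex (itsum_perm _ _ _ pD) -/(Ex _ _ _ _) Ex_cons//.
have [q0 q1] := andP q01.
have Tpos a : 0 < P (v :: T) (upd x v a) / P T x -> 0 < P (v :: T) (upd x v a).
  by rewrite pmulr_lgt0 ?invr_gt0.
have Tpos' a : 0 < P' (v :: T') (upd x' v a) / P' T' x' -> 0 < P' (v :: T') (upd x' v a).
  by rewrite pmulr_lgt0 ?invr_gt0.
(* The weights [q] and [1 - q] of [Ex_cons] are those of the coupling at [v]: open means that the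
   values may differ, closed that they agree. *)
apply: mixture_dist.
- by move=> a; rewrite divr_ge0 ?(law_ge0 PL).
- by move=> a; rewrite divr_ge0 ?(law_ge0 PL').
- by rewrite -mulr_suml (law_marg PL) ?DT// divff ?gt_eqF.
- by rewrite -mulr_suml (law_marg PL') ?DT'// divff ?gt_eqF.
- by move=> E; apply: site_dist; rewrite ?DT ?DT' ?DV ?DV'//; [exact: DV|exact: DV'].
(* Equal values at [v]: no new source of disagreement. *)
- move=> a /Tpos Ta /Tpos' Ta'; apply: IH => //.
  + by move=> u /D'D; exact: DV.
  + by move=> u /D'D; exact: DV'.
  + move=> u ub; rewrite /upd; case: eqVneq => // uv; apply: xF; exact: bD'.
  + move=> b Bb bD2; rewrite /upd; case: eqVneq => // bv; apply: xB => //.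
    by move: bD2; rewrite D'E bv.
(* Possibly different values at [v]. If [v] is in [B], the event is certain and the trivial bound 1
   suffices; otherwise [v] joins [F]. *)
- move=> a a' /Tpos Ta /Tpos' Ta'; case: (pselect (B v)) => Bv.
    have -> : Ex q D' (fun om => g (upd om v true)) (@off G) = 1.
      rewrite -[RHS](itsum_cst (bern_sum1 q) D' _ (@off G)).
      apply: eq_itsum => y Hy; apply: indT; exists v => //; exists v; last by exists w.
      by apply: cluster_refl; rewrite upd_eq.
    have := avg01 PL uD' DvT Ta f01; have := avg01 PL' uD' DvT' Ta' f01.
    by rewrite ler_norml; lra.
  pose F' := fun w => F w \/ w = v.
  apply: le_trans (IH D' F' (v :: T) (v :: T') _ _ _ _ _ _ _ _ _ _ _ _ _ _ _ _) _ => //.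
  + by move=> u /D'D; exact: DV.
  + by move=> u /D'D; exact: DV'.
  + move=> u ub; rewrite /upd; case: eqVneq => [->|uv]; first by right.
    by left; apply: xF => //; exact: bD'.
  + move=> b Bb bD2; rewrite /upd; case: eqVneq => [bv|bv].
      by case: Bv; rewrite -bv.
    by apply: xB => //; move: bD2; rewrite D'E bv.
  apply: Ex_le => // y Hy; apply: ind_le => -[b Bb tb]; exists b => //.
  apply/touches_upd => //;
    [by apply/eqP => bv; apply: Bv; rewrite -bv|by rewrite Hy|by exists w].
- by apply: Ex_ge0 => // y; exact: ind_ge0.
- apply: Ex_le => // y Hy; apply: ind_le => -[b Bb tb]; exists b => //.
  by apply: touches_mono tb => // z; exact: upd_true.
Qed.

End Disagreement.

End Gibbs.

(** * Conditional entropies *)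

Section Eta.
Variable R : realType.
Implicit Types s t : R.

Definition entfun s : R := - (s * ln s).

Lemma entfun0 : entfun 0 = 0.
Proof. by rewrite /entfun mul0r oppr0. Qed.

Lemma entfun_ge0 s : 0 <= s <= 1 -> 0 <= entfun s.
Proof. by move=> /andP[s0 s1]; rewrite /entfun -mulrN mulr_ge0// oppr_ge0 ln_le0. Qed.

Lemma ln_le_subr1 s : 0 < s -> ln s <= s - 1.
Proof.
move=> s0; have := @expR_ge1Dx R (ln s); rewrite lnK ?posrE//; lra.
Qed.

Lemma entfunM s t : 0 <= s -> 0 <= t -> entfun (s * t) = s * entfun t + t * entfun s.
Proof.
move=> s0 t0; rewrite /entfun; have [->|sn] := eqVneq s 0.
  by rewrite !mul0r oppr0 mulr0 addr0.
have [->|tn] := eqVneq t 0; first by rewrite !(mulr0, mul0r) oppr0 mulr0 addr0.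
by rewrite lnM ?posrE ?lt_def ?sn ?tn//; ring.
Qed.

Lemma entfun_le1 s : 0 <= s <= 1 -> entfun s <= 1.
Proof.
move=> /andP[]; rewrite le_eqVlt => /orP[/eqP <- _|s0 s1]; first by rewrite entfun0.
have := ln_le_subr1 (s := s^-1); rewrite invr_gt0 => /(_ s0); rewrite lnV ?posrE// => H.
rewrite /entfun -mulrN; apply: (@le_trans _ _ (s * (s^-1 - 1))).
  by rewrite ler_pM2l.
rewrite mulrBr divff ?gt_eqF//; lra.
Qed.

(** With s = a^2 the product rule gives 2 a (-a ln a), and -a ln a <= 1. *)
Lemma entfun_le_sqrt s : 0 <= s <= 1 -> entfun s <= 2 * Num.sqrt s.
Proof.
move=> /andP[]; rewrite le_eqVlt => /orP[/eqP <- _|s0 s1].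
  by rewrite entfun0 sqrtr0 mulr0.
set a := Num.sqrt s; have a0 : 0 < a by rewrite sqrtr_gt0.
have sE : s = a * a by rewrite -expr2 sqr_sqrtr// ltW.
have a1 : a <= 1 by rewrite -sqrtr1 ler_sqrt.
have := entfun_le1 (s := a); rewrite (ltW a0) a1 => /(_ isT) H.
by rewrite sE entfunM ?(ltW a0)//; nra.
Qed.

(** An increase is bounded by subadditivity ([up]), a decrease by ln u <= u - 1 at u = t / s ([lo]).
    A power modulus keeps exponentially small errors exponentially small. *)
Lemma entfun_modulus s t : 0 <= s <= 1 -> 0 <= t <= 1 ->
  `|entfun s - entfun t| <= 2 * Num.sqrt `|s - t|.
Proof.
wlog st : s t / s <= t.
  move=> H s01 t01; case: (leP s t) => [st|/ltW ts]; first exact: H.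
  by rewrite distrC (distrC s t); exact: H.
move=> /andP[s0 s1] /andP[t0 t1].
have [->|sneq] := eqVneq s t; first by rewrite !subrr normr0 sqrtr0 mulr0.
have {sneq}st' : s < t by rewrite lt_def eq_sym sneq.
set d := t - s; have d0 : 0 < d by rewrite subr_gt0.
have d1 : d <= 1 by rewrite /d; lra.
rewrite distrC (distrC s t) (gtr0_norm d0).
have tE : t = s + d by rewrite /d; ring.
have tp : 0 < t by lra.
have Hd : entfun d <= 2 * Num.sqrt d by apply: entfun_le_sqrt; rewrite (ltW d0).
have up : entfun t - entfun s <= entfun d.
  rewrite /entfun; have ld : d * ln d <= d * ln t.
    by rewrite ler_pM2l// ler_ln ?posrE//; lra.
  have ls : s * ln s <= s * ln t.
    move: s0; rewrite le_eqVlt => /orP[/eqP <-|s0]; first by rewrite !mul0r.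
    by rewrite ler_pM2l// ler_ln ?posrE.
  have -> : t * ln t = s * ln t + d * ln t by rewrite tE; ring.
  lra.
have lo : entfun s - entfun t <= d.
  have lt0 : ln t <= 0 by rewrite ln_le0.
  rewrite /entfun; have -> : t * ln t = s * ln t + d * ln t by rewrite {1}tE; ring.
  have dl : d * ln t <= 0 by nra.
  suff : s * ln t - s * ln s <= d by lra.
  move: s0; rewrite le_eqVlt => /orP[/eqP <-|s0]; first by rewrite !mul0r subrr ltW.
  have := ln_le_subr1 (s := t / s); rewrite divr_gt0// => /(_ isT).
  rewrite ln_div ?posrE// => H.
  rewrite -mulrBr; apply: (@le_trans _ _ (s * (t / s - 1))); first by rewrite ler_pM2l.
  by rewrite mulrBr mulrCA divff ?gt_eqF// !mulr1 /d.
have dsq : d <= 2 * Num.sqrt d.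
  have : Num.sqrt d <= 1 by rewrite -sqrtr1 ler_sqrt.
  have : 0 < Num.sqrt d by rewrite sqrtr_gt0.
  have : d = Num.sqrt d * Num.sqrt d by rewrite -expr2 sqr_sqrtr// ltW.
  nra.
rewrite ler_norml; apply/andP; split; lra.
Qed.

End Eta.

(** * Tower property and chain rule *)

Section Towers.
Variables (R : realType) (G : graph) (A : alphabetType).
Variable P : seq G -> (G -> A) -> R.
Hypothesis PL : is_law P.
Implicit Types (D T U : seq G) (x y : G -> A).

Lemma marginal_sum D T g x : uniq D -> (forall u, u \in D -> u \notin T) ->
  depends (fun u => u \notin D) g ->
  sumc (D ++ T) (fun y => g y * P (D ++ T) y) x = sumc T (fun y => g y * P T y) x.
Proof.
move=> uD DT dg; rewrite /sumc (itsum_perm _ _ _ (permEl (perm_catC D T))) itsum_cat.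
apply: eq_itsum => y _.
by rewrite (itsum_mull _ _ _ dg)//; congr (_ * _); apply: (law_sum PL).
Qed.

Lemma avg_tower D Q T f x : uniq D -> uniq Q ->
  (forall u, u \in D -> u \notin T) -> (forall u, u \in Q -> u \notin T) ->
  (forall u, u \in D -> u \notin Q) -> depends (fun u => u \notin Q) f ->
  avg P D T f x = avg P Q T (avg P D (Q ++ T) f) x.
Proof.
move=> uD uQ DT QT DQ dfQ.
suff H : sumc D (fun y => f y * P (D ++ T) y) x =
    sumc Q (fun y => avg P D (Q ++ T) f y * P (Q ++ T) y) x by rewrite {1}/avg H.
transitivity (sumc Q (sumc D (fun y => f y * P (D ++ Q ++ T) y)) x); last first.
  apply: eq_itsum => y _; rewrite mulrC (avgE PL)// => u uD2.
  by rewrite mem_cat negb_or DQ// DT.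
rewrite /sumc -itsum_cat (itsum_perm _ _ _ (permEl (perm_catC Q D))) itsum_cat.
apply: eq_itsum => y _; rewrite (itsum_mull _ _ _ dfQ)//; congr (_ * _).
rewrite (_ : P (D ++ Q ++ T) = P (Q ++ D ++ T)); last first.
  by apply/funext => z; apply: (law_mem PL) => u; rewrite !mem_cat orbCA.
apply/esym/(law_sum PL) => // u uQ2; rewrite mem_cat negb_or QT// andbT.
by apply: contraL uQ2; exact: DQ.
Qed.

(** Brings the conditional law of a site into the form of an average over a whole window, to which
    [disagreement] applies. *)
Lemma avg_site D T v a x : uniq D -> (forall u, u \in D -> u \notin T) -> v \in D ->
  0 < P T x ->
  avg P D T (fun y => ind (y v = a)) x = P (v :: T) (upd x v a) / P T x.
Proof.
move=> uD DT vD T0.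
have pD : perm_eq D (v :: rem v D) by exact: perm_to_rem.
have vD' : v \notin rem v D by rewrite mem_rem_uniq// inE eqxx.
rewrite (avg_cons PL _ _ pD)// (bigD1 a)//= [X in _ + X]big1 ?addr0.
  have [Pa|Pa] := eqVneq (P (v :: T) (upd x v a)) 0; first by rewrite Pa !mul0r.
  rewrite (_ : avg _ _ _ _ _ = 1) ?mulr1//.
  have dis u : u \in rem v D -> u \notin v :: T.
    by rewrite mem_rem_uniq// !inE negb_or => /andP[-> /DT].
  rewrite /avg; apply/eqP; rewrite -(inj_eq (mulIf Pa)) mul1r divfK//; apply/eqP.
  rewrite -[RHS](law_sum PL _ _ dis) ?rem_uniq//; apply: eq_itsum => y Hy.
  by rewrite indT ?mul1r// Hy// upd_eq.
move=> b ba; rewrite [X in _ * X](_ : _ = 0) ?mulr0//.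
rewrite /avg (_ : sumc _ _ _ = 0) ?mul0r//.
rewrite /sumc -[RHS](mul0r (sumc (rem v D) (fun=> 0) (upd x v b))) -itsumZ.
apply: eq_itsum => y Hy; rewrite mul0r indF ?mul0r// Hy// upd_eq.
by move=> /eqP; rewrite (negbTE ba).
Qed.

Definition local_entropy v U x : R := \sum_a entfun (P (v :: U) (upd x v a) / P U x).

Definition cond_entropy v U : R :=
  sumc U (fun x => P U x * local_entropy v U x) (fun=> point).

Definition set_entropy U : R := sumc U (fun x => entfun (P U x)) (fun=> point).

Lemma site_prob01 v U x a : v \notin U -> 0 <= P (v :: U) (upd x v a) / P U x <= 1.
Proof.
move=> vU; rewrite divr_ge0 ?(law_ge0 PL)//=.
have [P0|P0] := eqVneq (P U x) 0; first by rewrite P0 invr0 mulr0 ler01.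
rewrite ler_pdivrMr ?lt_def ?P0 ?(law_ge0 PL)// mul1r -(law_marg PL x vU).
by rewrite (bigD1 a)//= lerDl; apply: sumr_ge0 => *; exact: (law_ge0 PL).
Qed.

Lemma local_entropy_ge0 v U x : v \notin U -> 0 <= local_entropy v U x.
Proof. by move=> vU; apply: sumr_ge0 => a _; apply: entfun_ge0; exact: site_prob01. Qed.

Lemma local_entropy_le v U x : v \notin U -> local_entropy v U x <= #|A|%:R.
Proof.
move=> vU; apply: (@le_trans _ _ (\sum_(a : A) 1)); last by rewrite sumr_const.
by apply: ler_sum => a _; apply: entfun_le1; exact: site_prob01.
Qed.

Lemma sumc_law U x : uniq U -> sumc U (P U) x = 1.
Proof.
move=> uU; rewrite -[RHS](law_nil PL x) -[in LHS](cats0 U).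
by rewrite -(law_sum PL (D := U)) ?cats0.
Qed.

Lemma cond_entropy_bound v U : uniq U -> v \notin U -> 0 <= cond_entropy v U <= #|A|%:R.
Proof.
move=> uU vU; apply/andP; split.
  apply: itsum_ge0 => [a|y _]; first exact: ler01.
  by rewrite mulr_ge0 ?(law_ge0 PL) ?local_entropy_ge0.
apply: (@le_trans _ _ (sumc U (fun x => #|A|%:R * P U x) (fun=> point))).
  apply: le_sumc => y _; rewrite mulrC; apply: ler_wpM2r; first exact: (law_ge0 PL).
  exact: local_entropy_le.
by rewrite /sumc itsumZ -/(sumc _ _ _) sumc_law// mulr1.
Qed.

(** Pattern by pattern this is [entfunM], applied to the probability of the past and the conditional
    probability at [v]. *)
Lemma entropy_chain v U : uniq U -> v \notin U ->
  set_entropy (v :: U) = set_entropy U + cond_entropy v U.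
Proof.
move=> uU vU; rewrite /set_entropy /cond_entropy sumc_cons /sumc -itsumD.
transitivity (\sum_a sumc U (fun y => entfun (P (v :: U) (upd y v a))) (fun=> point)).
  by apply: eq_bigr => a _; rewrite /sumc itsum_upd.
rewrite /sumc -itsum_sum; apply: eq_itsum => y _; rewrite /local_entropy.
have [P0|P0] := eqVneq (P U y) 0.
  rewrite P0 entfun0 mul0r addr0 big1// => a _.
  rewrite (_ : P _ _ = 0) ?entfun0//; apply/eqP; rewrite eq_le (law_ge0 PL) andbT.
  rewrite -P0 -(law_marg PL y vU) (bigD1 a)//= lerDl.
  by apply: sumr_ge0 => *; exact: (law_ge0 PL).
transitivity (\sum_a (P U y * entfun (P (v :: U) (upd y v a) / P U y) +
    P (v :: U) (upd y v a) / P U y * entfun (P U y))).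
  apply: eq_bigr => a _; rewrite -entfunM ?(law_ge0 PL)//.
    by congr entfun; field.
  by rewrite divr_ge0 ?(law_ge0 PL).
rewrite big_split /= -mulr_sumr addrC -!mulr_suml (law_marg PL)//.
by rewrite divff// mul1r.
Qed.

End Towers.

Lemma dist_exit (s b u w : Z2) rho m : (dist s b + m <= rho)%N -> adj u w ->
  (rho < dist s w)%N -> (m <= dist b u)%N.
Proof.
move=> sb uw sw; have := dist_adj uw; have := dist_triangle s u w.
by have := dist_triangle s b u; lia.
Qed.

(** * Conditional entropies depend little on what is far away *)

Section Comparison.
Variables (R : realType) (A : alphabetType) (L : specification R Z2 A).
Variables (q K r : R).
Hypothesis q01 : 0 <= q <= 1.
Hypothesis Hq : forall v x y (E : pred A),
  \sum_(a | E a) (spec_at L [:: v] (upd x v a) - spec_at L [:: v] (upd y v a)) <= q.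
Hypotheses (K0 : 0 < K) (r0 : 0 <= r).
Hypothesis decay : forall (D : seq Z2) v m, uniq D ->
  Ex q D (fun x => ind (exists2 z, open_cluster x v z & (m <= dist v z)%N)) (@off Z2)
    <= K * r ^+ m.
Implicit Types (U W B : seq Z2) (x : Z2 -> A) (s u w : Z2) (V : pred Z2).

Record same_near s (rho : nat) V bc U V' bc' U' : Prop := SameNear {
  same_region : forall u, (dist s u <= rho)%N -> V u = V' u;
  same_bc : forall u, (dist s u <= rho)%N -> ~~ V u -> bc u = bc' u :> A;
  same_past : forall u, (dist s u <= rho)%N -> (u \in U) = (u \in U') }.

Lemma same_near_sym s rho V bc U V' bc' U' :
  same_near s rho V bc U V' bc' U' -> same_near s rho V' bc' U' V bc U.
Proof.
move=> [H1 H2 H3]; split => u su; rewrite ?H1 ?H3// => Vu.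
by rewrite H2// H1.
Qed.

Lemma same_near_refl s rho V bc U : same_near s rho V bc U V bc U.
Proof. by []. Qed.

Lemma same_near_le s rho rho' V bc U V' bc' U' : (rho <= rho')%N ->
  same_near s rho' V bc U V' bc' U' -> same_near s rho V bc U V' bc' U'.
Proof.
move=> rr [H1 H2 H3]; split => u su; [apply: H1|apply: H2|apply: H3];
  exact: leq_trans rr.
Qed.

Lemma same_near_nil s rho V bc U V' bc' U' :
  same_near s rho V bc U V' bc' U' -> same_near s rho V bc [::] V' bc' [::].
Proof. by case. Qed.

(** The sites of the box that are still random. *)
Definition window s rho V U : seq Z2 := [seq u <- box s rho | V u && (u \notin U)].

Lemma mem_window s rho V U u :
  (u \in window s rho V U) = [&& (dist s u <= rho)%N, V u & u \notin U].
Proof. by rewrite mem_filter mem_box andbC. Qed.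

Lemma window_uniq s rho V U : uniq (window s rho V U).
Proof. by rewrite filter_uniq ?box_uniq. Qed.

Lemma window_same s rho V bc U V' bc' U' : same_near s rho V bc U V' bc' U' ->
  window s rho V' U' = window s rho V U.
Proof.
move=> H; apply: eq_in_filter => u; rewrite mem_box => su.
by rewrite (same_region H)// (same_past H).
Qed.

(** A site of [bd W] inside of the box is in the past, where the values agree, or outside of the
    region, where both laws are frozen to the same value. So disagreements start outside of the box
    and have to travel a distance [m] to reach [B]. *)
Lemma window_comparison1 V bc P V' bc' P' s rho m U U' x x' B f :
  gibbs L V bc P -> gibbs L V' bc' P' ->
  same_near s rho V bc U V' bc' U' ->
  0 < P U x -> 0 < P' U' x' ->
  (forall u, u \in U -> (dist s u <= rho)%N -> x u = x' u) ->
  (forall b, b \in B -> V b /\ (dist s b + m <= rho)%N) ->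
  (forall y, 0 <= f y <= 1) -> depends (fun u => u \in B) f ->
  avg P (window s rho V U) U f x - avg P' (window s rho V U) U' f x' <=
    (size B)%:R * (K * r ^+ m).
Proof.
move=> PG PG' H T0 T0' xx' HB f01 fB.
have PL := gibbs_law PG; have PL' := gibbs_law PG'.
set W := window s rho V U.
have WE u : (u \in W) = [&& (dist s u <= rho)%N, V u & u \notin U] by exact: mem_window.
have WE' u : (u \in W) = [&& (dist s u <= rho)%N, V' u & u \notin U'].
  by rewrite /W -(window_same H) mem_window.
pose Q := [seq u <- bd W | u \notin U]; pose Q' := [seq u <- bd W | u \notin U'].
have uW : uniq W by exact: window_uniq.
have uQ : uniq Q by rewrite filter_uniq ?bd_uniq.
have uQ' : uniq Q' by rewrite filter_uniq ?bd_uniq.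
have WU u : u \in W -> u \notin U by rewrite WE => /and3P[].
have WU' u : u \in W -> u \notin U' by rewrite WE' => /and3P[].
have QU u : u \in Q -> u \notin U by rewrite mem_filter => /andP[].
have QU' u : u \in Q' -> u \notin U' by rewrite mem_filter => /andP[].
have bdW u : u \in bd W -> u \notin W by move=> /mem_bd[].
have WQ u : u \in W -> u \notin Q.
  by move=> uW'; rewrite mem_filter negb_and; apply/orP; right; apply: contraL uW'; exact: bdW.
have WQ' u : u \in W -> u \notin Q'.
  by move=> uW'; rewrite mem_filter negb_and; apply/orP; right; apply: contraL uW'; exact: bdW.
have BWU b : b \in B -> b \in W \/ b \in U.
  move=> /HB[Vb sb]; rewrite WE Vb; case: (boolP (b \in U)); [by right|left].
  by rewrite andbT (leq_trans (leq_addr _ _) sb).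
have BU' b : b \in B -> b \notin W -> b \in U /\ b \in U'.
  move=> bB bW; have [|bU] := BWU _ bB; first by rewrite (negbTE bW).
  have [_ sb] := HB _ bB.
  by split => //; rewrite -(same_past H)// (leq_trans (leq_addr _ _) sb).
have fQ : depends (fun u => u \notin Q) f.
  move=> y y' yy'; apply: fB => u uB; apply: yy'.
  have [/WQ//|uU] := BWU _ uB; by apply: contraL uU; exact: QU.
have fQ' : depends (fun u => u \notin Q') f.
  move=> y y' yy'; apply: fB => u uB; apply: yy'.
  case: (boolP (u \in W)) => [/WQ'//|uW']; have [_ uU] := BU' _ uB uW'.
  by apply: contraL uU; exact: QU'.
rewrite (avg_tower PL _ uW uQ)// (avg_tower PL' _ uW uQ')//.
apply: avg_diff_le => // z z' Hz Hz' Pz Pz'.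
apply: le_trans (ler_norm _) _.
have WQU u : u \in W -> u \notin Q ++ U by move=> uW'; rewrite mem_cat negb_or WQ// WU.
have WQU' u : u \in W -> u \notin Q' ++ U' by move=> uW'; rewrite mem_cat negb_or WQ'// WU'.
pose F (w : Z2) := (rho < dist s w)%N : Prop.
apply: (@le_trans _ _ (Ex q W (fun om =>
    ind (exists2 b, b \in B & touches F om b)) (@off Z2))).
  apply: (disagreement q01 Hq PG PG') => //.
  - by move=> u; rewrite WE => /and3P[].
  - by move=> u; rewrite WE' => /and3P[].
  - by move=> u ub; rewrite mem_cat mem_filter ub andbT orNb.
  - by move=> u ub; rewrite mem_cat mem_filter ub andbT orNb.
  - move=> w wb zw; apply: contrapT => /negP; rewrite -leqNgt => sw; apply: zw.
    have := bdW _ wb; rewrite WE sw /= negb_and negbK.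
    case: (boolP (w \in U)) => [wU _|wU].
      have wU' : w \in U' by rewrite -(same_past H).
      rewrite Hz ?Hz' ?xx'// mem_filter ?wU ?wU'//.
    rewrite orbF => Vw; have wU' : w \notin U' by rewrite -(same_past H).
    have wQ : w \in Q by rewrite mem_filter wU.
    have wQ' : w \in Q' by rewrite mem_filter wU'.
    have -> : z w = bc w.
      apply: contrapT => zb; move: Pz.
      by rewrite (gibbs_frozen PG _ Vw zb) ?ltxx// mem_cat wQ.
    have Vw' : ~~ V' w by rewrite -(same_region H).
    have -> : z' w = bc' w.
      apply: contrapT => zb; move: Pz'.
      by rewrite (gibbs_frozen PG' _ Vw' zb) ?ltxx// mem_cat wQ'.
    exact: (same_bc H).
  - move=> b bB bW; have [bU bU'] := BU' _ bB bW.
    have bQ : b \notin Q by apply: contraL bU; exact: QU.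
    have bQ' : b \notin Q' by apply: contraL bU'; exact: QU'.
    have [_ /(leq_trans (leq_addr _ _)) sb] := HB _ bB.
    by rewrite (Hz _ bQ) (Hz' _ bQ'); exact: xx'.
(* Union bound over the sites of [B]. *)
apply: (@le_trans _ _ (Ex q W (fun om => \sum_(b <- B) ind (touches F om b)) (@off Z2))).
  apply: Ex_le => // om _; rewrite /ind; case: asboolP => [[b bB tb]|_]; last first.
    by apply: sumr_ge0 => *; rewrite ler0n.
  by rewrite (big_rem b)//= asboolT// lerDl; apply: sumr_ge0 => *; rewrite ler0n.
rewrite /Ex itsum_sum -!/(Ex _ _ _ _).
apply: (@le_trans _ _ (\sum_(b <- B) K * r ^+ m)); last first.
  by rewrite big_const_seq count_predT iter_addr_0 mulr_natl.
rewrite big_seq [leRHS]big_seq; apply: ler_sum => b bB.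
apply: le_trans (decay b m uW); apply: Ex_le => // om _; apply: ind_le.
move=> [u bu [w uw sw]]; exists u => //.
have [_ sb] := HB _ bB; exact: (dist_exit sb uw sw).
Qed.

Lemma window_comparison V bc P V' bc' P' s rho m U U' x x' B f :
  gibbs L V bc P -> gibbs L V' bc' P' ->
  same_near s rho V bc U V' bc' U' ->
  0 < P U x -> 0 < P' U' x' ->
  (forall u, u \in U -> (dist s u <= rho)%N -> x u = x' u) ->
  (forall b, b \in B -> V b /\ (dist s b + m <= rho)%N) ->
  (forall y, 0 <= f y <= 1) -> depends (fun u => u \in B) f ->
  `|avg P (window s rho V U) U f x - avg P' (window s rho V U) U' f x'| <=
    (size B)%:R * (K * r ^+ m).
Proof.
move=> PG PG' H T0 T0' xx' HB f01 fB.
rewrite ler_norml lerNl opprB; apply/andP; split.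
  rewrite -(window_same H).
  apply: (window_comparison1 PG' PG (same_near_sym H)) => //.
    by move=> u uU su; apply/esym/xx' => //; rewrite (same_past H).
  by move=> b bB; have [Vb sb] := HB _ bB; split => //; rewrite -(same_region H)//; lia.
exact: (window_comparison1 PG PG' H).
Qed.

Let delta m : R := K * r ^+ m.
(** The first term pays twice, once for each law, for replacing the local entropy by a function of
    the near past. The second compares the means of that function: it is bounded by the size of the
    alphabet and reads at most the sites of a box. *)
Definition entropy_error m : R :=
  4 * #|A|%:R * Num.sqrt (delta m) + #|A|%:R * ((2 * m).+1 ^ 2)%:R * delta m.

Lemma local_entropy_comparison V bc P V' bc' P' s m U U' x x' :
  gibbs L V bc P -> gibbs L V' bc' P' ->
  same_near s m V bc U V' bc' U' -> V s -> s \notin U ->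
  0 < P U x -> 0 < P' U' x' ->
  (forall u, u \in U -> (dist s u <= m)%N -> x u = x' u) ->
  `|local_entropy P s U x - local_entropy P' s U' x'| <=
    2 * #|A|%:R * Num.sqrt (delta m).
Proof.
move=> PG PG' H Vs sU T0 T0' xx'.
have PL := gibbs_law PG; have PL' := gibbs_law PG'.
have sU' : s \notin U' by rewrite -(same_past H) ?distxx.
rewrite /local_entropy -sumrB; apply: le_trans (ler_norm_sum _ _ _) _.
apply: (@le_trans _ _ (\sum_(a : A) 2 * Num.sqrt (delta m))); last first.
  by rewrite sumr_const -[X in X <= _]mulr_natl mulrCA mulrA.
apply: ler_sum => a _.
apply: le_trans (entfun_modulus (site_prob01 PL _ _ sU) (site_prob01 PL' _ _ sU')) _.
apply: ler_wpM2l => //; apply: ler_wsqrtr.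
have sW : s \in window s m V U by rewrite mem_window distxx Vs.
rewrite -(avg_site PL _ (window_uniq s m V U) _ sW T0); last first.
  by move=> u; rewrite mem_window => /and3P[].
rewrite -(avg_site PL' _ (window_uniq s m V U) _ sW T0'); last first.
  by move=> u; rewrite -(window_same H) mem_window => /and3P[].
rewrite -[leRHS]mul1r.
apply: (window_comparison (B := [:: s]) PG PG' H) => //.
- by move=> b; rewrite inE => /eqP ->; rewrite distxx.
- by move=> y; rewrite ind_ge0 ind_le1.
- by move=> y y' yy'; congr ind; rewrite yy' ?mem_head.
Qed.

(** Any list containing [C] gives the same marginal on [C], so the past [U] may be exchanged for a
    window with empty past. *)
Lemma marginal_uncond V bc P U C s rho f : gibbs L V bc P -> uniq U -> uniq C ->
  {subset C <= U} -> (forall u, u \in C -> V u /\ (dist s u <= rho)%N) ->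
  depends (fun u => u \in C) f ->
  sumc U (fun y => P U y * f y) (fun=> point) =
  avg P (window s rho V [::]) [::] f (fun=> point).
Proof.
move=> PG uU uC CU HC fC; have PL := gibbs_law PG.
suff Hs D : uniq D -> {subset C <= D} -> sumc D (fun y => f y * P D y) (fun=> point) =
    sumc C (fun y => f y * P C y) (fun=> point).
  rewrite /avg (law_nil PL) divr1 cats0 Hs ?window_uniq//; last first.
    by move=> u /HC[Vu su]; rewrite mem_window Vu su.
  by rewrite -(Hs U)//; apply: eq_itsum => y _; rewrite mulrC.
move=> uD CD; pose E := [seq u <- D | u \notin C].
have pD : perm_eq D (E ++ C).
  apply: uniq_perm => //.
    rewrite cat_uniq filter_uniq// uC andbT; apply/hasPn => u uC'.
    by rewrite mem_filter uC'.
  move=> u; rewrite mem_cat mem_filter; case: (boolP (u \in C)) => [/CD ->|] //=.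
  by rewrite orbF.
rewrite /sumc (itsum_perm _ _ _ pD) -/(sumc _ _ _).
rewrite (_ : P D = P (E ++ C)); last first.
  by apply/funext => y; apply: (law_mem PL) => u; rewrite (perm_mem pD).
apply: (marginal_sum PL); first by rewrite filter_uniq.
  by move=> u; rewrite mem_filter => /andP[].
move=> y y' yy'; apply: fC => u uC'; apply: yy'.
by rewrite mem_filter uC'.
Qed.

(** Two scales: up to a small error the local entropy reads only [C], the past within [m]; the laws
    on [C] are close because [C] is at distance [m] from the border of the window of radius
    [2 * m]. *)
Lemma cond_entropy_comparison V bc P V' bc' P' s m U U' :
  gibbs L V bc P -> gibbs L V' bc' P' ->
  same_near s (2 * m) V bc U V' bc' U' -> V s -> s \notin U ->
  uniq U -> uniq U' -> {subset U <= V} ->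
  `|cond_entropy P s U - cond_entropy P' s U'| <= entropy_error m.
Proof.
move=> PG PG' H Vs sU uU uU' UV.
have PL := gibbs_law PG; have PL' := gibbs_law PG'.
have sU' : s \notin U' by rewrite -(same_past H) ?distxx.
have Hm : same_near s m V bc U V' bc' U' by apply: same_near_le H; lia.
pose C := [seq u <- U | (dist s u <= m)%N].
have uC : uniq C by rewrite filter_uniq.
have CU : {subset C <= U} by move=> u; rewrite mem_filter => /andP[].
have CU' : {subset C <= U'}.
  by move=> u; rewrite mem_filter => /andP[su]; rewrite (same_past Hm).
have Cm u : u \in C -> (dist s u <= m)%N by rewrite mem_filter => /andP[].
pose omega := 2 * #|A|%:R * Num.sqrt (delta m).
(* [g] depends on the sites of C only and is close to both local entropies. *)
pose near (x : Z2 -> A) := [set z | (forall u, u \in C -> x u = z u) /\ 0 < P U z]%classic.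
pose near' (x : Z2 -> A) := [set z | (forall u, u \in C -> x u = z u) /\ 0 < P' U' z]%classic.
pose g x : R := if `[< near x !=set0 >]%classic
  then local_entropy P s U (xget (fun=> point) (near x))
  else if `[< near' x !=set0 >]%classic
  then local_entropy P' s U' (xget (fun=> point) (near' x)) else 0.
have gC : depends (fun u => u \in C) g.
  move=> y y' yy'; rewrite /g.
  have -> : near y = near y'.
    apply/seteqP; split => z /= [yz Pz]; split => // u uC'; rewrite -yz ?yy'//.
  have -> // : near' y = near' y'.
  by apply/seteqP; split => z /= [yz Pz]; split => // u uC'; rewrite -yz ?yy'.
have g0 x : 0 <= g x <= #|A|%:R.
  rewrite /g; case: ifP => _; first by rewrite local_entropy_ge0 ?local_entropy_le.
  by case: ifP => _; rewrite ?local_entropy_ge0 ?local_entropy_le// lexx ler0n.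
have inC u : u \in U -> (dist s u <= m)%N -> u \in C by rewrite mem_filter => -> ->.
have inC' u : u \in U' -> (dist s u <= m)%N -> u \in C.
  by move=> uU2 su; apply: inC => //; rewrite (same_past Hm).
have gP x : 0 < P U x -> `|local_entropy P s U x - g x| <= omega.
  move=> Px; have nx : near x x by [].
  rewrite /g asboolT; last by exists x.
  have [xz Pz] := xgetPex (fun=> point) (ex_intro _ x nx).
  apply: (local_entropy_comparison PG PG (same_near_refl _ _ _ _ _)) => //.
  by move=> u uU2 su; apply: xz; exact: inC.
have gP' x : 0 < P' U' x -> `|local_entropy P' s U' x - g x| <= omega.
  move=> Px; have nx : near' x x by [].
  rewrite /g; case: asboolP => [[y ny]|_].
    have [xz Pz] := xgetPex (fun=> point) (ex_intro _ y ny).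
    rewrite distrC; apply: (local_entropy_comparison PG PG') => //.
    by move=> u uU2 su; apply/esym/xz; exact: inC.
  rewrite asboolT; last by exists x.
  have [xz Pz] := xgetPex (fun=> point) (ex_intro _ x nx).
  apply: (local_entropy_comparison PG' PG' (same_near_refl _ _ _ _ _)) => //.
    by rewrite -(same_region Hm) ?distxx.
  by move=> u uU2 su; apply: xz; exact: inC'.
(* On either side, averaging turns the pointwise bound by [omega] into a bound for the conditional
   entropy. *)
have close Q W : is_law Q -> uniq W ->
    (forall x, 0 < Q W x -> `|local_entropy Q s W x - g x| <= omega) ->
    `|cond_entropy Q s W - sumc W (fun x => Q W x * g x) (fun=> point)| <= omega.
  move=> QL uW Hg; rewrite /cond_entropy /sumc -itsumB -!/(sumc _ _ _).
  have bnd x : `|Q W x * local_entropy Q s W x - Q W x * g x| <= omega * Q W x.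
    rewrite -mulrBr normrM (ger0_norm (law_ge0 QL _ _)) mulrC.
    have := law_ge0 QL W x; rewrite le_eqVlt => /orP[/eqP <-|Qx]; first by rewrite !mulr0.
    by rewrite ler_pM2r//; exact: Hg.
  have tot : omega = sumc W (fun x => omega * Q W x) (fun=> point).
    by rewrite /sumc itsumZ -/(sumc _ _ _) (sumc_law QL)// mulr1.
  rewrite ler_norml {2}tot [in leLHS]tot /sumc -itsumN; apply/andP; split; apply: le_sumc => y _.
    by have := bnd y; rewrite ler_norml => /andP[].
  by have := bnd y; rewrite ler_norml => /andP[].
have HC u : u \in C -> V u /\ (dist s u <= 2 * m)%N.
  by move=> uC'; split; [exact/UV/CU|exact: leq_trans (Cm _ uC') (leq_pmull _ _)].
have HC' u : u \in C -> V' u /\ (dist s u <= 2 * m)%N.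
  by move=> uC'; have [Vu su] := HC _ uC'; split => //; rewrite -(same_region H).
have mid : `|sumc U (fun x => P U x * g x) (fun=> point) -
             sumc U' (fun x => P' U' x * g x) (fun=> point)| <=
    #|A|%:R * ((2 * m).+1 ^ 2)%:R * delta m.
  rewrite (marginal_uncond PG uU uC CU HC gC) (marginal_uncond PG' uU' uC CU' HC' gC).
  rewrite (window_same (same_near_nil H)).
  have [A0|A0] := eqVneq (#|A|%:R : R) 0.
    have gz x : g x = 0.
      by apply/eqP; rewrite eq_le; have := g0 x; rewrite A0 andbC.
    rewrite A0 !mul0r (_ : g = fun=> 0); last by apply/funext.
    rewrite (_ : avg P _ _ _ _ = 0); last first.
      by rewrite /avg /sumc itsumZ mul0r mul0r.
    by rewrite sub0r normrN /avg /sumc itsumZ !mul0r normr0.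
  have A1 : 0 < #|A|%:R :> R by rewrite lt_def A0 ler0n.
  (* [window_comparison] asks for values in [0, 1]. *)
  pose f x := g x / #|A|%:R.
  have fg Q W : avg Q W [::] g (fun=> point) = #|A|%:R * avg Q W [::] f (fun=> point).
    rewrite /avg mulrA /sumc -itsumZ; congr (_ / _); apply: eq_itsum => y _.
    by rewrite /f; field.
  rewrite !fg -mulrBr normrM ger0_norm ?ler0n// -mulrA ler_pM2l//.
  apply: (@le_trans _ _ ((size C)%:R * delta m)).
    apply: (window_comparison PG PG' (same_near_nil H)) => //.
    - by rewrite (law_nil PL) ltr01.
    - by rewrite (law_nil PL') ltr01.
    - by move=> b bC; have [Vb _] := HC _ bC; rewrite mul2n -addnn leq_add2r Cm.
    - move=> y; have /andP[y0 y1] := g0 y; rewrite /f divr_ge0 ?ler0n//=.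
      by rewrite ler_pdivrMr// mul1r.
    - by move=> y y' yy'; rewrite /f (gC y y').
  apply: ler_wpM2r; first by rewrite mulr_ge0 ?(ltW K0)// exprn_ge0.
  rewrite ler_nat -(size_box s m); apply: uniq_leq_size => // u uC'.
  by rewrite mem_box; exact: Cm.
have c1 := close P U PL uU gP; have c2 := close P' U' PL' uU' gP'.
rewrite /entropy_error; set S1 := sumc U _ _ in c1 mid; set S2 := sumc U' _ _ in c2 mid.
move: c1 c2 mid; rewrite !ler_norml /omega => /andP[? ?] /andP[? ?] /andP[? ?].
by apply/andP; split; lra.
Qed.

End Comparison.

(** * Entropy rates *)

Section ShiftedLaws.
Variables (R : realType) (A : alphabetType) (L : specification R Z2 A).
Implicit Types (P : seq Z2 -> (Z2 -> A) -> R) (S T U : seq Z2) (x y : Z2 -> A).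
Hypothesis TI : translation_invariant L.

Definition negate (v : Z2) : Z2 := (- (v : int * int))%R.

Definition shift_law v P U x := P (map (translate v) U) (x \o translate (negate v)).

Lemma spec_at_fset (S S' : {fset Z2}) x : S = S' ->
  L S (restr _ x) (restr _ x) = L S' (restr _ x) (restr _ x).
Proof. by move=> ->. Qed.

Lemma spec_at_translate v S x :
  spec_at L (map (translate v) S) (x \o translate (negate v)) = spec_at L S x.
Proof.
rewrite /spec_at -(TI (negate v) [fset u in S]%fset x x).
apply: spec_at_fset; apply/fsetP => u; rewrite !inE.
apply/mapP/imfsetP => /= -[w wS ->]; exists w; rewrite ?inE in wS *=> //.
  by rewrite /translate opprK.
by rewrite /translate opprK.
Qed.

Lemma upd_translate v x u a :
  upd x u a \o translate (negate v) = upd (x \o translate (negate v)) (translate v u) a.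
Proof.
apply/funext => w /=; rewrite /upd.
by rewrite (can2_eq (translateVK v) (translateK v)).
Qed.

(** The invariance of [L] makes the shift of any Gibbs law Gibbs again, with region and frozen
    values shifted along; two sites at different places can then be compared as one. *)
Lemma gibbs_shift v V bc P : gibbs L V bc P ->
  gibbs L (V \o translate v) (bc \o translate v) (shift_law v P).
Proof.
move=> [PL PM PF]; have inj := can_inj (translateK v); split.
- split.
  + by move=> x; exact: (law_nil PL).
  + by move=> U x; exact: (law_ge0 PL).
  + by move=> U x y xy; apply: (law_ext PL) => _ /mapP[u uU ->] /=; rewrite translateK; exact: xy.
  + by move=> U U' x UU'; apply: (law_mem PL) => u; exact: eq_mem_map.
  + move=> u U x uU; rewrite /shift_law -(law_marg PL (v := translate v u)) ?mem_map//.
    by apply: eq_bigr => a _; rewrite upd_translate.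
- move=> S T x SV ST bT; rewrite /shift_law map_cat PM ?spec_at_translate//.
  + by move=> _ /mapP[u uS ->]; exact: SV.
  + by move=> _ /mapP[u uS ->]; rewrite mem_map//; exact: ST.
  + move=> u; rewrite (perm_mem (perm_bd_translate S v)) => /mapP[w wb ->].
    by rewrite mem_map//; exact: bT.
- move=> U x u uU Vu xu; apply: (PF _ _ (translate v u)) => //; first exact: map_f.
  by rewrite /= translateK.
Qed.

Lemma cond_entropy_shift v P s U :
  cond_entropy (shift_law v P) s U = cond_entropy P (translate v s) (map (translate v) U).
Proof.
rewrite /cond_entropy /sumc (itsum_map _ _ _ _ (translateK v) (translateVK v)).
apply: eq_itsum => x _; rewrite /shift_law; congr (_ * _).
by apply: eq_bigr => a _; rewrite /shift_law upd_translate.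
Qed.

End ShiftedLaws.

(** * The column-by-column order and the entropy of rectangles *)

Section Past.
Implicit Types (c i : int) (n w k : nat) (u : Z2).

(* Columns are filled from the left to the right, each one from the bottom to the
   top; [past i n w k] lists the sites that precede (i + w, k + 1) when the first
   column is i and the rows are 1, ..., n. *)
Fixpoint column_part c k : seq Z2 :=
  if k is k'.+1 then ((c, k%:Z) : Z2) :: column_part c k' else [::].

Fixpoint rectangle i n w : seq Z2 :=
  if w is w'.+1 then column_part (i + w'%:Z) n ++ rectangle i n w' else [::].

Definition past i n w k : seq Z2 := column_part (i + w%:Z) k ++ rectangle i n w.

Lemma mem_column_part c k u :
  (u \in column_part c k) = (u.1 == c) && (1 <= u.2 <= k%:Z).
Proof.
case: u => a b; elim: k => [|k IH] /=; first by rewrite in_nil; lia.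
by rewrite inE IH xpair_eqE /=; lia.
Qed.

Lemma mem_rectangle i n w u :
  (u \in rectangle i n w) = (i <= u.1 < i + w%:Z) && (1 <= u.2 <= n%:Z).
Proof.
case: u => a b; elim: w => [|w IH] /=; first by rewrite in_nil; lia.
by rewrite mem_cat IH mem_column_part /=; lia.
Qed.

Lemma mem_past i n w k u : (u \in past i n w k) =
  (u.1 == i + w%:Z) && (1 <= u.2 <= k%:Z) ||
  (i <= u.1 < i + w%:Z) && (1 <= u.2 <= n%:Z).
Proof. by rewrite mem_cat mem_column_part mem_rectangle. Qed.

Lemma column_part_uniq c k : uniq (column_part c k).
Proof. by elim: k => //= k ->; rewrite mem_column_part /= andbT; lia. Qed.

Lemma past_uniq i n w k : uniq (past i n w k).
Proof.
have disj k' w' : ~~ has (mem (column_part (i + w'%:Z) k')) (rectangle i n w').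
  by apply/hasPn => -[a b]; rewrite mem_rectangle /= mem_column_part /=; lia.
rewrite cat_uniq column_part_uniq disj /=.
by elim: w => //= w IH; rewrite cat_uniq column_part_uniq disj.
Qed.

Lemma rectangle_uniq i n w : uniq (rectangle i n w).
Proof. by have := past_uniq i n w 0. Qed.

Lemma site_notin_past i n w k : ((i + w%:Z, k.+1%:Z) : Z2) \notin past i n w k.
Proof. by rewrite mem_past /=; lia. Qed.

End Past.

Section EntropyOfRectangles.
Variables (R : realType) (A : alphabetType) (P : seq Z2 -> (Z2 -> A) -> R).
Hypothesis PL : is_law P.

Definition site_entropy (i : int) (n w k : nat) : R :=
  cond_entropy P ((i + w%:Z, k.+1%:Z) : Z2) (past i n w k).

Lemma site_entropy_bound (i : int) n w k : 0 <= site_entropy i n w k <= #|A|%:R.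
Proof. by apply: (cond_entropy_bound PL); [exact: past_uniq|exact: site_notin_past]. Qed.

Lemma set_entropy_rectangleS (i : int) n w :
  set_entropy P (rectangle i n w.+1) =
  set_entropy P (rectangle i n w) + \sum_(k < n) site_entropy i n w k.
Proof.
(* [past i n w n] unfolds to [rectangle i n w.+1], so [k = n] is the claim. *)
suff H k : set_entropy P (past i n w k) =
    set_entropy P (rectangle i n w) + \sum_(k' < k) site_entropy i n w k' by exact: H.
elim: k => [|k IH]; first by rewrite big_ord0 addr0.
rewrite big_ord_recr /= addrA -IH -(entropy_chain PL)//; first exact: past_uniq.
exact: site_notin_past.
Qed.

Lemma set_entropy_nil : set_entropy P [::] = 0.
Proof. by rewrite /set_entropy /sumc /= (law_nil PL) /entfun ln1 mulr0 oppr0. Qed.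

Lemma set_entropy_rectangle (i : int) n w :
  set_entropy P (rectangle i n w) = \sum_(j < w) \sum_(k < n) site_entropy i n j k.
Proof.
elim: w => [|w IH]; first by rewrite big_ord0 set_entropy_nil.
by rewrite set_entropy_rectangleS IH big_ord_recr.
Qed.

End EntropyOfRectangles.

(** * Site entropies of strips and of the plane compared *)

Section SiteEntropies.
Variables (R : realType) (A : alphabetType) (L : specification R Z2 A).
Variable err : nat -> R.
Hypothesis TI : translation_invariant L.
Hypothesis Hcmp : forall V bc P V' bc' P' s m U U',
  gibbs L V bc P -> gibbs L V' bc' P' ->
  same_near s (2 * m) V bc U V' bc' U' -> V s -> s \notin U ->
  uniq U -> uniq U' -> {subset U <= V} ->
  `|cond_entropy P s U - cond_entropy P' s U'| <= err m.
Implicit Types (V : pred Z2) (bc : Z2 -> A) (P : seq Z2 -> (Z2 -> A) -> R).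

(** [v] carries the first site to the second, and [Hcmp] is applied to the second law shifted
    back. *)
Lemma site_entropy_comparison V bc P V' bc' P' (i i' : int) (n w k n' w' k' m : nat)
    (v : Z2) :
  gibbs L V bc P -> gibbs L V' bc' P' ->
  v = ((i' + w'%:Z) - (i + w%:Z), k'%:Z - k%:Z) ->
  (forall u, (dist (i + w%:Z, k.+1%:Z)%R u <= 2 * m)%N ->
    [/\ V u = V' (translate v u), ~~ V u -> bc u = bc' (translate v u) &
    (u \in past i n w k) = (translate v u \in past i' n' w' k')]) ->
  V (i + w%:Z, k.+1%:Z) -> {subset past i n w k <= V} ->
  `|site_entropy P i n w k - site_entropy P' i' n' w' k'| <= err m.
Proof.
move=> PG PG' vE H Vs pV.
have sE : translate v (i + w%:Z, k.+1%:Z) = (i' + w'%:Z, k'.+1%:Z).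
  by clear - vE; rewrite vE /translate; congr pair => /=; lia.
have -> : site_entropy P' i' n' w' k' = cond_entropy (shift_law v P')
    ((i + w%:Z, k.+1%:Z) : Z2) (map (translate (negate v)) (past i' n' w' k')).
  rewrite cond_entropy_shift sE -map_comp map_id_in// => u _.
  exact: translateVK.
apply: (Hcmp PG (gibbs_shift TI v PG')).
- split => u /H[H1 H2 H3] //; rewrite H3 -[in RHS](translateK v u) mem_map//.
  exact: can_inj (translateVK v).
- exact: Vs.
- exact: site_notin_past.
- exact: past_uniq.
- by rewrite map_inj_uniq ?past_uniq//; exact: can_inj (translateVK v).
- exact: pV.
Qed.

Lemma distP (a b : int) (u : Z2) m : (dist (a, b) u <= m)%N ->
  (`|a - u.1| <= m%:Z) && (`|b - u.2| <= m%:Z).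
Proof. by rewrite /dist geq_max /=; lia. Qed.

Definition region (n : nat) : pred Z2 := fun u => 1 <= u.2 <= n%:Z.

Lemma past_region i n w k : (k <= n)%N -> {subset past i n w k <= region n}.
Proof. by move=> kn u; rewrite mem_past unfold_in; lia. Qed.

Section TwoStrips.
Variables (t b : int -> A) (p : nat).
Hypothesis tp : forall i : int, t (i + p%:Z) = t i.
Hypothesis bp : forall i : int, b (i + p%:Z) = b i.

Definition strip_frozen (u : Z2) : A := if u.2 <= 0 then b u.1 else t u.1.

Lemma periodicM (f : int -> A) (l : nat) i :
  (forall i : int, f (i + p%:Z) = f i) -> f (i + (p * l)%N%:Z) = f i.
Proof.
move=> fp; elim: l => [|l IH]; first by rewrite muln0 addr0.
by rewrite mulnS addnC PoszD addrA fp.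
Qed.

(** A shift by a multiple of the period preserves [t] and [b]; [2 * m <= w] hides the first column,
    the only thing that moves. *)
Lemma site_entropy_periodic n P i w k l m :
  gibbs L (region n) strip_frozen P -> (k < n)%N -> (2 * m <= w)%N ->
  `|site_entropy P i n w k - site_entropy P i n (w + p * l) k| <= err m.
Proof.
move=> PG kn mw.
apply: (site_entropy_comparison (v := ((p * l)%N%:Z, 0)) PG PG).
- congr pair; lia.
- move=> u /distP/andP[H1 H2]; split.
  + by rewrite /region /= addr0.
  + by move=> _; rewrite /strip_frozen /= addr0 !periodicM.
  + by rewrite !mem_past /=; move: H1 H2; case: u => u1 u2 /=; lia.
- by rewrite /region /=; lia.
- by apply: past_region; exact: ltnW.
Qed.

Section Pair.
Variables (n : nat) (P P' : seq Z2 -> (Z2 -> A) -> R).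
Hypothesis PG : gibbs L (region n) strip_frozen P.
Hypothesis PG' : gibbs L (region n.+1) strip_frozen P'.

(** The top side is out of sight, so the extra row above is not noticed. *)
Lemma site_entropy_bottom i w k m : (2 * m <= w)%N -> (k.+1 + 2 * m <= n)%N ->
  `|site_entropy P i n w k - site_entropy P' i n.+1 w k| <= err m.
Proof.
move=> mw kn.
apply: (site_entropy_comparison (v := (0, 0)) PG PG').
- congr pair; lia.
- move=> u /distP/andP[H1 H2]; rewrite /translate addr0; split => //.
  + by rewrite /region; move: H1 H2; case: u => u1 u2 /=; lia.
  + by rewrite !mem_past; move: H1 H2; case: u => u1 u2 /=; lia.
- by rewrite /region /=; lia.
- by apply: past_region; lia.
Qed.

(** The bottom side is out of sight, and the shift by one row matches the two top sides. *)
Lemma site_entropy_top i w k m : (2 * m <= w)%N -> (2 * m <= k)%N -> (k < n)%N ->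
  `|site_entropy P i n w k - site_entropy P' i n.+1 w k.+1| <= err m.
Proof.
move=> mw mk kn.
apply: (site_entropy_comparison (v := (0, 1)) PG PG').
- congr pair; lia.
- move=> u /distP/andP[H1 H2]; split => //.
  + by rewrite /region; move: H1 H2; case: u => u1 u2 /=; lia.
  + by rewrite /strip_frozen; move: H1 H2; case: u => u1 u2 /= *; rewrite !ifF ?addr0//; lia.
  + by rewrite !mem_past; move: H1 H2; case: u => u1 u2 /=; lia.
- by rewrite /region /=; lia.
- by apply: past_region; lia.
Qed.

End Pair.
End TwoStrips.

(** Within sight nothing is frozen, and the past is the same set up to translation. *)
Lemma site_entropy_deep V bc P V' bc' P' i i' n w k n' w' k' m :
  gibbs L V bc P -> gibbs L V' bc' P' ->
  {subset region n <= V} -> {subset region n' <= V'} ->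
  (2 * m <= w)%N -> (2 * m <= k)%N -> (k.+1 + 2 * m <= n)%N ->
  (2 * m <= w')%N -> (2 * m <= k')%N -> (k'.+1 + 2 * m <= n')%N ->
  `|site_entropy P i n w k - site_entropy P' i' n' w' k'| <= err m.
Proof.
move=> PG PG' nV nV' mw mk kn mw' mk' kn'.
apply: (site_entropy_comparison
  (v := ((i' + w'%:Z) - (i + w%:Z), k'%:Z - k%:Z)) PG PG') => //.
- move=> u /distP/andP[H1 H2].
  have Vu : V u.
    by apply: nV; rewrite unfold_in; move: H1 H2; case: u => u1 u2 /=; lia.
  split => //; rewrite ?Vu//.
    by apply/esym/nV'; rewrite unfold_in; move: H1 H2; case: (u) => u1 u2 /=; lia.
  by rewrite !mem_past; clear - H1 H2 mw mk kn mw' mk' kn'; move: H1 H2; case: u => u1 u2 /=; lia.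
- by apply: nV; rewrite unfold_in /=; lia.
- by move=> u /past_region-/(_ (leq_trans (leq_trans (leqnSn k) (leq_addr _ _)) kn)); exact: nV.
Qed.

End SiteEntropies.

(** * Elementary facts on real sequences *)

Section RealSequences.
Variable R : realType.
Implicit Types (u : nat -> R).

Lemma cauchy_seq u :
  (forall e, 0 < e -> exists N, forall n, (N <= n)%N -> `|u N - u n| <= e) ->
  cvgn u.
Proof.
move=> H; apply/cauchy_cvgP/cauchy_exP => e e0.
have [N HN] := H (e / 2) ltac:(lra).
exists (u N); exists N => // n /= Nn; rewrite /ball /=.
by apply: le_lt_trans (HN n Nn) _; lra.
Qed.

Lemma limit_dist u (l c e : R) N : (u @ \oo --> l)%classic ->
  (forall n, (N <= n)%N -> `|u n - c| <= e) -> `|l - c| <= e.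
Proof.
move=> ul H; rewrite ler_distl; apply/andP; split.
  apply: (cvgr_to_ge ul); exists N => // n /= /H; rewrite ler_distl => /andP[] //.
apply: (cvgr_to_le ul); exists N => // n /= /H; rewrite ler_distl => /andP[] //.
Qed.

Lemma mean_limit u (l : R) : (u @ \oo --> l)%classic ->
  ((fun j : nat => (j%:R)^-1 * \sum_(k < j) u k : R) @ \oo --> l)%classic.
Proof.
move=> /cesaro H; rewrite -cvg_shiftS.
rewrite (_ : (fun j => _) = arithmetic_mean u); first exact: H.
by apply/funext => j; rewrite /arithmetic_mean /= /series /= big_mkord.
Qed.

Lemma sum_blocks (f : nat -> R) p j :
  \sum_(w < p * j) f w = \sum_(l < j) \sum_(r < p) f (p * l + r)%N.
Proof.
elim: j => [|j IH]; first by rewrite muln0 !big_ord0.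
by rewrite big_ord_recr -IH mulnSr big_split_ord.
Qed.

(** Bernoulli's inequality for 1 / b = 1 + x; the constant comes from (1 + 2 / x) (1 + m x) >= 2 m +
    1. *)
Lemma linear_geometric_bound (b : R) : 0 < b < 1 ->
  exists2 C : R, 0 < C & forall m, (2 * m).+1%:R * b ^+ m <= C.
Proof.
move=> /andP[b0 b1]; pose x := b^-1 - 1.
have x0 : 0 < x by rewrite subr_gt0 invf_gt1.
exists (1 + 2 / x) => [|m]; first by rewrite addr_gt0// divr_gt0.
have H : 1 + m%:R * x <= b^-1 ^+ m.
  elim: m => [|m IH]; first by rewrite mul0r addr0 expr0.
  rewrite exprS (_ : b^-1 = 1 + x); last by rewrite /x; ring.
  rewrite (_ : b^-1 = 1 + x) in IH; last by rewrite /x; ring.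
  have xm : 0 <= m%:R * x * x by rewrite !mulr_ge0// ltW.
  apply: (@le_trans _ _ ((1 + x) * (1 + m%:R * x))).
    by rewrite -natr1; lra.
  by apply: ler_wpM2l => //; lra.
have bm : 0 < b ^+ m by exact: exprn_gt0.
rewrite -ler_pdivlMr// -exprVn.
apply: (@le_trans _ _ ((1 + 2 / x) * (1 + m%:R * x))); last first.
  by apply: ler_wpM2l => //; rewrite addr_ge0// divr_ge0// ltW.
have -> : (1 + 2 / x) * (1 + m%:R * x) = 1 + m%:R * x + 2 / x + 2 * m%:R.
  by field; rewrite gt_eqF.
rewrite -natr1 natrM.
have : 0 <= m%:R * x by rewrite mulr_ge0// ltW.
have : 0 < 2 / x by rewrite divr_gt0.
lra.
Qed.

Lemma sum_lt_le c j : \sum_(w < j) (w < c)%:R <= c%:R :> R.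
Proof.
rewrite -natr_sum ler_nat.
suff -> : (\sum_(w < j) (w < c) = minn j c)%N by rewrite geq_minr.
elim: j => [|j IH]; first by rewrite big_ord0 min0n.
by rewrite big_ord_recr /= IH; case: (ltnP j c) => /=; lia.
Qed.

Lemma sum_gt_le c j : \sum_(k < j) (j < k.+1 + c)%:R <= c%:R :> R.
Proof.
rewrite -natr_sum ler_nat.
suff H j' : (\sum_(k < j') (j < k.+1 + c) = j' - (j - c))%N by rewrite H; lia.
elim: j' => [|j' IH]; first by rewrite big_ord0.
by rewrite big_ord_recr /= IH; case: (ltnP j (j'.+1 + c)) => /=; lia.
Qed.

End RealSequences.

(** * Entropy rates of the plane and of the strips *)

Section EntropyRates.
Variables (R : realType) (A : alphabetType) (L : specification R Z2 A).
Variable err : nat -> R.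
Hypothesis TI : translation_invariant L.
Hypothesis Hcmp : forall V bc P V' bc' P' s m U U',
  gibbs L V bc P -> gibbs L V' bc' P' ->
  same_near s (2 * m) V bc U V' bc' U' -> V s -> s \notin U ->
  uniq U -> uniq U' -> {subset U <= V} ->
  `|cond_entropy P s U - cond_entropy P' s U'| <= err m.
Hypothesis err_small : forall e, 0 < e -> exists m, err m <= e.

Section PlaneRate.
Variables (bc : Z2 -> A) (P : seq Z2 -> (Z2 -> A) -> R).
Hypothesis PG : gibbs L xpredT bc P.

(* Sites that are deep inside of their regions have nearly equal conditional
   entropies, whatever the laws: this takes the place of uniqueness and
   stationarity. *)
Lemma site_entropy_limit : exists h : R, 0 <= h <= #|A|%:R /\
  forall V bc' P' i n w k m, gibbs L V bc' P' -> {subset region n <= V} ->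
    (2 * m <= w)%N -> (2 * m <= k)%N -> (k.+1 + 2 * m <= n)%N ->
    `|site_entropy P' i n w k - h| <= err m.
Proof.
(* The middle row of the lowest strip that leaves [2 * m] rows on both sides of it. *)
pose a m := site_entropy P 1 (4 * m).+1 (2 * m) (2 * m).
have Ha V bc' P' i n w k m m' : gibbs L V bc' P' -> {subset region n <= V} ->
    (2 * m <= w)%N -> (2 * m <= k)%N -> (k.+1 + 2 * m <= n)%N -> (m <= m')%N ->
    `|a m' - site_entropy P' i n w k| <= err m.
  move=> PG' nV mw mk kn mm'.
  by apply: (site_entropy_deep TI Hcmp _ _ PG PG') => //; lia.
have ca : cvgn a.
  apply: cauchy_seq => e e0; have [m me] := err_small e0.
  exists m => n mn; apply: le_trans me; rewrite distrC.
  by apply: (Ha _ _ _ _ _ _ _ _ _ PG) => //; lia.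
exists (limn a); split.
  have b m : 0 <= a m <= #|A|%:R.
    by apply: site_entropy_bound; exact: gibbs_law PG.
  apply/andP; split.
    by apply: (cvgr_to_ge ca); exists 0%N => // n _; have /andP[] := b n.
  by apply: (cvgr_to_le ca); exists 0%N => // n _; have /andP[] := b n.
move=> V bc' P' i n w k m PG' nV mw mk kn; rewrite distrC.
apply: (limit_dist (N := m) ca) => m' mm'.
exact: (Ha _ _ _ _ _ _ _ _ _ PG' nV mw mk kn mm').
Qed.

(** In a large rectangle all sites but three layers of width [2 * m], at the left, the bottom and
    the top, contribute nearly [h]. *)
Lemma plane_entropy_rate h : 0 <= h <= #|A|%:R ->
  (forall i n w k m, (2 * m <= w)%N -> (2 * m <= k)%N -> (k.+1 + 2 * m <= n)%N ->
    `|site_entropy P i n w k - h| <= err m) ->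
  ((fun j : nat * nat => ((j.1 * j.2)%:R)^-1 *
      set_entropy P (rectangle 1 j.2 j.1)) @ filter_prod \oo \oo --> h)%classic.
Proof.
move=> h01 Hh; have PL := gibbs_law PG.
set M : R := #|A|%:R in h01.
have M0 : 0 <= M by rewrite ler0n.
apply/cvgrPdist_le => e e0.
have [m me] : exists m, err m <= e / 2 by apply: err_small; lra.
(* The layers cost at most M (2 m j2 + 4 m j1); with 12 M m <= e j1 and 12 M m <= e j2 this is at
   most (e / 6 + e / 3) j1 j2. *)
pose x : R := 12 * M * m%:R / e.
have x0 : 0 <= x by rewrite divr_ge0 ?(ltW e0)// !mulr_ge0.
pose N := (Num.trunc x).+1.
have xN : x < N%:R by rewrite truncnS_gt.
exists ([set j | (N <= j)%N], [set j | (N <= j)%N])%classic.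
  by split; exists N.
move=> [j1 j2] /= [Nj1 Nj2].
rewrite (set_entropy_rectangle PL).
have j1p : 0 < j1%:R :> R by rewrite ltr0n (leq_trans _ Nj1).
have j2p : 0 < j2%:R :> R by rewrite ltr0n (leq_trans _ Nj2).
have jp : 0 < (j1 * j2)%:R :> R by rewrite natrM mulr_gt0.
have -> : h - ((j1 * j2)%:R)^-1 * (\sum_(j < j1) \sum_(k < j2) site_entropy P 1 j2 j k) =
    ((j1 * j2)%:R)^-1 * \sum_(j < j1) \sum_(k < j2) (h - site_entropy P 1 j2 j k).
  have hE : \sum_(j < j1) \sum_(k < j2) h = (j1 * j2)%:R * h.
    by rewrite !sumr_const !card_ord -mulrnA mulnC mulr_natl.
  under [in RHS]eq_bigr do rewrite sumrB.
  by rewrite sumrB hE mulrBr mulKf ?gt_eqF.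
rewrite normrM gtr0_norm ?invr_gt0// ler_pdivrMl//.
apply: le_trans (ler_norm_sum _ _ _) _.
pose bad (j k : nat) : R := (j < 2 * m)%:R + (k < 2 * m)%:R + (j2 < k.+1 + 2 * m)%:R.
have em : 0 <= err m.
  apply: le_trans (Hh 1 (4 * m).+1 (2 * m)%N (2 * m)%N m _ _ _) => //.
  by rewrite addSn ltnS -mulnDl.
have point_bound j k : `|h - site_entropy P 1 j2 j k| <= err m + M * bad j k.
  rewrite distrC; case: (boolP [&& 2 * m <= j, 2 * m <= k & k.+1 + 2 * m <= j2]%N).
    move=> /and3P[H1 H2 H3]; apply: le_trans (Hh _ _ _ _ _ H1 H2 H3) _.
    by rewrite lerDl mulr_ge0// !addr_ge0.
  move=> H; have b1 : 1 <= bad j k.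
    move: H; rewrite !negb_and -!ltnNge /bad.
    case: (j < 2 * m)%N; case: (k < 2 * m)%N; case: (j2 < k.+1 + 2 * m)%N => //= _; lra.
  have /andP[s0 s1] := site_entropy_bound PL 1 j2 j k.
  have /andP[h0 h1] := h01.
  apply: (@le_trans _ _ M); first
    by rewrite ler_norml; apply/andP; split; rewrite /M in h1 *; lra.
  have : M <= M * bad j k by rewrite ler_peMr.
  lra.
apply: (@le_trans _ _ (\sum_(j < j1) \sum_(k < j2) (err m + M * bad j k))).
  apply: ler_sum => j _; apply: le_trans (ler_norm_sum _ _ _) _.
  by apply: ler_sum => k _; exact: point_bound.
have -> : \sum_(j < j1) \sum_(k < j2) (err m + M * bad j k) =
    (j1 * j2)%:R * err m + M * (j2%:R * (\sum_(j < j1) (j < 2 * m)%:R) +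
      j1%:R * (\sum_(k < j2) (k < 2 * m)%:R) +
      j1%:R * (\sum_(k < j2) (j2 < k.+1 + 2 * m)%:R)).
  transitivity (\sum_(j < j1) (j2%:R * err m + M * (j2%:R * (j < 2 * m)%:R +
      (\sum_(k < j2) (k < 2 * m)%:R + \sum_(k < j2) (j2 < k.+1 + 2 * m)%:R)))).
    apply: eq_bigr => j _; rewrite big_split /= sumr_const card_ord -mulr_sumr.
    rewrite mulr_natl; congr (_ + _ * _); rewrite /bad !big_split /= sumr_const card_ord.
    by rewrite mulr_natl addrA.
  rewrite big_split /= sumr_const card_ord -mulr_sumr big_split /= -mulr_sumr.
  rewrite sumr_const card_ord -[(_ * err m) *+ _]mulr_natl -[(_ + _) *+ _]mulr_natl.
  rewrite natrM; ring.
have S1 := @sum_lt_le R (2 * m) j1.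
have S2 := @sum_lt_le R (2 * m) j2.
have S3 := @sum_gt_le R (2 * m) j2.
have Nj1' : N%:R <= j1%:R :> R by rewrite ler_nat.
have Nj2' : N%:R <= j2%:R :> R by rewrite ler_nat.
have xe : 12 * M * m%:R = x * e by rewrite /x divfK// gt_eqF.
have [X1 X2] : 12 * M * m%:R <= j1%:R * e /\ 12 * M * m%:R <= j2%:R * e.
  by rewrite xe; split; apply: ler_wpM2r; rewrite ?(ltW e0)//; lra.
apply: (@le_trans _ _ ((j1 * j2)%:R * (e / 2) + M * (j2%:R * (2 * m)%:R +
    j1%:R * (2 * m)%:R + j1%:R * (2 * m)%:R))).
  apply: lerD; first by rewrite ler_pM2l.
  by apply: ler_wpM2l => //; rewrite !lerD// ler_pM2l.
rewrite !natrM.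
have Y1 : 12 * M * m%:R * j2%:R <= j1%:R * e * j2%:R by rewrite ler_pM2r.
have Y2 : 12 * M * m%:R * j1%:R <= j2%:R * e * j1%:R by rewrite ler_pM2r.
lra.
Qed.

End PlaneRate.

Section StripRate.
Variables (t b : int -> A) (p : nat).
Hypothesis p0 : (0 < p)%N.
Hypothesis tp : forall i : int, t (i + p%:Z) = t i.
Hypothesis bp : forall i : int, b (i + p%:Z) = b i.

(** Entropy of the p columns of a block given the preceding ones. The first column is [p] because
    block 1 of the power code starts there. *)
Definition block_increment (P : seq Z2 -> (Z2 -> A) -> R) n l : R :=
  \sum_(r < p) \sum_(k < n) site_entropy P p%:Z n (p * l + r) k.

(** Periodicity makes the block increments a Cauchy sequence; the entropy is the limit of their
    Cesaro means. *)
Lemma strip_entropy_rate n P : gibbs L (region n) (strip_frozen t b) P ->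
  cvgn (block_increment P n) /\
  ((fun j : nat => (j%:R)^-1 * set_entropy P (rectangle p%:Z n (p * j))) @ \oo -->
    limn (block_increment P n))%classic.
Proof.
move=> PG; have cd : cvgn (block_increment P n).
  apply: cauchy_seq => e e0.
  (* One share for each of the [p * n] sites of a block; [n.+1] keeps the denominator positive. *)
  have e0' : 0 < e / (p * n.+1)%:R by rewrite divr_gt0// ltr0n muln_gt0 p0.
  have [m me] := err_small e0'; exists (2 * m)%N => l ml.
  rewrite /block_increment -sumrB; apply: le_trans (ler_norm_sum _ _ _) _.
  apply: (@le_trans _ _ (\sum_(r < p) \sum_(k < n) (e / (p * n.+1)%:R))).
    apply: ler_sum => r _; rewrite -sumrB; apply: le_trans (ler_norm_sum _ _ _) _.
    apply: ler_sum => k _; apply: le_trans me.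
    have -> : (p * l + r = p * (2 * m) + r + p * (l - 2 * m))%N.
      by rewrite addnAC -mulnDr subnKC.
    apply: (site_entropy_periodic TI Hcmp tp bp) => //.
    by rewrite (leq_trans (leq_pmull _ p0))// leq_addr.
  rewrite !sumr_const !card_ord -mulrnA -[leLHS]mulr_natr mulrAC.
  rewrite ler_pdivrMr ?ltr0n ?muln_gt0 ?p0// ler_pM2l// ler_nat mulnC leq_mul2l.
  by rewrite leqnSn orbT.
split => //; rewrite (_ : (fun j => _) =
    (fun j => (j%:R)^-1 * \sum_(l < j) block_increment P n l)); first exact: mean_limit.
apply/funext => j; rewrite (set_entropy_rectangle (gibbs_law PG)).
by rewrite (sum_blocks (fun w => \sum_(k < n) site_entropy P p%:Z n w k)).
Qed.

(** Row index [2 * m] of the higher strip is the additional one. Smaller indices are matched from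
    the bottom, the others, raised by one, from the top; [4 * m <= n] makes each match
    legitimate. *)
Lemma column_difference n P P' h w m :
  gibbs L (region n) (strip_frozen t b) P ->
  gibbs L (region n.+1) (strip_frozen t b) P' ->
  (forall V bc' P' i n w k m, gibbs L V bc' P' -> {subset region n <= V} ->
    (2 * m <= w)%N -> (2 * m <= k)%N -> (k.+1 + 2 * m <= n)%N ->
    `|site_entropy P' i n w k - h| <= err m) ->
  (4 * m <= n)%N -> (2 * m <= w)%N ->
  `|\sum_(k < n.+1) site_entropy P' p%:Z n.+1 w k -
    \sum_(k < n) site_entropy P p%:Z n w k - h| <= n.+1%:R * err m.
Proof.
move=> PG PG' Hh mn mw.
have k0P : (2 * m < n.+1)%N by lia.
have E (x y z c : R) : x + y - z - c = (y - z) + (x - c) by ring.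
rewrite (bigD1_ord (Ordinal k0P))//= E.
rewrite -natr1 mulrDl mul1r; apply: le_trans (ler_normD _ _) _; apply: lerD.
  rewrite -sumrB; apply: le_trans (ler_norm_sum _ _ _) _.
  apply: (@le_trans _ _ (\sum_(k < n) err m)); last by rewrite sumr_const card_ord mulr_natl.
  apply: ler_sum => k _; rewrite distrC /bump; case: (leqP (2 * m) k) => mk.
    exact: (site_entropy_top TI Hcmp PG PG').
  by apply: (site_entropy_bottom TI Hcmp PG PG') => //; lia.
by apply: (Hh _ _ _ _ _ _ _ _ PG') => //; lia.
Qed.

Lemma rate_difference n P P' h m :
  gibbs L (region n) (strip_frozen t b) P ->
  gibbs L (region n.+1) (strip_frozen t b) P' ->
  (forall V bc' P' i n w k m, gibbs L V bc' P' -> {subset region n <= V} ->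
    (2 * m <= w)%N -> (2 * m <= k)%N -> (k.+1 + 2 * m <= n)%N ->
    `|site_entropy P' i n w k - h| <= err m) ->
  (4 * m <= n)%N ->
  `|p%:R^-1 * (limn (block_increment P' n.+1) - limn (block_increment P n)) - h|
    <= n.+1%:R * err m.
Proof.
move=> PG PG' Hh mn.
have [c _] := strip_entropy_rate PG; have [c' _] := strip_entropy_rate PG'.
have pp : 0 < p%:R :> R by rewrite ltr0n.
have H : ((fun l => p%:R^-1 * (block_increment P' n.+1 l - block_increment P n l))
    @ \oo --> p%:R^-1 * (limn (block_increment P' n.+1) - limn (block_increment P n)))%classic.
  by apply: cvgM; [exact: cvg_cst|exact: (cvgB c' c)].
apply: (@limit_dist R _ _ _ _ (2 * m) H) => l ml /=.
have -> : p%:R^-1 * (block_increment P' n.+1 l - block_increment P n l) - h =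
    p%:R^-1 * \sum_(r < p) (\sum_(k < n.+1) site_entropy P' p%:Z n.+1 (p * l + r) k -
      \sum_(k < n) site_entropy P p%:Z n (p * l + r) k - h).
  by rewrite sumrB sumr_const card_ord -[h *+ p]mulr_natl sumrB [in RHS]mulrBr mulKf ?gt_eqF.
rewrite normrM gtr0_norm ?invr_gt0// ler_pdivrMl//.
apply: le_trans (ler_norm_sum _ _ _) _.
apply: (@le_trans _ _ (\sum_(r < p) n.+1%:R * err m)); last first.
  by rewrite sumr_const card_ord -[leLHS]mulr_natl.
apply: ler_sum => r _; apply: column_difference => //.
by rewrite (leq_trans ml)// (leq_trans (leq_pmull _ p0))// leq_addr.
Qed.

End StripRate.

End EntropyRates.

(** * Measures on configurations *)

Section LawOfMeasure.
Variables (d : measure_display) (T : measurableType d) (R : realType).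
Variables (mu : probability T R) (G : graph) (A : alphabetType) (e : T -> G -> A).
Hypothesis me : forall v a, measurable [set z | e z v = a].
Implicit Types (U : seq G) (x : G -> A).

Definition agree U x : set T := [set z | forall u, u \in U -> e z u = x u].

(** The map [e] allows configurations on another space, such as strip configurations completed by
    frozen values. *)
Definition law_of U x : R := fine (mu (agree U x)).

Lemma measurable_agree_map U x : measurable (agree U x).
Proof.
elim: U => [|v U IH].
  rewrite (_ : agree _ _ = setT); first exact: measurableT.
  by apply/seteqP; split.
rewrite (_ : agree _ _ = [set z | e z v = x v] `&` agree U x)%classic.
  exact: measurableI.
apply/seteqP; split => z /=.
  by move=> H; split => [|u uU]; apply: H; rewrite inE ?eqxx// uU orbT.
by move=> [zv zU] u; rewrite inE => /orP[/eqP ->//|]; exact: zU.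
Qed.

Lemma law_ofE U x : (law_of U x)%:E = mu (agree U x).
Proof. by rewrite fineK//; apply: fin_num_measure; exact: measurable_agree_map. Qed.

Lemma law_of_is_law : is_law law_of.
Proof.
split.
- move=> x; rewrite /law_of (_ : agree _ _ = setT) ?probability_setT//.
  by apply/seteqP; split.
- by move=> U x; exact: fine_ge0.
- move=> U x y xy; congr (fine (mu _)); apply/seteqP; split => z /= zU u uU.
    by rewrite -xy ?zU.
  by rewrite xy ?zU.
- move=> U U' x UU'; congr (fine (mu _)); apply/seteqP; split => z /= zU u uU.
    by apply: zU; rewrite UU'.
  by apply: zU; rewrite -UU'.
- move=> v U x vU; apply: EFin_inj; rewrite -sumEFin law_ofE.
  under eq_bigr do rewrite law_ofE.
  rewrite -measure_bigU; first last.
  + move=> a b [z [/= za zb]].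
    by rewrite -(upd_eq x v a) -za ?mem_head// zb ?mem_head// upd_eq.
  + by move=> a; exact: measurable_agree_map.
  congr (mu _); rewrite -bigcup_seq; apply/seteqP; split => z /=.
    move=> [a _ /= za] u uU; rewrite za ?inE ?uU ?orbT// upd_neq//.
    by apply: contraNneq vU => <-.
  move=> zU; exists (e z v) => /=; first exact: mem_index_enum.
  by move=> u; rewrite inE /upd; case: eqP => [->//|_ /=]; exact: zU.
Qed.

End LawOfMeasure.

Section MarkovLaw.
Variables (R : realType) (G : graph) (A : alphabetType) (L : specification R G A).
Variable mu : probability (cfg G A) R.
Hypothesis muL : associated L mu.

Lemma cylE (S : seq G) (x : G -> A) :
  cyl (restr [fset u in S]%fset x) = agree (fun z : cfg G A => z : G -> A) S x.
Proof. exact: cyl_restrE. Qed.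

Definition cfg_law := law_of mu (fun z : cfg G A => z : G -> A).

Lemma cfg_law_is_law : is_law cfg_law.
Proof. by apply: law_of_is_law => v a; exact: measurable_coord. Qed.

(** The Markov property shrinks the condition from [T] to the boundary of [S], where the
    specification applies. Null patterns are treated apart: both sides vanish. *)
Lemma cfg_law_markov S T x : (forall u, u \in S -> u \notin T) ->
  {subset bd S <= T} -> cfg_law (S ++ T) x = cfg_law T x * spec_at L S x.
Proof.
move=> ST bT; have PL := cfg_law_is_law.
have [T0|T0] := eqVneq (cfg_law T x) 0.
  rewrite T0 mul0r; apply/eqP; rewrite eq_le (law_ge0 PL) andbT -T0.
  exact: law_catr.
have [mrf assoc] := muL.
pose S' := [fset u in S]%fset; pose T' := [fset u in T]%fset.
have sT : (boundary S' `<=` T')%fset.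
  by apply/fsubsetP => u ub; rewrite inE; exact: bT.
have dis : [disjoint T' & S']%fset.
  by apply/fdisjointP => u; rewrite !inE; apply: contraL; exact: ST.
have muT : mu (cyl (restr T' x)) = (cfg_law T x)%:E.
  by rewrite cylE law_ofE// => v a; exact: measurable_coord.
have muT0 : mu (cyl (restr T' x)) != 0%E by rewrite muT eqe.
have bE : subrestr sT (restr T' x) = restr (boundary S') x.
  by apply/ffunP => u; rewrite !ffunE.
have := mrf S' (restr S' x) T' sT (restr T' x) dis muT0.
rewrite bE assoc; last first.
  apply: (@lt_le_trans _ _ (mu (cyl (restr T' x)))).
    by rewrite muT lte_fin lt_def T0 (law_ge0 PL).
  apply: le_measure; rewrite ?inE; [exact: measurable_cyl|exact: measurable_cyl|].
  move=> z /= /ffunP zx; apply/ffunP => u; rewrite !ffunE.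
  have uT : val u \in T' by exact: (fsubsetP sT _ (valP u)).
  by have := zx [` uT]%fset; rewrite !ffunE.
rewrite /spec_at => ->; rewrite /condp muT /= mulrC divfK//.
congr (fine (mu _)); rewrite !cylE; apply/seteqP; split => z /=.
  by move=> H; split=> u uS; apply: H; rewrite mem_cat uS ?orbT.
by move=> [zS zT] u; rewrite mem_cat => /orP[/zS|/zT].
Qed.

End MarkovLaw.

Lemma plane_gibbs (R : realType) (A : alphabetType) (L : specification R Z2 A)
    (mu : probability (cfg Z2 A) R) (bc : Z2 -> A) :
  associated L mu -> gibbs L xpredT bc (cfg_law mu).
Proof.
move=> muL; split=> //; first exact: cfg_law_is_law.
by move=> S T x _; exact: cfg_law_markov.
Qed.

(** * Strip measures as laws on the plane *)

Section StripLaw.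
Variables (R : realType) (A : alphabetType) (L : specification R Z2 A).
Variables (n : int) (t b : int -> A) (nu : probability (cfg (strip 1 n) A) R).
Implicit Types (U S T : seq Z2) (x : Z2 -> A).

Definition embed (z : cfg (strip 1 n) A) (u : Z2) : A :=
  if insub u is Some u' then z u' else strip_frozen t b u.

Lemma measurable_embed v a : measurable [set z | embed z v = a].
Proof.
rewrite /embed; case: insubP => [u _ _|_]; first exact: measurable_coord.
have [->|ne] := eqVneq (strip_frozen t b v) a.
  rewrite (_ : [set _ | _] = setT)%classic; first exact: measurableT.
  by apply/seteqP; split.
rewrite (_ : [set _ | _] = set0)%classic; first exact: measurable0.
by apply/seteqP; split => // z /= /eqP; rewrite (negbTE ne).
Qed.

Definition strip_law := law_of nu embed.

Definition to_strip U : seq (strip 1 n) := pmap insub U.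

Lemma mem_to_strip U (u : strip 1 n) : (u \in to_strip U) = (val u \in U).
Proof. by rewrite mem_pmap_sub. Qed.

Lemma strip_law_out U x u : u \in U -> ~~ in_strip 1 n u ->
  x u <> strip_frozen t b u -> strip_law U x = 0.
Proof.
move=> uU uV xu; rewrite /strip_law /law_of (_ : agree _ _ _ = set0)%classic.
  by rewrite measure0.
apply/seteqP; split => // z /= /(_ _ uU); rewrite /embed insubN// => zu.
by apply: xu.
Qed.

Lemma strip_lawE U x :
  (forall u, u \in U -> ~~ in_strip 1 n u -> x u = strip_frozen t b u) ->
  strip_law U x = cfg_law nu (to_strip U) (fun u => x (val u)).
Proof.
move=> xU; rewrite /strip_law /cfg_law /law_of; congr (fine (nu _)).
apply/seteqP; split => z /= zU u.
  by rewrite mem_to_strip => /zU; rewrite /embed valK.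
move=> uU; rewrite /embed; case: insubP => [u' _ uE|uV]; last by rewrite xU.
by rewrite -uE; apply: zU; rewrite mem_to_strip uE.
Qed.

Hypothesis n0 : 0 <= n.
Hypothesis nuL : associated (strip_spec L 1 n t b) nu.

Lemma mem_bd_to_strip S (u : strip 1 n) : {subset S <= in_strip 1 n} ->
  (u \in bd (to_strip S)) = (val u \in bd S).
Proof.
move=> SV; apply/mem_bd/mem_bd => -[uS [w wS wu]].
  split; first by rewrite -mem_to_strip.
  by exists (val w); rewrite -?mem_to_strip.
split; first by rewrite mem_to_strip.
exists (exist _ w (SV _ wS)); first by rewrite mem_to_strip.
exact: wu.
Qed.

Lemma restr_extend (D : {fset strip 1 n}) (x : Z2 -> A) (u : strip 1 n) :
  u \in D -> extend (restr D (fun u => x (val u))) (val u) = x (val u).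
Proof.
by move=> uD; rewrite (extendE _ [` uD]%fset) ffunE.
Qed.

(** A boundary site of [S] in the plane lies in the strip or on one of the two rows next to it,
    where a consistent [x] carries [t] or [b]. *)
Lemma strip_spec_at S T x : {subset S <= in_strip 1 n} -> {subset bd S <= T} ->
  (forall u, u \in T -> ~~ in_strip 1 n u -> x u = strip_frozen t b u) ->
  spec_at (strip_spec L 1 n t b) (to_strip S) (fun u => x (val u)) = spec_at L S x.
Proof.
move=> SV bT xT; rewrite /spec_at /= /strip_fun /strip_bc.
have SE : unstrip [fset u in to_strip S]%fset = [fset u in S]%fset.
  apply/fsetP => u; rewrite inE; apply/imfsetP/idP => /= [[w]|uS].
    by rewrite inE mem_to_strip => wS ->.
  by exists (exist _ u (SV _ uS)); rewrite ?inE ?mem_to_strip.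
set X := fun v : Z2 => _; set Y := extend _.
have -> : L (unstrip [fset u in to_strip S]%fset) (restr _ X) (restr _ Y) =
    L [fset u in S]%fset (restr _ X) (restr _ Y) by rewrite SE.
congr (L _ _); apply/ffunP => u; rewrite !ffunE; last first.
  have := valP u; rewrite inE => uS.
  apply: (@restr_extend _ x (exist (in_strip 1 n) (val u) (SV _ uS))).
  by rewrite inE mem_to_strip.
have ub : val u \in bd S by exact: valP u.
have uT := bT _ ub; rewrite /X; move: (val u) ub uT => {}u ub uT.
case: ifPn => [/eqP un|un].
  rewrite xT//; last by rewrite /in_strip un; lia.
  (* [0 <= n] puts row [n + 1] above row 0, so [strip_frozen] reads [t] there. *)
  by rewrite /strip_frozen ifF// un; lia.
case: ifPn => [/eqP u0|u0].
  rewrite xT//; last by rewrite /in_strip u0; lia.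
  by rewrite /strip_frozen ifT// u0; lia.
have uV : in_strip 1 n u.
  have /mem_bd[_ [w wS wu]] := ub; have := SV _ wS.
  clear - wu un u0; case: u w un u0 wu => [u1 u2] [w1 w2].
  by rewrite unfold_in /in_strip /= /Z2adj /=; lia.
apply: (@restr_extend _ x (exist (in_strip 1 n) u uV)).
by have := mem_bd_to_strip (exist (in_strip 1 n) u uV) SV => /= ->.
Qed.

Lemma strip_gibbs (m : nat) : m%:Z = n -> gibbs L (region m) (strip_frozen t b) strip_law.
Proof.
move=> mn; have RV u : region m u = in_strip 1 n u by rewrite /region mn.
have PL : is_law strip_law by apply: law_of_is_law => v a; exact: measurable_embed.
split=> //; last first.
  by move=> U x u uU; rewrite RV; exact: strip_law_out.
move=> S T x SV ST bT.
have SV' : {subset S <= in_strip 1 n} by move=> u /SV uV; rewrite -[_ \in _]/(in_strip 1 n u) -RV.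
have [xT|] := pselect (forall u, u \in T -> ~~ in_strip 1 n u -> x u = strip_frozen t b u);
    last first.
  move=> /existsNP[u /not_implyP[uT /not_implyP[uV xu]]].
  rewrite !(@strip_law_out _ _ u)// ?mul0r// mem_cat uT orbT//.
rewrite !strip_lawE//; last first.
  by move=> u; rewrite mem_cat => /orP[/SV' uV /negP/(_ uV)|]; [|exact: xT].
rewrite -(strip_spec_at SV' bT xT) -(cfg_law_markov nuL).
- by rewrite /to_strip pmap_cat.
- by move=> u; rewrite !mem_to_strip; exact: ST.
- by move=> u; rewrite mem_bd_to_strip// mem_to_strip; exact: bT.
Qed.

End StripLaw.

(** * Block entropies as iterated sums *)

Section Reindexing.
Variables (R : realType) (G : graph) (A : alphabetType).

Lemma sumc_delta (l : seq G) (x z : G -> A) : uniq l ->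
  (forall u, u \notin l -> z u = x u) ->
  sumc l (fun y => ind (y = z)) x = 1 :> R.
Proof.
elim: l x => [|v l IH] x.
  move=> _ zx; rewrite /sumc /= indT//; apply/funext => u.
  by rewrite zx.
rewrite cons_uniq => /andP[vl ul] zx.
rewrite sumc_cons (bigD1 (z v))//= IH//; last first.
  move=> u ul'; rewrite /upd; case: eqVneq => [->//|uv].
  by apply: zx; rewrite inE negb_or uv.
rewrite big1 ?addr0// => a az.
rewrite /sumc -[RHS](mul0r (sumc l (fun=> 0) (upd x v a))) -itsumZ.
apply: eq_itsum => y Hy; rewrite mul0r; apply: indF => yz.
by move: az; rewrite -yz Hy// upd_eq eqxx.
Qed.

(** Insert the sum of the indicators of all encoded configurations, exactly one of which is 1, and
    exchange the sums. *)
Lemma sumc_reindex (I : finType) (enc : I -> G -> A) (l : seq G) g (x : G -> A) :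
  uniq l -> injective enc -> (forall w u, u \notin l -> enc w u = x u) ->
  (forall y, (forall u, u \notin l -> y u = x u) -> exists w, enc w = y) ->
  sumc l g x = \sum_w g (enc w) :> R.
Proof.
move=> ul inj encx surj.
transitivity (\sum_w sumc l (fun y => g (enc w) * ind (y = enc w)) x).
  rewrite /sumc -itsum_sum; apply: eq_itsum => y /surj[w <-].
  rewrite (bigD1 w)//= indT// mulr1 big1 ?addr0// => w' w'w.
  by rewrite indF ?mulr0// => /inj ww'; rewrite ww' eqxx in w'w.
apply: eq_bigr => w _; rewrite /sumc itsumZ -/(sumc _ _ _) sumc_delta ?mulr1//.
exact: encx.
Qed.

End Reindexing.

Section BlockEntropies.
Variables (R : realType) (A : alphabetType).

Lemma block_entropyE (V : choiceType) (B : alphabetType) (mu : probability (cfg V B) R)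
    (S : {fset V}) : block_entropy mu S = 
    \sum_(w : {ffun S -> B}) entfun (fine (mu (cyl w))).
Proof. by rewrite /block_entropy -sumrN. Qed.

Lemma plane_block_entropy (mu : probability (cfg Z2 A) R) (j1 j2 : nat) :
  block_entropy mu (fbox 1 j1%:Z 1 j2%:Z : {fset Z2}) =
  set_entropy (cfg_law mu) (rectangle 1 j2 j1).
Proof.
set S : {fset Z2} := fbox _ _ _ _.
have SE u : (u \in S) = (u \in rectangle 1 j2 j1).
  rewrite /S /fbox in_fsetM !mem_fint mem_rectangle.
  by rewrite [X in _ = X && _](_ : _ = (1 <= u.1 <= j1%:Z))//; lia.
pose enc (w : {ffun S -> A}) (u : Z2) : A :=
  if insub u is Some u' then w u' else point.
have encE w (u : S) : enc w (val u) = w u by rewrite /enc valK.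
rewrite block_entropyE /set_entropy (sumc_reindex (enc := enc)).
- apply: eq_bigr => w _; congr entfun; congr (fine (mu _)).
  apply/seteqP; split => z /=.
    move=> zw u; rewrite -SE => uS; rewrite -[u]/(val [` uS]%fset) encE -zw ffunE//.
  by move=> H; apply/ffunP => u; rewrite ffunE -encE; apply: H; rewrite -SE; exact: valP.
- exact: rectangle_uniq.
- by move=> w w' ww'; apply/ffunP => u; rewrite -!encE ww'.
- by move=> w u; rewrite -SE /enc => uS; rewrite insubN.
- move=> y Hy; exists (restr S y); apply/funext => u; rewrite /enc.
  by case: insubP => [u' _ <-|uS]; [rewrite ffunE|rewrite Hy// -SE].
Qed.

Lemma block_index_range (p v j i : int) : 0 < p -> 0 <= i < p ->
  (p <= p * v + i < p + p * j) = (1 <= v <= j).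
Proof.
move=> p0 /andP[i0 ip]; apply/idP/idP => /andP[H1 H2]; apply/andP.
  split; rewrite -ltzD1 -(ltr_pM2l p0) mulrDr mulr1; lia.
have := ler_wpM2l (ltW p0) H1; have := ler_wpM2l (ltW p0) H2; rewrite mulr1.
by split; lia.
Qed.

(** Letter v of the power code consists of the columns p v, ..., p v + p - 1, so letters 1, ..., j
    fill [p * j] columns from column [p] on. *)
Lemma strip_block_entropy (n : int) (m p j : nat) (t b : int -> A)
    (nu : probability (cfg (strip 1 n) A) R) : (0 < p)%N -> m%:Z = n ->
  block_entropy (higher_power p (column_measure nu)) (fint 1 j%:Z) =
  set_entropy (strip_law t b nu) (rectangle p%:Z m (p * j)).
Proof.
move=> p0 mn; set S := fint 1 j%:Z.
(* Euclidean division of the column by [p] yields the letter and the position in it; [point] is the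
   base configuration of [set_entropy] off the rectangle. *)
pose enc (w : {ffun S -> {ffun 'I_p -> column A 1 n}}) (u : Z2) : A :=
  if insub (u.1 %/ p%:Z)%Z is Some v then
    if insub `|(u.1 %% p%:Z)%Z|%N is Some i then
      if insub u.2 is Some r then w v i r else point
    else point
  else point.
have pz : p%:Z != 0 by lia.
have encE w (v : S) (i : 'I_p) (r : fint 1 n) :
    enc w (p%:Z * val v + i%:Z, val r) = w v i r.
  have e1 : ((p%:Z * val v + i%:Z) %/ p%:Z)%Z = val v.
    rewrite mulrC divzMDl// divz_small ?addr0//; have := ltn_ord i; lia.
  have e2 : `|((p%:Z * val v + i%:Z) %% p%:Z)%Z|%N = val i.
    by rewrite mulrC modzMDl modz_small//; have := ltn_ord i; lia.
  by rewrite /enc /= e1 e2 !valK.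
have mem_rect u : reflect (exists (v : S) (i : 'I_p) (r : fint 1 n),
    u = (p%:Z * val v + i%:Z, val r)) (u \in rectangle p%:Z m (p * j)).
  apply: (iffP idP) => [|[v [i [r ->]]]]; last first.
    rewrite mem_rectangle /=; have := ltn_ord i.
    have := valP v; have := valP r; rewrite !mem_fint mn => /andP[r1 r2] /andP[v1 v2] ip.
    apply/andP; split; last by apply/andP.
    by rewrite PoszM block_index_range ?v1 ?v2//; lia.
  rewrite mem_rectangle mn; case: u => c r /= /andP[/andP[c1 c2] rn].
  have c0 := divz_eq c p%:Z.
  have m0 : 0 <= (c %% p%:Z)%Z by exact: modz_ge0.
  have m1 : (c %% p%:Z)%Z < p%:Z by rewrite ltz_mod.
  have vS : (c %/ p%:Z)%Z \in S.
    have pp : 0 < p%:Z by lia.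
    have ir : 0 <= (c %% p%:Z)%Z < p%:Z by rewrite m0 m1.
    rewrite mem_fint -(block_index_range _ _ pp ir) [p%:Z * _]mulrC -c0 c1.
    by rewrite -PoszM.
  have ip : (`|(c %% p%:Z)%Z| < p)%N by lia.
  have rS : r \in fint 1 n by rewrite mem_fint.
  exists [` vS]%fset, (Ordinal ip), [` rS]%fset; congr pair => /=.
  rewrite {1}c0 mulrC; congr (_ + _); lia.
have enc_out w u : u \notin rectangle p%:Z m (p * j) -> enc w u = point.
  move=> uR; rewrite /enc; case: insubP => // v _ vE.
  case: insubP => // i _ iE; case: insubP => // r _ rE.
  case/negP: uR; apply/mem_rect; exists v, i, r.
  case: u vE iE rE => c r' /= -> iE ->; congr pair.
  rewrite {1}(divz_eq c p%:Z) mulrC; congr (_ + _); rewrite iE.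
  by rewrite gez0_abs// modz_ge0.
rewrite block_entropyE /set_entropy (sumc_reindex (enc := enc)).
- apply: eq_bigr => w _; congr entfun; congr (fine (nu _)).
  have emb z (v : S) (i : 'I_p) (r : fint 1 n) :
      embed t b z (p%:Z * val v + i%:Z, val r) =
      power_code p (columns z) (val v) i r.
    rewrite !ffunE /embed insubT; first exact: in_strip_fint.
    by move=> H; congr (z _); apply: val_inj.
  apply/seteqP; split => z /=.
    move=> zw u /mem_rect[v [i [r ->]]]; rewrite encE emb.
    by move/ffunP: zw => /(_ v); rewrite ffunE => ->.
  move=> H; apply/ffunP => v; rewrite ffunE; apply/ffunP => i; apply/ffunP => r.
  by rewrite -emb -encE; apply: H; apply/mem_rect; exists v, i, r.
- exact: rectangle_uniq.
- move=> w w' ww'; apply/ffunP => v; apply/ffunP => i; apply/ffunP => r.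
  by rewrite -!encE ww'.
- exact: enc_out.
- move=> y Hy; exists [ffun v : S => [ffun i : 'I_p => [ffun r : fint 1 n =>
    y (p%:Z * val v + i%:Z, val r)]]].
  apply/funext => u; case: (boolP (u \in rectangle p%:Z m (p * j))) => uR.
    by have /mem_rect[v [i [r ->]]] := uR; rewrite encE !ffunE.
  by rewrite enc_out// Hy.
Qed.

End BlockEntropies.

(** * The single-site bound by q *)

Section SingleSite.
Variables (R : realType) (A : alphabetType) (L : specification R Z2 A).

Lemma sum_pred_le_tv (I : finType) (f g : I -> R) (E : pred I) :
  \sum_i f i = \sum_i g i -> \sum_(i | E i) (f i - g i) <= tv f g.
Proof.
move=> fg; have S0 : \sum_i (f i - g i) = 0 by rewrite sumrB fg subrr.
rewrite /tv ler_pdivlMl// mulr_natl mulr2n.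
rewrite [leRHS](bigID E) /=; apply: lerD.
  by apply: ler_sum => i _; exact: ler_norm.
have -> : \sum_(i | E i) (f i - g i) = \sum_(i | ~~ E i) (g i - f i).
  move: S0; rewrite (bigID E) /= => /eqP; rewrite addr_eq0 => /eqP ->.
  by rewrite -sumrN; apply: eq_bigr => i _; rewrite opprB.
by apply: ler_sum => i _; rewrite distrC; exact: ler_norm.
Qed.

Lemma tv_le1 (I : finType) (f g : I -> R) : (forall i, 0 <= f i) -> (forall i, 0 <= g i) ->
  \sum_i f i = 1 -> \sum_i g i = 1 -> tv f g <= 1.
Proof.
move=> f0 g0 f1 g1; rewrite /tv ler_pdivrMl// mulr1.
apply: (@le_trans _ _ (\sum_i (f i + g i))); last by rewrite big_split /= f1 g1.
apply: ler_sum => i _; apply: le_trans (ler_normB _ _) _.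
by rewrite !ger0_norm.
Qed.

Let site_tv v d d' := tv (L [fset v]%fset d) (L [fset v]%fset d').
Let site_max (g : Z2) : R := \big[Num.max/0]_(d : {ffun boundary [fset g]%fset -> A})
      \big[Num.max/0]_(d' : {ffun boundary [fset g]%fset -> A}) site_tv d d'.

Lemma site_tv_le1 v d d' : @site_tv v d d' <= 1.
Proof. by apply: tv_le1; rewrite ?spec_sum1// => i; exact: spec_ge0. Qed.

Lemma site_tv_qspec v d d' : @site_tv v d d' <= qspec L.
Proof.
apply: (@le_trans _ _ (site_max v)).
  apply: (@le_trans _ _ (\big[Num.max/0]_d' site_tv d d')); first exact: le_bigmax.
  exact: (le_bigmax _ (fun d => \big[Num.max/0]_d' site_tv d d')).
apply: ub_le_sup; last by exists v.
exists 1 => _ [g _ <-]; apply: bigmax_le => // d1 _; apply: bigmax_le => // d2 _.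
exact: site_tv_le1.
Qed.

Lemma qspec_ge0 : 0 <= qspec L.
Proof.
pose d : {ffun boundary [fset ((0, 0) : Z2)]%fset -> A} := [ffun=> point].
apply: le_trans (site_tv_qspec d d).
by rewrite /site_tv /tv mulr_ge0 ?invr_ge0// sumr_ge0.
Qed.

(** Total variation bounds the difference on any event, and configurations on one site are
    identified with letters. *)
Lemma spec_at_site v x y (E : pred A) :
  \sum_(a | E a) (spec_at L [:: v] (upd x v a) - spec_at L [:: v] (upd y v a)) <= qspec L.
Proof.
pose S : {fset Z2} := [fset u in [:: v]]%fset.
have SE : S = [fset v]%fset by apply/fsetP => u; rewrite in_fset1 in_fset mem_seq1.
have spE z a : spec_at L [:: v] (upd z v a) =
    L [fset v]%fset (restr _ z) [ffun=> a].
  rewrite /spec_at -/S SE; congr (L _ _); apply/ffunP => u; rewrite !ffunE.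
    rewrite upd_neq//; have := valP u; rewrite in_fsetD => /andP[].
    by rewrite inE.
  by have /fset1P -> := valP u; rewrite upd_eq.
have v1 : v \in [fset v]%fset by rewrite inE.
have vU (u : [fset v]%fset) : u = [` v1]%fset.
  by apply: val_inj; have /fset1P := valP u.
under eq_bigr do rewrite !spE.
apply: le_trans (site_tv_qspec (restr _ x) (restr _ y)).
pose E' : pred {ffun [fset v]%fset -> A} := fun w => E (w [` v1]%fset).
apply: le_trans (@sum_pred_le_tv _ _ _ E' _); last by rewrite !spec_sum1.
rewrite le_eqVlt; apply/orP; left; apply/eqP.
rewrite [RHS](reindex (fun a : A => [ffun=> a] : {ffun [fset v]%fset -> A})).
  by apply: eq_bigl => a; rewrite /E' ffunE.
exists (fun w : {ffun [fset v]%fset -> A} => w [` v1]%fset) => [a _|w _]; first by rewrite ffunE.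
by apply/ffunP => u; rewrite ffunE (vU u).
Qed.

End SingleSite.

(** * Explicit exponential error bounds *)

Section GeometricError.
Variables (R : realType) (A : alphabetType).

Lemma entropy_error_geometric (K r : R) : 0 < K -> 0 < r < 1 ->
  exists Q b : R, [/\ 0 < Q, 0 < b < 1 & forall m, entropy_error A K r m <= Q * b ^+ m].
Proof.
move=> K0 /andP[r0 r1].
(* [b] is the fourth root of [r]: the square root leaves b^(2m), and in the other term half of
   b^(4m) absorbs the area (2m + 1)^2. *)
pose a := Num.sqrt r; pose b := Num.sqrt a.
have a0 : 0 < a by rewrite sqrtr_gt0.
have b0 : 0 < b by rewrite sqrtr_gt0.
have aE : a = b ^+ 2 by rewrite sqr_sqrtr// ltW.
have rE : r = a ^+ 2 by rewrite sqr_sqrtr// ltW.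
have a1 : a < 1 by rewrite -sqrtr1 ltr_sqrt.
have b1 : b < 1 by rewrite -sqrtr1 ltr_sqrt.
have b01 : 0 < b < 1 by rewrite b0.
have [C C0 HC] := linear_geometric_bound b01.
have M0 : 0 <= #|A|%:R :> R by rewrite ler0n.
exists (4 * #|A|%:R * Num.sqrt K + #|A|%:R * (C ^+ 2 * K) + 1), b; split => //.
  by rewrite ltr_wpDl// addr_ge0// !mulr_ge0// ?sqrtr_ge0 ?exprn_ge0// ltW.
move=> m; have bm : 0 < b ^+ m by exact: exprn_gt0.
have bm1 : b ^+ m <= 1 by rewrite exprn_ile1// ltW.
have sE : Num.sqrt (K * r ^+ m) = Num.sqrt K * (b ^+ m) ^+ 2.
  rewrite sqrtrM ?ltW//; congr (_ * _).
  rewrite (_ : r ^+ m = ((b ^+ m) ^+ 2) ^+ 2); first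
    by rewrite sqrtr_sqr ger0_norm// exprn_ge0 ?ltW.
  by rewrite rE aE -!exprM mulnC mulnA.
have rmE : r ^+ m = (b ^+ m) ^+ 4 by rewrite rE aE -!exprM mulnC.
have Cm : ((2 * m).+1 ^ 2)%:R * (b ^+ m) ^+ 2 <= C ^+ 2.
  by rewrite natrX -exprMn ler_sqr ?nnegrE ?mulr_ge0 ?(ltW bm) ?(ltW C0).
rewrite /entropy_error sE rmE.
set x := b ^+ m in bm bm1 Cm *; set y := ((2 * m).+1 ^ 2)%:R in Cm *.
have x2 : x ^+ 2 <= x by rewrite expr2 ler_piMl// ltW.
have sK : 0 <= Num.sqrt K by rewrite sqrtr_ge0.
rewrite [leRHS]mulrDl mul1r [X in _ <= X + _]mulrDl; apply: ler_wpDr; first exact: ltW.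
apply: lerD.
  by rewrite mulrA ler_wpM2l// !mulr_ge0.
rewrite -mulrA -[leRHS]mulrA ler_wpM2l//.
have -> : y * (K * x ^+ 4) = (y * x ^+ 2) * K * x ^+ 2 by ring.
have y0 : 0 <= y by exact: ler0n.
have x20 : 0 <= x ^+ 2 by rewrite exprn_ge0// ltW.
apply: ler_pM => //; first by rewrite mulr_ge0 ?(ltW K0)// mulr_ge0.
by rewrite ler_pM2r.
Qed.

Lemma geometric_small (Q b : R) : 0 < Q -> 0 < b < 1 ->
  forall e, 0 < e -> exists m, Q * b ^+ m <= e.
Proof.
move=> Q0 b01 e e0; have [C C0 HC] := linear_geometric_bound b01.
exists (Num.trunc (Q * C / e)); set m := Num.trunc _.
have H : Q * C / e < m.+1%:R by exact: truncnS_gt.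
have {}H : Q * C < m.+1%:R * e by rewrite -ltr_pdivrMr.
have bm : 0 < b ^+ m by rewrite exprn_gt0//; case/andP: b01.
have m1 : m.+1%:R * b ^+ m <= C.
  by apply: le_trans (HC m); rewrite ler_pM2r// ler_nat; lia.
have mp : 0 < m.+1%:R :> R by rewrite ltr0n.
rewrite -(ler_pM2l mp); apply: le_trans (ltW H).
by rewrite mulrCA ler_pM2l.
Qed.

Lemma error_exponential (Q b : R) : 0 < Q -> 0 < b < 1 ->
  exists Q' C : R, [/\ 0 < Q', 0 < C &
    forall n : nat, n.+1%:R * (Q * b ^+ (n %/ 4)) < Q' * expR (- (C * n%:R))].
Proof.
move=> Q0 /andP[b0 b1]; pose a := Num.sqrt b.
have a0 : 0 < a by rewrite sqrtr_gt0.
have bE : b = a ^+ 2 by rewrite sqr_sqrtr// ltW.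
have a1 : a < 1 by rewrite -sqrtr1 ltr_sqrt.
have a01 : 0 < a < 1 by rewrite a0.
have [D D0 HD] := linear_geometric_bound a01.
(* Half of the decay of [b] absorbs the factor [n.+1], the other half gives the exponential; the 4
   comes from [n %/ 4]. *)
pose C := - ln a / 4.
have la : ln a < 0 by exact: ln_lt0.
exists (4 * Q * D / a + 1), C; split.
- by rewrite ltr_wpDl// divr_ge0 ?(ltW a0)// !mulr_ge0// ltW.
- by rewrite /C; lra.
move=> n; set m := (n %/ 4)%N.
have nm : (n < 4 * m.+1)%N by rewrite mulnC ltn_ceil.
have am : 0 < a ^+ m by exact: exprn_gt0.
have E1 : a ^+ m.+1 <= expR (- (C * n%:R)).
  rewrite -{1}(@lnK R a) ?posrE// -expRM_natl ler_expR /C.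
  have : n%:R <= 4 * m.+1%:R :> R by rewrite -natrM ler_nat ltnW.
  move=> H; have : ln a * (4 * m.+1%:R) <= ln a * n%:R by rewrite ler_nM2l.
  lra.
rewrite mulrDl mul1r; apply: ltr_pwDr; first exact: expR_gt0.
apply: (@le_trans _ _ (4 * Q * D * a ^+ m)).
  have n4 : n.+1%:R <= 4 * (2 * m).+1%:R :> R by rewrite -natrM ler_nat (leq_trans nm)//
    leq_mul2l ltnS leq_pmull.
  rewrite bE exprAC expr2; set x := a ^+ m in am *.
  apply: (@le_trans _ _ (4 * (2 * m).+1%:R * (Q * (x * x)))).
    by rewrite ler_wpM2r// !mulr_ge0// ltW.
  have -> : 4 * (2 * m).+1%:R * (Q * (x * x)) = 4 * Q * ((2 * m).+1%:R * x) * x by ring.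
  rewrite ler_pM2r// ler_pM2l ?mulr_gt0//; exact: HD.
rewrite -[leRHS]mulrA; apply: ler_wpM2l; first by rewrite !mulr_ge0// ltW.
by rewrite mulrC ler_pdivlMr// -exprSr.
Qed.

End GeometricError.

(** [p_c] is the supremum of the parameters without percolation; an empty set would have supremum 0,
    which is excluded by [0 <= q]. *)
Lemma below_p_c (R : realType) (q : R) : 0 <= q -> q < p_c R Z2 ->
  exists p, [/\ q < p, p <= 1 & exists2 P : probability (cfg Z2 bool) R,
    is_bernoulli p P & P (@percolates Z2) = 0%E].
Proof.
move=> q0 qp; apply: contrapT => H.
suff : p_c R Z2 <= q by rewrite leNgt qp.
rewrite /p_c; set S := (X in sup X).
have [S0|S0] := pselect (S !=set0)%classic; last first.
  by have /nonemptyPn -> := S0; rewrite sup0.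
apply: sup_le_ub => // p [/andP[p0 p1] HP]; rewrite leNgt; apply/negP => qp'.
by apply: H; exists p.
Qed.

Lemma gt1_int_nat (n : int) : 1 < n ->
  exists m : nat, [/\ m%:Z = n, m.+1%:Z = n + 1, 0 <= n & 0 <= n + 1].
Proof. by case: n => // m m1; exists m; split => //; lia. Qed.

Theorem theorem3p22 (R : realType) (A : alphabetType) (L : specification R Z2 A)
    (mu : probability (cfg Z2 A) R) (N : int) (p : nat) (t b : int -> A) :
  (1 < #|A|)%N ->
  valid L ->
  translation_invariant L ->
  qspec L < p_c R Z2 ->
  associated L mu ->
  (0 < p)%N ->
  (forall i : int, t (i + p%:Z) = t i) ->
  (forall i : int, b (i + p%:Z) = b i) ->
  (forall n : int, N < n -> compatible L 1 n t b) ->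
  exists Q C : R, 0 < Q /\ 0 < C /\
    forall n : int, N < n ->
    forall (nu : probability (cfg (strip 1 n) A) R)
           (nu' : probability (cfg (strip 1 (n + 1)) A) R),
    associated (strip_spec L 1 n t b) nu ->
    associated (strip_spec L 1 (n + 1) t b) nu' ->
    `| p%:R^-1 * (entropy1 (higher_power p (column_measure nu'))
                  - entropy1 (higher_power p (column_measure nu)))
       - entropy2 mu | < Q * expR (- (C * n%:~R)).
Proof.
move=> _ _ TI qpc muL p0 tp bp comp.
have q0 := qspec_ge0 L.
have [pc [qpc' pc1 [P PB P0]]] := below_p_c q0 qpc.
have [K [r [K0 r01 decay]]] := exponential_decay q0 qpc' pc1 PB P0.
have q01 : 0 <= qspec L <= 1 by rewrite q0 ltW// (lt_le_trans qpc').
have [r0 _] := andP r01.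
have Hcmp := cond_entropy_comparison q01 (spec_at_site L) K0 (ltW r0) decay.
have [Q [a [Q0 a01 HQ]]] := entropy_error_geometric A K0 r01.
have small e : 0 < e -> exists m, entropy_error A K r m <= e.
  move=> e0; have [m Hm] := geometric_small Q0 a01 e0.
  by exists m; exact: le_trans (HQ m) Hm.
have [Q' [C [Q0' C0 HC]]] := error_exponential Q0 a01.
exists Q', C; split => //; split => // n Nn nu nu' nuL nuL'.
(* Compatibility provides [1 < n], so the height is a natural number. *)
have [n1 _] := comp n Nn.
have [m [mn mn' n0 n0']] := gt1_int_nat n1.
have PG := strip_gibbs n0 nuL mn.
have PG' := strip_gibbs n0' nuL' mn'.
have PM : gibbs L xpredT (fun=> point) (cfg_law mu) by exact: plane_gibbs.
have [h [h01 Hh]] := site_entropy_limit TI Hcmp small PM.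
have -> : entropy2 mu = h.
  rewrite /entropy2; under eq_fun do rewrite plane_block_entropy.
  apply: cvg_lim => //; apply: (plane_entropy_rate small PM h01).
  by move=> i n2 w k m2; apply: (Hh _ _ _ _ _ _ _ _ PM).
have rate (n2 : int) (m2 : nat) (nu2 : probability (cfg (strip 1 n2) A) R) :
    m2%:Z = n2 -> gibbs L (region m2) (strip_frozen t b) (strip_law t b nu2) ->
    entropy1 (higher_power p (column_measure nu2)) =
    limn (block_increment p (strip_law t b nu2) m2).
  move=> mn2 PG2; rewrite /entropy1.
  under eq_fun do rewrite (strip_block_entropy _ t b _ p0 mn2).
  by apply: cvg_lim => //; have [_] := strip_entropy_rate TI Hcmp small p0 tp bp PG2.
rewrite (rate _ _ _ mn PG) (rate _ _ _ mn' PG').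
have m4 : (4 * (m %/ 4) <= m)%N by rewrite mulnC leq_trunc_div.
apply: le_lt_trans (rate_difference TI Hcmp small p0 tp bp PG PG' Hh m4) _.
rewrite -mn; apply: le_lt_trans (HC m).
by rewrite ler_pM2l ?ltr0n.
Qed.
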